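(* If either $f\in BV(\mathbb{R}^n)$ or $f\in bv(\mathbb{R}^n)\cap L^\infty(\mathbb{R}^n)$, then $$|D^\alpha f|\rightharpoonup |Df|\quad\text{as }\alpha\to1^-.$$ Moreover, if $f\in BV(\mathbb{R}^n)$, then also $$\lim_{\alpha\to1^-}|D^\alpha f|(\mathbb{R}^n)=|Df|(\mathbb{R}^n).$$
   Context: Here $n\in\mathbb{N}$, $n\ge 1$. $BV(\mathbb{R}^n)$ is the space of $f\in L^1(\mathbb{R}^n)$ with $|Df|(\mathbb{R}^n)<+\infty$, and $bv(\mathbb{R}^n)$ is the space of $f\in L^1_{\rm loc}(\mathbb{R}^n)$ with $|Df|(\mathbb{R}^n)<+\infty$, where $Df$ is the distributional gradient measure and $|Df|$ its total variation. For $\alpha\in(0,1)$ let $\mu_{n,\alpha}:=2^\alpha\pi^{-n/2}\,\Gamma\big(\tfrac{n+\alpha+1}{2}\big)/\Gamma\big(\tfrac{1-\alpha}{2}\big)$, and for $\varphi\in \mathrm{Lip}_c(\mathbb{R}^n;\mathbb{R}^n)$ (Lipschitz with compact support) let $$\mathrm{div}^\alpha\varphi(x):=\mu_{n,\alpha}\int_{\mathbb{R}^n}\frac{(y-x)\cdot(\varphi(y)-\varphi(x))}{|y-x|^{n+\alpha+1}}\,dy,\qquad x\in\mathbb{R}^n,$$ which belongs to $L^1(\mathbb{R}^n)\cap L^\infty(\mathbb{R}^n)$. For $f\in L^1(\mathbb{R}^n)$ or $f\in L^\infty(\mathbb{R}^n)$, $D^\alpha f$ denotes the (unique, if it exists)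 $\mathbb{R}^n$-valued locally finite Radon measure on $\mathbb{R}^n$ such that $\int_{\mathbb{R}^n} f\,\mathrm{div}^\alpha\varphi\,dx=-\int_{\mathbb{R}^n}\varphi\cdot dD^\alpha f$ for all $\varphi\in\mathrm{Lip}_c(\mathbb{R}^n;\mathbb{R}^n)$; $|D^\alpha f|$ is its total variation measure. For $f$ as in the claim, $D^\alpha f$ exists for every $\alpha\in(0,1)$. The convergence $\mu_\alpha\rightharpoonup\mu$ of Radon measures means $\int\varphi\,d\mu_\alpha\to\int\varphi\,d\mu$ for every $\varphi\in C^0_c(\mathbb{R}^n)$ (weak*-convergence). *)

(* Defs.v *)
From HB Require Import structures.
From mathcomp Require Import all_boot all_order all_algebra.
From mathcomp Require Import all_classical all_reals all_analysis.
From mathcomp Require Import measurable_realfun.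

Set Implicit Arguments.
Unset Strict Implicit.
Unset Printing Implicit Defensive.
Import Order.TTheory GRing.Theory Num.Theory.
Import numFieldNormedType.Exports.

Local Open Scope classical_set_scope.
Local Open Scope ring_scope.

(* R^n is 'rV[R]_n.  The library norm `|x| on 'rV[R]_n is the sup norm: it only
   enters through the topology and the Lipschitz condition, which are the same
   for the Euclidean norm enorm. *)

Definition dot (R : realType) (n : nat) (x y : 'rV[R]_n) : R :=
  \sum_(i < n) x ord0 i * y ord0 i.

Definition enorm (R : realType) (n : nat) (x : 'rV[R]_n) : R :=
  Num.sqrt (dot x x).

Section borel_rV.
Context (R : realType) (n : nat).

Let borel : set (set 'rV[R]_n) := <<s [set U : set 'rV[R]_n | open U] >>.

Let borel0 : borel set0.
Proof. exact: sigma_algebra0. Qed.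

Let borelC A : borel A -> borel (~` A).
Proof. exact: sigma_algebraC. Qed.

Let borel_bigcup (F : (set 'rV[R]_n)^nat) :
  (forall i, borel (F i)) -> borel (\bigcup_i F i).
Proof. exact: sigma_algebra_bigcup. Qed.

HB.instance Definition _ := @isMeasurable.Build default_measure_display
  'rV[R]_n borel borel0 borelC borel_bigcup.

End borel_rV.

Lemma open_measurable_rV (R : realType) (n : nat) (U : set 'rV[R]_n) :
  open U -> measurable U.
Proof. by move=> oU; apply: sub_sigma_algebra. Qed.

Lemma continuous_measurable_rV (R : realType) (n : nat) (g : 'rV[R]_n -> R) :
  continuous g -> measurable_fun setT g.
Proof.
move=> /continuousP cg.
apply: (measurability _ (RGenOInfty.measurableE R)).
move=> _ [_ [a ->] <-]; rewrite setTI.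
by apply: open_measurable_rV; apply: cg; exact: interval_open.
Qed.

Lemma measurable_coord_rV (R : realType) (n : nat) (i : 'I_n) :
  measurable_fun setT (fun x : 'rV[R]_n => x ord0 i).
Proof. by apply: continuous_measurable_rV => x; exact: coord_continuous. Qed.

Lemma measurable_fun_rV d (T : measurableType d) (R : realType) (n : nat)
    (g : T -> 'rV[R]_n) :
  (forall i, measurable_fun setT (fun t => g t ord0 i)) ->
  measurable_fun setT g.
Proof.
move=> mg.
apply: (@measurability _ _ _ _ _ _ [set U : set 'rV[R]_n | open U]) => //.
move=> _ [U oU <-]; rewrite setTI.
pose B (p : 'rV[rat]_n * nat) : set 'rV[R]_n :=
  [set v | forall i, `|v ord0 i - ratr (p.1 ord0 i)| < p.2.+1%:R^-1].
have -> : U = \bigcup_p if `[< B p `<=` U >] then B p else set0.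
  apply/seteqP; split=> [v Uv|v [p _]]; last by case: asboolP => // BU /BU.
  have /nbhs_ballP[e /= e0 veU] := open_nbhs_nbhs (conj oU Uv).
  have [k] := ltr_add_invr (divr_gt0 e0 (ltr0n R 2)).
  rewrite add0r => ke.
  have k0 : 0 < k.+1%:R^-1 :> R by rewrite invr_gt0.
  have qP i : {q : rat | `|v ord0 i - ratr q| < k.+1%:R^-1}.
    apply: cid.
    have /rat_in_itvoo[q] : v ord0 i - k.+1%:R^-1 < v ord0 i + k.+1%:R^-1.
      by rewrite ltrD2l gt0_cp.
    rewrite in_itv/= => /andP[q1 q2]; exists q.
    by rewrite ltr_distl; apply/andP; split; [rewrite ltrBlDr|rewrite -ltrBlDr].
  exists (\row_i sval (qP i), k) => //.
  case: asboolP => [_ i|]; first by rewrite /= mxE; case: (qP i).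
  case; move=> w /= Bw; apply: veU; split => // i j.
  rewrite (ord1 i) /ball/= (splitr e).
  have := Bw j; have := svalP (qP j); rewrite mxE.
  set q := ratr _ => vq wq.
  rewrite -(subrKA q) (le_lt_trans (ler_normD _ _))// ltrD//.
    exact: lt_trans ke.
  by rewrite distrC; exact: lt_trans ke.
rewrite preimage_bigcup; apply: countable_bigcupT_measurable => [|p].
  exact: countableP.
case: asboolP => _; last by rewrite preimage_set0.
have -> : g @^-1` B p = \bigcap_(i in [set: 'I_n])
    ((fun t => g t ord0 i) @^-1` ball (ratr (p.1 ord0 i) : R) p.2.+1%:R^-1).
  apply/seteqP; split=> [t /= h i _|t /= h i].
    by rewrite /ball /= distrC; exact: h.
  by rewrite distrC; exact: h.
apply: fin_bigcap_measurable => [|i _]; first exact: finite_finset.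
by rewrite -[X in measurable X]setTI; apply: mg => //; exact: measurable_ball.
Qed.

(* Lebesgue measure on R^n: image of the iterated product of the
   one-dimensional Lebesgue measure. *)

Section lebesgue_rV_step.
Context (R : realType) (n : nat).
Variable mu : {sigma_finite_measure set 'rV[R]_n -> \bar R}.

Definition cons_rV (p : measurableTypeR R * 'rV[R]_n) : 'rV[R]_n.+1 :=
  \row_i (if unlift ord0 i is Some j then p.2 ord0 j else p.1).

Definition uncons_rV (v : 'rV[R]_n.+1) : measurableTypeR R * 'rV[R]_n :=
  (v ord0 ord0, \row_j v ord0 (lift ord0 j)).

Let cons_rVK : cancel cons_rV uncons_rV.
Proof.
move=> [x v]; rewrite /uncons_rV /cons_rV mxE unlift_none; congr pair.
by apply/rowP => j; rewrite !mxE liftK.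
Qed.

Let measurable_cons : measurable_fun setT cons_rV.
Proof.
apply: measurable_fun_rV => i; rewrite /cons_rV.
under eq_fun do rewrite mxE.
case: unliftP => [j _|_]; last exact: measurable_fst.
exact: (measurableT_comp (measurable_coord_rV j) measurable_snd).
Qed.

Let measurable_uncons : measurable_fun setT uncons_rV.
Proof.
apply/measurable_fun_pair; first exact: measurable_coord_rV.
apply: measurable_fun_rV => i; under eq_fun do rewrite mxE.
exact: measurable_coord_rV.
Qed.

Definition lebesgue_rV_step : set 'rV[R]_n.+1 -> \bar R :=
  pushforward (lebesgue_measure \x mu)%E cons_rV.

HB.instance Definition _ := Measure.copy lebesgue_rV_step
  (measure_function_pushforward__canonical__measure_function_Measure
     (lebesgue_measure \x mu)%E measurable_cons).

Let lebesgue_rV_step_sigma_finite : sigma_finite setT lebesgue_rV_step.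
Proof.
have /sigma_finiteP[F [FT ndF Ffin]] := sigma_finiteT (@lebesgue_measure R).
have /sigma_finiteP[G [GT ndG Gfin]] := sigma_finiteT mu.
exists (fun k => uncons_rV @^-1` (F k `*` G k)).
  rewrite -preimage_bigcup -(preimage_setT uncons_rV); congr (_ @^-1` _).
  apply/seteqP; split=> // -[x v] _.
  have [i _ Fix] : (\bigcup_i F i) x by rewrite -FT.
  have [j _ Gjv] : (\bigcup_j G j) v by rewrite -GT.
  exists (maxn i j) => //; split.
    by move: x Fix; exact/subsetPset/ndF/leq_maxl.
  by move: v Gjv; exact/subsetPset/ndG/leq_maxr.
move=> k; have [mF Foo] := Ffin k; have [mG Goo] := Gfin k; split.
  rewrite -[X in measurable X]setTI; apply: measurable_uncons => //.
  exact: measurableX.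
rewrite /lebesgue_rV_step /pushforward -comp_preimage (_ : _ \o _ = id).
  by rewrite preimage_id product_measure1E// lte_mul_pinfty// ge0_fin_numE.
by apply/funext => p; exact: cons_rVK.
Qed.

HB.instance Definition _ := Measure_isSigmaFinite.Build _ _ _
  lebesgue_rV_step lebesgue_rV_step_sigma_finite.

End lebesgue_rV_step.

Fixpoint lebesgue_rV (R : realType) (n : nat) :
    {sigma_finite_measure set 'rV[R]_n -> \bar R} :=
  if n is n'.+1 then lebesgue_rV_step (lebesgue_rV R n')
  else dirac (0 : 'rV[R]_0).

Lemma lebesgue_rV_box (R : realType) (n : nat) (a b : 'rV[R]_n) :
  (forall i, a ord0 i <= b ord0 i) ->
  lebesgue_rV R n [set x | forall i, x ord0 i \in `[a ord0 i, b ord0 i]] =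
  (\prod_(i < n) (b ord0 i - a ord0 i))%:E.
Proof.
elim: n a b => [|n IHn] a b ab.
  by rewrite big_ord0 /= diracE mem_set// => -[].
pose a' : 'rV_n := \row_j a ord0 (lift ord0 j).
pose b' : 'rV_n := \row_j b ord0 (lift ord0 j).
rewrite /= /lebesgue_rV_step /pushforward.
pose S := [set x : 'rV_n | forall i, x ord0 i \in `[a' ord0 i, b' ord0 i]].
rewrite [X in (_ \x _)%E X](_ : _ = `[a ord0 ord0, b ord0 ord0]%classic `*` S).
  have mS : measurable S.
    rewrite (_ : S = \bigcap_(i in [set: 'I_n])
      ((fun x : 'rV_n => x ord0 i) @^-1` `[a' ord0 i, b' ord0 i]%classic)).
      apply: fin_bigcap_measurable => [|i _]; first exact: finite_finset.
      rewrite -[X in measurable X]setTI; apply: measurable_coord_rV => //.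
    by apply/seteqP; split=> [x h i _|x h i]; have := h i; apply.
  rewrite product_measure1E// big_ord_recl EFinM; congr (_ * _)%E.
    apply: (etrans (lebesgue_measure_itv _)) => /=; rewrite lte_fin.
    have := ab ord0; rewrite le_eqVlt => /predU1P[->|->]; last by rewrite -EFinB.
    by rewrite ltxx subrr.
  rewrite IHn => [|i]; last by rewrite !mxE.
  by congr EFin; apply: eq_bigr => i _; rewrite !mxE.
apply/seteqP; split=> [[x v] /= h|[x v] [/= hx hv] i].
  split=> /=.
    by have := h ord0; rewrite mxE unlift_none.
  by move=> i; have := h (lift ord0 i); rewrite !mxE liftK.
rewrite mxE; case: unliftP => [j ->|->//].
by have := hv j; rewrite !mxE.
Qed.

Definition compact_supp (R : realType) (n : nat) (V : nmodType)
    (g : 'rV[R]_n -> V) : Prop :=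
  compact (closure [set x | g x != 0]).

(* R^n-valued locally finite Radon measures.  Such a measure is a set function
   on the relatively compact Borel sets; each of its components is a difference
   of two locally finite positive Borel measures, by which it is presented
   here.  The two measures need not be mutually singular: radon_val,
   radon_variation and radon_pairing only depend on their difference. *)

Record radon (R : realType) (n : nat) := Radon {
  rpos : 'I_n -> {measure set 'rV[R]_n -> \bar R} ;
  rneg : 'I_n -> {measure set 'rV[R]_n -> \bar R} ;
  rpos_lty : forall i K, compact K -> (rpos i K < +oo)%E ;
  rneg_lty : forall i K, compact K -> (rneg i K < +oo)%E }.

Section radon_choice.
Context (R : realType) (n : nat).

Let mzero_lty (i : 'I_n) (K : set 'rV[R]_n) :
  compact K -> (@mzero _ 'rV[R]_n R K < +oo)%E.
Proof. by move=> _; rewrite /mzero ltry. Qed.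

HB.instance Definition _ := gen_eqMixin (radon R n).
HB.instance Definition _ := gen_choiceMixin (radon R n).
HB.instance Definition _ := isPointed.Build (radon R n)
  (Radon mzero_lty mzero_lty).

End radon_choice.

(* Only meaningful for E Borel and relatively compact, where both values are
   finite. *)
Definition radon_val (R : realType) (n : nat) (nu : radon R n)
    (E : set 'rV[R]_n) : 'rV[R]_n :=
  \row_i (fine (rpos nu i E) - fine (rneg nu i E)).

(* |nu|(B) for B Borel.  The pieces are relatively compact because nu is only
   defined there; every Borel set has such countable partitions.  This is a
   Borel measure, but it is used below as a bare set function. *)
Definition radon_variation (R : realType) (n : nat) (nu : radon R n)
    (B : set 'rV[R]_n) : \bar R :=
  ereal_sup [set (\sum_(0 <= k <oo) (enorm (radon_val nu (E k)))%:E)%E |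
    E in [set E : (set 'rV[R]_n)^nat |
      [/\ forall k, measurable (E k), forall k, precompact (E k),
          trivIset setT E & \bigcup_k E k = B]]].

Definition radon_pairing (R : realType) (n : nat) (nu : radon R n)
    (phi : 'rV[R]_n -> 'rV[R]_n) : R :=
  \sum_(i < n) (\int[rpos nu i]_x phi x ord0 i - \int[rneg nu i]_x phi x ord0 i).

Definition weak_star_cvg (R : realType) (n : nat) (T : Type) (F : set_system T)
    (mu : T -> set 'rV[R]_n -> \bar R) (nu : set 'rV[R]_n -> \bar R) : Prop :=
  forall phi : 'rV[R]_n -> R, continuous phi -> compact_supp phi ->
    (\int[mu a]_x (phi x)%:E)%E @[a --> F] --> (\int[nu]_x (phi x)%:E)%E.

Definition e_ (R : realType) (n : nat) (i : 'I_n) : 'rV[R]_n := delta_mx ord0 i.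

Fixpoint Ck (R : realType) (n k : nat) (g : 'rV[R]_n -> R) : Prop :=
  continuous g /\
  if k is k'.+1 then
    forall i : 'I_n, (forall x, derivable g x (e_ R i)) /\
                     Ck k' (fun x => 'D_(e_ R i) g x)
  else True.

Definition smooth_c (R : realType) (n : nat) (phi : 'rV[R]_n -> 'rV[R]_n) :
    Prop :=
  (forall (i : 'I_n) k, Ck k (fun x => phi x ord0 i)) /\ compact_supp phi.

Definition divergence (R : realType) (n : nat) (phi : 'rV[R]_n -> 'rV[R]_n)
    (x : 'rV[R]_n) : R :=
  \sum_(i < n) 'D_(e_ R i) (fun y => phi y ord0 i) x.

Definition is_grad (R : realType) (n : nat) (f : 'rV[R]_n -> R)
    (nu : radon R n) : Prop :=
  forall phi, smooth_c phi ->
    \int[lebesgue_rV R n]_x (f x * divergence phi x) = - radon_pairing nu phi.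

(* The set function presented by nu is unique when it exists, so that the choice
   made by get is irrelevant for radon_variation; if there is none, the value is
   arbitrary.  The same holds for grad_frac. *)
Definition grad (R : realType) (n : nat) (f : 'rV[R]_n -> R) : radon R n :=
  get [set nu | is_grad f nu].

Definition Gamma (R : realType) (s : R) : R :=
  \int[lebesgue_measure]_(t in `]0, +oo[) (t `^ (s - 1) * expR (- t)).

Definition mu_frac (R : realType) (n : nat) (alpha : R) : R :=
  2 `^ alpha * pi `^ (- (n%:R / 2)) *
  Gamma ((n%:R + alpha + 1) / 2) / Gamma ((1 - alpha) / 2).

(* At y = x the integrand is 0 by the convention on division by 0. *)
Definition div_frac (R : realType) (n : nat) (alpha : R)
    (phi : 'rV[R]_n -> 'rV[R]_n) (x : 'rV[R]_n) : R :=
  mu_frac n alpha * \int[lebesgue_rV R n]_y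
    (dot (y - x) (phi y - phi x) / enorm (y - x) `^ (n%:R + alpha + 1)).

Definition lip_c (R : realType) (n : nat) (phi : 'rV[R]_n -> 'rV[R]_n) : Prop :=
  lipschitz phi /\ compact_supp phi.

Definition is_grad_frac (R : realType) (n : nat) (alpha : R)
    (f : 'rV[R]_n -> R) (nu : radon R n) : Prop :=
  forall phi, lip_c phi ->
    \int[lebesgue_rV R n]_x (f x * div_frac alpha phi x) =
    - radon_pairing nu phi.

Definition grad_frac (R : realType) (n : nat) (alpha : R)
    (f : 'rV[R]_n -> R) : radon R n :=
  get [set nu | is_grad_frac alpha f nu].

(* Elements of L^1, L^1_loc and L^oo are given by Borel representatives. *)

Definition L1loc (R : realType) (n : nat) (f : 'rV[R]_n -> R) : Prop :=
  measurable_fun setT f /\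
  forall K, compact K -> (lebesgue_rV R n).-integrable K (EFin \o f).

Definition finite_variation (R : realType) (n : nat) (f : 'rV[R]_n -> R) :
    Prop :=
  (exists nu, is_grad f nu) /\ (radon_variation (grad f) setT < +oo)%E.

Definition BV (R : realType) (n : nat) (f : 'rV[R]_n -> R) : Prop :=
  f \in Lfun (lebesgue_rV R n) 1 /\ finite_variation f.

Definition bv (R : realType) (n : nat) (f : 'rV[R]_n -> R) : Prop :=
  L1loc f /\ finite_variation f.

(* Main.v *)
Require Import Defs.
From HB Require Import structures.
From mathcomp Require Import all_boot all_order all_algebra.
From mathcomp Require Import all_classical all_reals all_analysis.
From mathcomp Require Import measurable_realfun ess_sup_inf.
From mathcomp Require Import ring lra.
Set Implicit Arguments.
Unset Strict Implicit.
Unset Printing Implicit Defensive.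
Import Order.TTheory GRing.Theory Num.Theory.
Import numFieldNormedType.Exports.
Local Open Scope classical_set_scope.
Local Open Scope ring_scope.

(* The kernel of div^alpha is a superposition over u > 0, with a weight wt alpha
   u proportional to u^{-(3-alpha)/2}, of the gradients of the Gaussian densities
   gam u z = (u/pi)^{n/2} exp(-u|z|^2).  Integrating by parts against each
   Gaussian gives
     int f div^alpha phi = - int_0^oo wt alpha u * a(u) du,
     a(u) = int (gam u * phi) . dDf,
   so that D^alpha f exists and is an average over u of mollifications of Df.
   Now a(u) = int phi . dDf + O(u^{-1/2}) at infinity and a(u) = O(u^{1/2}) at 0,
   whereas, because q Gamma(q) --> 1 as q --> 0, the mass of wt alpha on
   [1, +oo[ tends to 1 and its integrals against u^{-1/2} there and u^{1/2} on
   ]0, 1] tend to 0.  This gives the convergence of int phi . dD^alpha f, and upper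
   bounds uniform in phi under |phi| <= psi; as int psi d|nu| is the supremum of
   int phi . dnu over these phi, the total variations converge too. *)

(** * Measures with densities and Fubini's theorem *)

(** Gaussians are chosen because [gam u] is a product of one-variable functions: [lebesgue_rV] being
    an iterated product, masses, moments and derivatives reduce to the line. They lack compact
    support, so the identity defining Df reaches them only through cutoffs. The decay of a(u) at 0
    has two sources. On the side of Df, [gam u] <= sqrt u for u <= 1 and n >= 1, at the price of a
    Lebesgue integral of psi: this serves compactly supported psi. On the side of f, the mollified
    kernel is O(sqrt u) with a constant depending on phi through its supremum only: this serves psi
    = 1, with f in L^1, hence the total masses. The upper bounds ask psi to be Lipschitz, since
    their error must not depend on phi; the lower bounds hold for every continuous psi >= 0, and
    this asymmetry shapes the proof of weak* convergence. Finally, the total variation is given as a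
    supremum over partitions and not as a measure: identifying it with one takes a polar
    decomposition, for which Radon-Nikodym must first be made available to measures that are merely
    locally finite. *)

Section density.
Local Open Scope ereal_scope.
Context d (T : measurableType d) (R : realType).
Implicit Types (mu nu : {measure set T -> \bar R}) (f k : T -> \bar R).

Import HBNNSimple.

(** Monotone approximation of f by simple functions; since k may take the value +oo, the convergence
    of the products needs an argument. *)
Lemma integral_density mu nu k f :
  (forall x, 0 <= k x) -> measurable_fun setT k ->
  (forall E, measurable E -> nu E = \int[mu]_(x in E) k x) ->
  (forall x, 0 <= f x) -> measurable_fun setT f ->
  \int[nu]_x f x = \int[mu]_x (f x * k x).
Proof.
move=> k0 mk nuE f0 mf.
pose g := nnsfun_approx measurableT mf.
have gk_ge0 n x : 0 <= (g n x)%:E * k x by rewrite mule_ge0// lee_fin.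
have mgk n : measurable_fun setT (fun x => (g n x)%:E * k x).
  by apply: emeasurable_funM => //; exact/measurable_EFinP.
transitivity (limn (fun n => \int[nu]_x (g n x)%:E)).
  rewrite -monotone_convergence//.
  - apply: eq_integral => x _; apply/esym/cvg_lim => //.
    by apply: cvg_nnsfun_approx.
  - by move=> n; exact/measurable_EFinP.
  - by move=> n x _; rewrite lee_fin.
  - by move=> x _ m n mn; rewrite lee_fin; exact/lefP/nd_nnsfun_approx.
transitivity (limn (fun n => \int[mu]_x ((g n x)%:E * k x))); last first.
  rewrite -monotone_convergence//.
  - apply: eq_integral => x _; apply/cvg_lim => //.
    have kx := k0 x; rewrite muleC; under eq_fun do rewrite muleC.
    have gx := cvg_nnsfun_approx measurableT mf (fun x _ => f0 x) (x := x) I.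
    have [kxfin|] := boolP (k x \is a fin_num).
      by apply: cvgeZl => //; exact: gx.
    rewrite ge0_fin_numE// -leNgt leye_eq => /eqP ->.
    (* Where k x = +oo, multiplication by k x is discontinuous at 0: if f x = 0 every approximant
       vanishes at x, otherwise some approximant is positive there and the products equal +oo from
       then on. *)
    have [fx0|fx0] := eqVneq (f x) 0.
      rewrite fx0 mule0; under eq_fun => n.
        rewrite (_ : (g n x)%:E = 0) ?mule0; last first.
          apply/eqP; rewrite eq_le; apply/andP; split; last by rewrite lee_fin.
          rewrite -fx0 -(cvg_lim _ gx)//.
          have ndg : nondecreasing_seq (fun n => (g n x)%:E).
            by move=> a b ab; rewrite lee_fin; exact/lefP/nd_nnsfun_approx.
          rewrite (cvg_lim _ (ereal_nondecreasing_cvgn ndg))//.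
          by apply: ereal_sup_ubound; exists n.
        over.
      exact: cvg_cst.
    have fx_gt0 : 0 < f x by rewrite lt0e fx0 f0.
    rewrite gt0_mulye//.
    have [N gN] : exists N, (0 < g N x)%R.
      apply: contrapT => gN0.
      suff : f x = 0 by move/eqP; rewrite (negbTE fx0).
      rewrite -(cvg_lim _ gx)//; apply/cvg_lim => //.
      rewrite [X in X @ _ --> _](_ : _ = cst 0); first exact: cvg_cst.
      apply/funext => n /=; congr EFin; apply/eqP; rewrite eq_le fun_ge0 ?andbT.
      by rewrite leNgt; apply/negP => ?; apply: gN0; exists n.
    apply: cvg_near_cst; exists N => // n /= Nn.
    rewrite gt0_mulye// lte_fin (lt_le_trans gN)//.
    exact/lefP/nd_nnsfun_approx.
  - move=> x _ m n mn; rewrite lee_wpmul2r// lee_fin.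
    exact/lefP/nd_nnsfun_approx.
congr (limn _); apply/funext => n.
transitivity (\sum_(r \in range (g n))
    r%:E * \int[nu]_x (\1_(g n @^-1` [set r]) x)%:E).
  under eq_integral do rewrite fimfunE -fsumEFin//.
  rewrite ge0_integral_fsum//; last 2 first.
  - by move=> y; exact/measurable_EFinP/measurable_funM.
  - by move=> y x _; rewrite nnfun_muleindic_ge0.
  by apply: eq_fsbigr => r _; rewrite integralZl_indic_nnsfun// integral_indic.
transitivity (\sum_(r \in range (g n))
    \int[mu]_x ((r * \1_(g n @^-1` [set r]) x)%:E * k x)).
  apply: eq_fsbigr => r rg.
  have r0 : (0 <= r)%R by move: rg => /[!inE]/= -[x _ <-]; exact: fun_ge0.
  rewrite integral_indic// setIT nuE//.
  under [RHS]eq_integral do rewrite EFinM -muleA.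
  rewrite ge0_integralZl//.
  - congr (_ * _); rewrite integral_mkcond; apply: eq_integral => x _.
    rewrite patchE indicE; case: (x \in _); first by rewrite mul1e.
    by rewrite mul0e.
  - by apply: emeasurable_funM => //; exact/measurable_EFinP.
  - by move=> x _; rewrite mule_ge0// lee_fin.
rewrite -ge0_integral_fsum//.
- apply: eq_integral => x _; rewrite -ge0_mule_fsuml.
    by rewrite fsumEFin// -fimfunE.
  by move=> r; rewrite nnfun_muleindic_ge0.
- move=> r; apply: emeasurable_funM => //.
  exact/measurable_EFinP/measurable_funM.
- by move=> r x _; rewrite mule_ge0// nnfun_muleindic_ge0.
Qed.

Lemma density_measure mu k :
  (forall x, 0 <= k x) -> measurable_fun setT k ->
  exists nu : {measure set T -> \bar R},
    forall E, measurable E -> nu E = \int[mu]_(x in E) k x.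
Proof.
move=> k0 mk; pose m E := \int[mu]_(x in E) k x.
have m0 : m set0 = 0 by rewrite /m integral_set0.
have m_ge0 E : 0 <= m E by exact: integral_ge0.
have m_sig : semi_sigma_additive m.
  move=> F mF tF mUF; rewrite /m ge0_integral_bigcup//.
    apply: is_cvg_ereal_nneg_natsum => n _; exact: integral_ge0.
  exact: measurable_funTS.
pose nu : {measure set T -> \bar R} :=
  HB.pack m (isMeasure.Build _ _ _ m m0 m_ge0 m_sig).
by exists nu.
Qed.

End density.

Section setfun_integral.
Local Open Scope ereal_scope.
Context d (T : measurableType d) (R : realType).
Import HBNNSimple.

(** [integral] accepts bare set functions and evaluates them only on level sets of simple functions.
    This transfers integrals from [radon_variation], which is not packaged as a measure, to the
    measure with which it agrees on Borel sets. *)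
Lemma eq_setfun_integral (m1 m2 : set T -> \bar R) (f : T -> \bar R) :
  (forall E, measurable E -> m1 E = m2 E) -> \int[m1]_x f x = \int[m2]_x f x.
Proof.
move=> m12.
have eqs (h : {nnsfun T >-> R}) : sintegral m1 h = sintegral m2 h.
  by rewrite /sintegral; apply: eq_fsbigr => r _; rewrite m12.
rewrite /integral; congr (ereal_sup _ - ereal_sup _); apply/seteqP;
  by split=> _ [h hf <-]; exists h => //; rewrite eqs.
Qed.

End setfun_integral.

Section Rfubini.
Context d1 d2 (T1 : measurableType d1) (T2 : measurableType d2) (R : realType).
Variable m1 : {sigma_finite_measure set T1 -> \bar R}.
Variable m2 : {sigma_finite_measure set T2 -> \bar R}.
Variable F : T1 * T2 -> R.
Hypothesis iF : (m1 \x m2)%E.-integrable setT (EFin \o F).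

(** The inner integral is finite only almost everywhere and [fine] sends infinite values to 0, so
    the real-valued and the extended iterated integrals agree up to a null set. *)
Let aeF : ae_eq m1 setT (fun x => (\int[m2]_y (F (x, y))%:E)%E)
   (fun x => (\int[m2]_y F (x, y))%:E).
Proof.
have := ae_integrable1 iF; apply: filterS => x ix _.
by rewrite /Rintegral fineK//; exact: integrable_fin_num ix.
Qed.

Let aeG : ae_eq m2 setT (fun y => (\int[m1]_x (F (x, y))%:E)%E)
   (fun y => (\int[m1]_x F (x, y))%:E).
Proof.
have := ae_integrable2 iF; apply: filterS => x ix _.
by rewrite /Rintegral fineK//; exact: integrable_fin_num ix.
Qed.

Let mF1 : measurable_fun setT (fun x => (\int[m2]_y F (x, y))%:E).
Proof.
apply/measurable_EFinP; apply: measurableT_comp => //.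
exact: (measurable_fubini_F iF).
Qed.

Let mG1 : measurable_fun setT (fun y => (\int[m1]_x F (x, y))%:E).
Proof.
apply/measurable_EFinP; apply: measurableT_comp => //.
exact: (measurable_fubini_G iF).
Qed.

Lemma integrable_Rfubini1 :
  m1.-integrable setT (fun x => (\int[m2]_y F (x, y))%:E).
Proof.
apply/integrableP; split => //.
have /integrableP[mm] := integrable_fubini_F iF.
apply: le_lt_trans; rewrite le_eqVlt; apply/orP; left; apply/eqP.
apply: ae_eq_integral => //; [exact: measurableT_comp|exact: measurableT_comp|].
apply: filterS aeF => x h _; by rewrite -h.
Qed.

Lemma integrable_Rfubini2 :
  m2.-integrable setT (fun y => (\int[m1]_x F (x, y))%:E).
Proof.
have iG : m2.-integrable setT (fun y => (\int[m1]_x (F (x, y))%:E)%E).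
  apply/integrableP; split; first exact: (measurable_fubini_G iF).
  have mf : measurable_fun setT (EFin \o F) by exact: measurable_int iF.
  have h := (integrable21ltyP m1 m2 mf).1 iF.
  apply: le_lt_trans h.
  apply: ge0_le_integral => //.
  - by apply: measurableT_comp => //; exact: (measurable_fubini_G iF).
  - apply: (measurable_fun_fubini_tonelli_G (abse \o (EFin \o F))) => [|x].
      exact: measurableT_comp.
    exact: abse_ge0.
  - move=> y _; apply: le_abse_integral => //.
    by apply: (measurableT_comp mf); exact: measurable_pair2.
apply/integrableP; split => //.
have /integrableP[mm] := iG.
apply: le_lt_trans; rewrite le_eqVlt; apply/orP; left; apply/eqP.
apply: ae_eq_integral => //; [exact: measurableT_comp|exact: measurableT_comp|].
apply: filterS aeG => x h _; by rewrite -h.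
Qed.

Lemma Rfubini1 :
  \int[(m1 \x m2)%E]_z F z = \int[m1]_x (\int[m2]_y F (x, y)).
Proof.
rewrite /Rintegral -(integral12_prod_meas1 iF); congr fine.
by apply: ae_eq_integral => //; exact: (measurable_fubini_F iF).
Qed.

Lemma Rfubini2 :
  \int[(m1 \x m2)%E]_z F z = \int[m2]_y (\int[m1]_x F (x, y)).
Proof.
rewrite /Rintegral -(integral21_prod_meas1 iF); congr fine.
by apply: ae_eq_integral => //; exact: (measurable_fubini_G iF).
Qed.

End Rfubini.

(** * Euclidean norm, cubes and Lipschitz fields *)

Section euclid.
Context (R : realType) (n : nat).
Implicit Types (x y z : 'rV[R]_n) (r : R).

Lemma rV_coord_le_norm x i : `|x ord0 i| <= `|x|.
Proof.
rewrite [leRHS]/Num.norm /= mx_normrE; apply/bigmax_geP; right => /=.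
by exists (ord0, i).
Qed.

Lemma rV_norm_le x r : 0 <= r -> (forall i, `|x ord0 i| <= r) -> `|x| <= r.
Proof.
move=> r0 xr; rewrite [leLHS]/Num.norm /= mx_normrE; apply: bigmax_le => //= -[i j] _.
by rewrite (ord1 i).
Qed.

Lemma dot_ge0 x : 0 <= dot x x.
Proof. by apply: sumr_ge0 => i _; rewrite -expr2 sqr_ge0. Qed.

Lemma enorm_ge0 x : 0 <= enorm x. Proof. exact: sqrtr_ge0. Qed.

Lemma enorm_sqr x : enorm x ^+ 2 = dot x x.
Proof. by rewrite sqr_sqrtr// dot_ge0. Qed.

Lemma dotC x y : dot x y = dot y x.
Proof. by apply: eq_bigr => i _; rewrite mulrC. Qed.

Lemma dotDr x y z : dot x (y + z) = dot x y + dot x z.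
Proof. by rewrite -big_split; apply: eq_bigr => i _; rewrite mxE mulrDr. Qed.

Lemma dotNr x y : dot x (- y) = - dot x y.
Proof. by rewrite -sumrN; apply: eq_bigr => i _; rewrite mxE mulrN. Qed.

Lemma dotBr x y z : dot x (y - z) = dot x y - dot x z.
Proof. by rewrite dotDr dotNr. Qed.

Lemma dotZr r x y : dot x (r *: y) = r * dot x y.
Proof. by rewrite mulr_sumr; apply: eq_bigr => i _; rewrite mxE mulrCA. Qed.

Lemma dotNN x : dot (- x) (- x) = dot x x.
Proof. by apply: eq_bigr => i _; rewrite !mxE mulrNN. Qed.

Lemma dot0r x : dot x 0 = 0.
Proof. by rewrite /dot big1// => i _; rewrite mxE mulr0. Qed.

Lemma enorm_eq0 x : enorm x = 0 -> x = 0.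
Proof.
move=> x0; have : dot x x = 0 by rewrite -enorm_sqr x0 expr0n.
move/eqP; rewrite psumr_eq0; last by move=> i _; rewrite -expr2 sqr_ge0.
move=> /allP h; apply/rowP => i; have := h i (mem_index_enum _).
by rewrite -expr2 sqrf_eq0 mxE => /eqP.
Qed.

Lemma dot_le_enorm x y : dot x y <= enorm x * enorm y.
Proof.
have [/enorm_eq0 ->|x0] := eqVneq (enorm x) 0.
  by rewrite dotC dot0r mulr_ge0 ?enorm_ge0.
have [/enorm_eq0 ->|y0] := eqVneq (enorm y) 0.
  by rewrite dot0r mulr_ge0 ?enorm_ge0.
have : 0 <= dot (enorm y *: x - enorm x *: y) (enorm y *: x - enorm x *: y).
  exact: dot_ge0.
rewrite !(dotBr, dotZr) ![dot (_ - _) _]dotC !(dotBr, dotZr) (dotC y x).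
rewrite -!enorm_sqr => h.
have xy : 0 < enorm x * enorm y by rewrite mulr_gt0// lt0r ?x0 ?y0 enorm_ge0.
have : 0 <= (2 * (enorm x * enorm y)) * (enorm x * enorm y - dot x y).
  by apply: le_trans h _; nra.
by rewrite pmulr_rge0 ?subr_ge0// mulr_gt0.
Qed.

Lemma normr_dot_le x y : `|dot x y| <= enorm x * enorm y.
Proof.
rewrite ler_norml dot_le_enorm andbT lerNl -dotNr.
by apply: le_trans (dot_le_enorm _ _) _; rewrite {2}/enorm dotNN.
Qed.

Lemma coord_le_enorm x i : `|x ord0 i| <= enorm x.
Proof.
rewrite -(ger0_norm (enorm_ge0 x)) -ler_sqr ?nnegrE// !real_normK ?num_real//.
rewrite enorm_sqr /dot (bigD1 i)//= -expr2 lerDl.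
by apply: sumr_ge0 => j _; rewrite -expr2 sqr_ge0.
Qed.

Lemma norm_le_enorm x : `|x| <= enorm x.
Proof. by apply: rV_norm_le (enorm_ge0 x) _ => i; exact: coord_le_enorm. Qed.

Definition cube r : set 'rV[R]_n := [set x | `|x| <= r].

Lemma closed_cube r : closed (cube r).
Proof.
rewrite (_ : cube r = Num.norm @^-1` [set u : R | u <= r])//.
apply: closed_comp => [x _|]; first exact: norm_continuous.
exact: (@closed_le R r).
Qed.

Lemma compact_cube r : compact (cube r).
Proof.
apply: bounded_closed_compact; last exact: closed_cube.
exists r; split; first exact: num_real.
by move=> M rM x xr; exact: le_trans xr (ltW rM).
Qed.

Lemma measurable_cube r : measurable (cube r).
Proof.
by rewrite -[cube r]setCK; apply: measurableC; apply: open_measurable_rV;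
  rewrite openC; exact: closed_cube.
Qed.

Lemma compact_sub_cube (K : set 'rV[R]_n) :
  compact K -> exists k : nat, K `<=` cube k%:R.
Proof.
move=> /compact_bounded[M [_ MK]].
exists (Num.truncn (Num.max M 0)).+2 => x Kx; apply: MK Kx.
apply: le_lt_trans (_ : Num.max M 0 < _); first by rewrite le_max lexx.
apply: lt_trans (truncnS_gt _) _; first by rewrite ltr_nat.
Qed.

Lemma compact_supp_sub (V : nmodType) (g : 'rV[R]_n -> V) :
  compact_supp g -> exists k : nat, forall x, g x != 0 -> `|x| <= k%:R.
Proof.
by move=> /compact_sub_cube[k kg]; exists k => x gx; apply/kg/subset_closure.
Qed.

Lemma sub_compact_supp (V : nmodType) (g : 'rV[R]_n -> V) r :
  (forall x, g x != 0 -> `|x| <= r) -> compact_supp g.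
Proof.
move=> gr; apply: subclosed_compact (@compact_cube r) _.
  exact: closed_closure.
by rewrite [in X in _ `<=` X](iffLR (closure_id _) (@closed_cube r)); apply: closure_subset => x /gr.
Qed.

Lemma cube_bigcup : \bigcup_k cube k%:R = setT.
Proof.
apply/seteqP; split => // x _; exists (Num.truncn `|x|).+1 => //.
exact/ltW/truncnS_gt.
Qed.

Lemma measurable_dot d (T : measurableType d) (D : set T) (f g : T -> 'rV[R]_n) :
  (forall i, measurable_fun D (fun t => f t ord0 i)) ->
  (forall i, measurable_fun D (fun t => g t ord0 i)) ->
  measurable_fun D (fun t => dot (f t) (g t)).
Proof.
move=> mf mg; rewrite /dot; apply: measurable_sum => i.
exact: measurable_funM.
Qed.

Lemma lip_cP (phi : 'rV[R]_n -> 'rV[R]_n) : lip_c phi <->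
  exists L r, [/\ 0 <= L, 0 <= r, forall i x y,
    `|phi x ord0 i - phi y ord0 i| <= L * `|x - y| &
    forall x, phi x != 0 -> `|x| <= r].
Proof.
split=> [[/= [M [_ ML]] /compact_supp_sub[k phik]]|[L [r [L0 r0 phiL phir]]]].
  (* The library predicate grants every constant strictly above some [M], possibly negative; this
     one is nonnegative as well. *)
  exists (Num.max M 0 + 1), k%:R; split => //.
  - by rewrite addr_ge0// le_max lexx orbT.
  - move=> i x y; have := ML (Num.max M 0 + 1).
    have -> : M < Num.max M 0 + 1 by rewrite (@le_lt_trans _ _ (Num.max M 0)) ?le_max ?lexx// ltrDl.
    move=> /(_ isT (x, y))/= h.
    apply: le_trans (h (conj I I)).
    have := rV_coord_le_norm (phi x - phi y) i; by rewrite !mxE.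
split; last exact: sub_compact_supp phir.
exists L; split; first exact: num_real.
move=> M LM [x y] _ /=; apply: (@le_trans _ _ (L * `|x - y|)).
  apply: rV_norm_le; first by rewrite mulr_ge0.
  by move=> i; rewrite !mxE; exact: phiL.
by rewrite ler_wpM2r// ltW.
Qed.

End euclid.

Section signed_density.
Local Open Scope ereal_scope.
Context d (T : measurableType d) (R : realType).
Variables (mu nu : {measure set T -> \bar R}) (k : T -> R).
Hypothesis k0 : forall x, (0 <= k x)%R.
Hypothesis mk : measurable_fun setT k.
Hypothesis nuE : forall E, measurable E -> nu E = \int[mu]_(x in E) (k x)%:E.

Lemma signed_integral_density (h : T -> R) : measurable_fun setT h ->
  \int[nu]_x (h x)%:E = \int[mu]_x (h x * k x)%:E.
Proof.
move=> mh; rewrite integralE [RHS]integralE.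
have dens (f : T -> \bar R) : (forall x, 0 <= f x) -> measurable_fun setT f ->
    \int[nu]_x f x = \int[mu]_x (f x * (k x)%:E).
  move=> f0 mf; apply: (integral_density (k := EFin \o k)) => //.
  exact/measurable_EFinP.
have mh' : measurable_fun setT (EFin \o h) by exact/measurable_EFinP.
rewrite !dens//; [|exact: measurable_funeneg|exact: measurable_funepos].
congr (_ - _); apply: eq_integral => x _.
  by rewrite !funeposE -!EFin_max -EFinM maxr_pMl// mul0r.
by rewrite !funenegE -!EFinN -!EFin_max -EFinM maxr_pMl// mul0r mulNr.
Qed.

Lemma integrable_density (h : T -> R) : measurable_fun setT h ->
  nu.-integrable setT (EFin \o h) <-> mu.-integrable setT (fun x => (h x * k x)%:E).
Proof.
move=> mh; have h1 : \int[nu]_x `|(h x)%:E| = \int[mu]_x `|(h x * k x)%:E|.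
  rewrite (eq_integral (fun x => (`|h x|)%R%:E))//.
  rewrite signed_integral_density; last exact: measurableT_comp.
  by apply: eq_integral => x _ /=; rewrite normrM (ger0_norm (k0 x)).
split => /integrableP[_ /= h2]; apply/integrableP; split.
- exact/measurable_EFinP/measurable_funM.
- by rewrite -h1.
- exact/measurable_EFinP.
- by rewrite h1.
Qed.

Lemma Rintegral_density (h : T -> R) : measurable_fun setT h ->
  (\int[nu]_x h x)%R = (\int[mu]_x (h x * k x))%R.
Proof. by move=> mh; rewrite /Rintegral signed_integral_density. Qed.

End signed_density.

(** * Densities of locally finite measures *)

Section dominating.
Local Open Scope ereal_scope.
Context d (T : measurableType d) (R : realType).

Lemma to_finite_measure (m : {measure set T -> \bar R}) : m setT < +oo ->
  exists m' : {finite_measure set T -> \bar R}, forall E, m' E = m E.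
Proof.
move=> moo; exists (mfrestr measurableT moo) => E.
by rewrite /= /mfrestr /mrestr setIT.
Qed.

(** The sum of the family serves as one reference measure for all of them; domination is what
    Radon-Nikodym asks for. *)
Lemma dominating_measure (I : finType) (m : I -> {measure set T -> \bar R}) :
  (forall i, m i setT < +oo) ->
  exists lam : {finite_measure set T -> \bar R}, forall i E, m i E <= lam E.
Proof.
move=> moo.
have [lam lamoo lamE] : exists2 lam : {measure set T -> \bar R}, lam setT < +oo &
    forall i E, i \in enum I -> m i E <= lam E.
  elim: (enum I) => [|i s [lam lamoo lamE]]; first by exists mzero => [|i E]; [rewrite /mzero ltry|rewrite in_nil].
  pose lam' : {measure set T -> \bar R} := measure_add (m i) lam.
  have lamE' A : lam' A = m i A + lam A by exact: measure_addE.
  exists lam'; first by rewrite lamE' lte_add_pinfty.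
  move=> j E; rewrite inE lamE' => /predU1P[->|js]; first by rewrite leeDl.
  by rewrite (le_trans (lamE _ _ js))// leeDr.
have [lam' lam'E] := to_finite_measure lamoo.
by exists lam' => i E; rewrite lam'E; apply: lamE; rewrite mem_enum.
Qed.

End dominating.

Section weight.
Local Open Scope ereal_scope.
Context (R : realType) (n : nat).

(** Turns locally finite measures into finite ones by a strictly positive weight, which can be
    divided out again afterwards. The weight depends on the bounds [L] alone, so one choice serves a
    whole family. *)
Lemma finite_weight (L : nat -> R) : (forall k, 0 <= L k)%R ->
  exists w : 'rV[R]_n -> R, [/\ measurable_fun setT w, forall x, (0 < w x)%R &
    forall rho : {measure set 'rV[R]_n -> \bar R},
      (forall k : nat, rho (cube k%:R) <= (L k)%:E) -> \int[rho]_x (w x)%:E <= 1].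
Proof.
(* The factor 2^-(k+1) keeps the sum of the [b k] at most 1, and division by 1 + L k does the same
   for the sum of the products of [b k] and [L k], which bounds the integral. *)
move=> L0; pose b k : R := (1 / (2 ^ k.+1)%:R / (1 + L k))%R.
have b0 k : (0 < b k)%R.
  by rewrite /b !divr_gt0// ?ltr0n ?expn_gt0// ltr_wpDr.
have bL k : (b k * L k <= 1 / (2 ^ k.+1)%:R)%R.
  rewrite /b -[leLHS]mulrA ler_piMr ?divr_ge0// mulrC ler_pdivrMr ?ltr_wpDr//.
  by rewrite mul1r lerDr.
have b1 k : (b k <= 1 / (2 ^ k.+1)%:R)%R.
  by rewrite /b ler_piMr ?divr_ge0// invf_le1 ?ltr_wpDr// lerDl.
pose t k x : \bar R := (b k * \1_(cube k%:R : set 'rV[R]_n) x)%:E.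
have t0 k x : 0 <= t k x by rewrite lee_fin mulr_ge0// ltW.
have mt k : measurable_fun setT (t k).
  apply/measurable_EFinP/measurable_funM => //.
  by apply: measurable_indic; exact: measurable_cube.
pose W x := \sum_(k <oo) t k x.
have W0 x : 0 < W x.
  have [k _ kx] : (\bigcup_k (cube k%:R : set 'rV[R]_n)) x by rewrite cube_bigcup.
  have : 0 < t k x by rewrite lte_fin mulr_gt0// indicE mem_set.
  move=> /lt_le_trans; apply; rewrite /W (@nneseries_split _ _ 0 k.+1)//.
  rewrite add0n big_nat_recr//= -addeA addeCA leeDl// adde_ge0//.
    by rewrite sume_ge0.
  exact: nneseries_ge0.
have W1 x : W x <= 1.
  apply: le_trans (epsilon_trick0 xpredT (@ler01 R)).
  apply: lee_nneseries => [k _ _|k _]; first exact: t0.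
  rewrite lee_fin; apply: le_trans (b1 k).
  by rewrite ler_piMr ?(ltW (b0 _))// indicE lern1 leq_b1.
have Wfin x : W x \is a fin_num.
  by rewrite ge0_fin_numE ?ltW// (le_lt_trans (W1 x))// ltry.
have mW : measurable_fun setT W.
  by apply: ge0_emeasurable_sum => // k x _ _.
exists (fine \o W); split.
- exact: measurableT_comp.
- by move=> x; rewrite fine_gt0// W0/= (le_lt_trans (W1 x))// ltry.
move=> rho rhoL; rewrite (eq_integral W); last by move=> x _ /=; rewrite fineK.
rewrite integral_nneseries//.
apply: le_trans (epsilon_trick0 xpredT (@ler01 R)).
apply: lee_nneseries => k _; first by rewrite integral_ge0.
under eq_integral do rewrite /t EFinM.
rewrite ge0_integralZl//; last 2 first.
- by apply/measurable_EFinP; apply: measurable_indic; exact: measurable_cube.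
- by rewrite lee_fin ltW.
rewrite integral_indic//; last exact: measurable_cube.
rewrite setIT (@le_trans _ _ ((b k)%:E * (L k)%:E))//.
  by rewrite lee_wpmul2l// lee_fin ltW.
by rewrite -EFinM lee_fin.
Qed.

End weight.

Section radon_density.
Local Open Scope ereal_scope.
Context (R : realType) (n : nat).

(** Radon-Nikodym is applied to the finite measures of density w with respect to the [m i]; dividing
    the resulting densities by w > 0 gives densities of the [m i] themselves. *)
Lemma common_density (I : finType)
    (m : I -> {measure set 'rV[R]_n -> \bar R}) :
  (forall i K, compact K -> m i K < +oo) ->
  exists (lam : {finite_measure set 'rV[R]_n -> \bar R}) (P : I -> 'rV[R]_n -> R),
    [/\ forall i x, (0 <= P i x)%R, forall i, measurable_fun setT (P i) &
    forall i E, measurable E -> m i E = \int[lam]_(x in E) (P i x)%:E].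
Proof.
move=> mK.
pose L (k : nat) : R := (\sum_i fine (m i (cube k%:R)))%R.
have L0 k : (0 <= L k)%R by apply: sumr_ge0 => i _; exact: fine_ge0.
have [w [mw w0 wL]] := finite_weight n L0.
have mL i (k : nat) : m i (cube k%:R) <= (L k)%:E.
  have fm : m i (cube k%:R) \is a fin_num.
    by rewrite ge0_fin_numE// mK//; exact: compact_cube.
  rewrite -(fineK fm) lee_fin /L (bigD1 i)//= lerDl.
  by apply: sumr_ge0 => j _; exact: fine_ge0.
have mwE : measurable_fun setT (EFin \o w) by exact/measurable_EFinP.
have /choice[rho rhoE] i : exists rho : {measure set 'rV[R]_n -> \bar R},
    forall E, measurable E -> rho E = \int[m i]_(x in E) (w x)%:E.
  by apply: density_measure => // x; rewrite lee_fin ltW.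
have rho_fin i : rho i setT < +oo.
  by rewrite rhoE// (le_lt_trans (wL _ (mL i)))// ltry.
have [lam lamE] := dominating_measure rho_fin.
have /choice[p pE] i : exists p : 'rV[R]_n -> \bar R,
    [/\ forall x, 0 <= p x, forall x, p x \is a fin_num,
        lam.-integrable setT p &
        forall E, measurable E -> rho i E = \int[lam]_(x in E) p x].
  have [rho' rho'E] := to_finite_measure (rho_fin i).
  have dom : rho' `<< lam.
    apply/null_content_dominatesP => E mE lam0; rewrite rho'E.
    by apply/eqP; rewrite eq_le measure_ge0 andbT -lam0 lamE.
  have [p [p0 pfin ip pE]] := radon_nikodym_sigma_finite dom.
  by exists p; split => // E mE; rewrite -rho'E pE.
have mp i : measurable_fun setT (p i) by have [_ _ /measurable_int] := pE i.
have p0 i x : 0 <= p i x by have [] := pE i.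
have pfin i x : p i x \is a fin_num by have [] := pE i.
have miw : measurable_fun setT (fun x => (w x)^-1%R).
  rewrite (_ : (fun x => _) = (fun x => x `^ (-1))%R \o w); last first.
    by apply/funext => x /=; rewrite powR_inv1// ltW.
  by apply: measurableT_comp => //; exact: measurable_powR.
exists lam, (fun i x => fine (p i x) / w x)%R; split.
- by move=> i x; rewrite divr_ge0 ?fine_ge0// ltW.
- by move=> i; apply: measurable_funM => //; exact: measurableT_comp.
move=> i E mE; rewrite integral_mkcond.
have h0 x : (0 <= \1_E x / w x)%R by rewrite divr_ge0// ltW.
have mh : measurable_fun setT (fun x => (\1_E x / w x)%R).
  exact: measurable_funM.
(* Undoing the weight: 1_E / w is integrated against [rho i] in two ways, through its density [p i]
   with respect to [lam] and through its density w with respect to [m i], where 1_E is left. *)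
transitivity (\int[lam]_x ((\1_E x / w x)%:E * p i x)); last first.
  apply: eq_integral => x _; rewrite patchE indicE.
  case: (x \in E); last by rewrite mul0r mul0e.
  by rewrite -(fineK (pfin i x)) -EFinM div1r mulrC.
have [_ _ _ rhopE] := pE i.
rewrite -(integral_density (nu := rho i))//; last exact/measurable_EFinP.
rewrite (integral_density (mu := m i) (k := EFin \o w)); last 5 first.
- by move=> x; rewrite lee_fin ltW.
- by [].
- exact: rhoE.
- by move=> x; rewrite lee_fin.
- exact/measurable_EFinP.
rewrite (eq_integral (fun x => (\1_E x)%:E)); last first.
  by move=> x _ /=; rewrite -EFinM divfK// gt_eqF.
by rewrite integral_indic// setIT.
Qed.

Lemma radon_density (nu : radon R n) :
  exists (lam : {finite_measure set 'rV[R]_n -> \bar R})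
    (P Q : 'I_n -> 'rV[R]_n -> R),
    [/\ forall i x, (0 <= P i x)%R /\ (0 <= Q i x)%R,
    forall i, measurable_fun setT (P i) /\ measurable_fun setT (Q i) &
    forall i E, measurable E -> rpos nu i E = \int[lam]_(x in E) (P i x)%:E /\
       rneg nu i E = \int[lam]_(x in E) (Q i x)%:E].
Proof.
(* Indexing the positive and negative parts of all components by one finite type gives them a common
   reference measure, so that their densities can be subtracted. *)
pose m (s : ('I_n * bool)%type) := if s.2 then rpos nu s.1 else rneg nu s.1.
have mK s K : compact K -> m s K < +oo.
  by move=> cK; rewrite /m; case: s.2; [exact: rpos_lty|exact: rneg_lty].
have [lam [P [P0 mP PE]]] := common_density mK.
exists lam, (fun i => P (i, true)), (fun i => P (i, false)); split.
- by move=> i x; split; exact: P0.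
- by move=> i; split; exact: mP.
- move=> i E mE; rewrite -(PE (i, true))// -(PE (i, false))//.
Qed.

End radon_density.

(** * Polar decomposition of a Radon measure *)

Lemma Rintegral_sum d (T : measurableType d) (R : realType)
    (mu : {measure set T -> \bar R}) (D : set T) (I : Type) (s : seq I)
    (f : I -> T -> R) :
  measurable D -> (forall i, mu.-integrable D (EFin \o f i)) ->
  \int[mu]_(x in D) (\sum_(i <- s) f i x) =
  \sum_(i <- s) \int[mu]_(x in D) f i x.
Proof.
move=> mD fi; elim: s => [|i s IH].
  by rewrite big_nil; under eq_Rintegral do rewrite big_nil; rewrite /Rintegral integral0.
rewrite big_cons -IH -RintegralD//; last first.
  rewrite (_ : _ \o _ = (fun x => \sum_(j <- s) (f j x)%:E)%E).
    by apply: integrable_sum => // *; exact: fi.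
  by apply/funext => x /=; rewrite sumEFin.
by apply: eq_Rintegral => x _; rewrite big_cons.
Qed.

Section polar.
Context (R : realType) (n : nat).

Lemma enorm_le_sum (x : 'rV[R]_n) : enorm x <= \sum_i `|x ord0 i|.
Proof.
have S0 : 0 <= \sum_i `|x ord0 i| by exact: sumr_ge0.
rewrite -ler_sqr ?nnegrE ?enorm_ge0// enorm_sqr expr2 mulr_suml.
apply: ler_sum => i _; rewrite -expr2 -real_normK ?num_real// expr2.
by rewrite ler_wpM2l// (bigD1 i)//= lerDl sumr_ge0.
Qed.

Lemma enormD (x y : 'rV[R]_n) : enorm (x + y) <= enorm x + enorm y.
Proof.
rewrite -ler_sqr ?nnegrE ?addr_ge0 ?enorm_ge0// enorm_sqr.
rewrite dotDr ![dot (_ + _) _]dotC !dotDr (dotC y x) sqrrD !enorm_sqr.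
by have := dot_le_enorm x y; nra.
Qed.

Lemma enorm0 : enorm (0 : 'rV[R]_n) = 0.
Proof. by rewrite /enorm dot0r sqrtr0. Qed.

Lemma enormN (x : 'rV[R]_n) : enorm (- x) = enorm x.
Proof. by rewrite /enorm dotNN. Qed.

Lemma measurable_enorm d (T : measurableType d) (D : set T) (g : T -> 'rV[R]_n) :
  (forall i, measurable_fun D (fun t => g t ord0 i)) ->
  measurable_fun D (fun t => enorm (g t)).
Proof.
move=> mg; rewrite /enorm.
rewrite (_ : (fun t => _) = (fun u => u `^ 2^-1) \o (fun t => dot (g t) (g t))).
  by apply: measurableT_comp; [exact: measurable_powR|exact: measurable_dot].
by apply/funext => t /=; rewrite powR12_sqrt// dot_ge0.
Qed.

Lemma bounded_supp_integrable (rho : {measure set 'rV[R]_n -> \bar R})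
   (h : 'rV[R]_n -> R) (M r : R) : measurable_fun setT h ->
  (forall K, compact K -> rho K < +oo)%E ->
  (forall x, `|h x| <= M) -> (forall x, h x != 0 -> `|x| <= r) ->
  rho.-integrable setT (EFin \o h).
Proof.
move=> mh rhoK hM hr; have mr := @measurable_cube R n r.
rewrite (_ : EFin \o h = (EFin \o h) \_ (cube r)); last first.
  apply/funext => x; rewrite patchE /=; case: ifPn => // xr.
  by apply: contraNeq xr => hx; rewrite inE; apply: hr; move: hx; apply: contraNN => /eqP ->.
apply/integrable_restrict => //; rewrite setTI.
apply: measurable_bounded_integrable => //.
- by apply: rhoK; exact: compact_cube.
- exact: measurable_funTS.
- exists M; split; first exact: num_real.
  by move=> y My x _; exact: le_trans (hM x) (ltW My).
Qed.

Variables (nu : radon R n) (lam : {finite_measure set 'rV[R]_n -> \bar R}).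
Variables P Q : 'I_n -> 'rV[R]_n -> R.
Hypothesis PQ0 : forall i x, (0 <= P i x) /\ (0 <= Q i x).
Hypothesis mPQ : forall i, measurable_fun setT (P i) /\ measurable_fun setT (Q i).
Hypothesis PQE : forall i E, measurable E ->
  rpos nu i E = (\int[lam]_(x in E) (P i x)%:E)%E /\
  rneg nu i E = (\int[lam]_(x in E) (Q i x)%:E)%E.

Let g x : 'rV[R]_n := \row_i (P i x - Q i x).

Let mg i : measurable_fun setT (fun x => g x ord0 i).
Proof.
rewrite (_ : (fun x => _) = P i \- Q i); last by apply/funext => x; rewrite mxE.
by have [] := mPQ i => *; exact: measurable_funB.
Qed.

Let meg : measurable_fun setT (fun x => enorm (g x)).
Proof. exact: measurable_enorm. Qed.

Variable m : {measure set 'rV[R]_n -> \bar R}.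
Hypothesis mE : forall E, measurable E ->
  m E = (\int[lam]_(x in E) (enorm (g x))%:E)%E.

Let iP i (E K : set 'rV[R]_n) : measurable E -> compact K -> E `<=` K ->
  lam.-integrable E (EFin \o P i) /\ lam.-integrable E (EFin \o Q i).
Proof.
move=> mEE cK EK.
have mK : measurable K.
  have cl : closed K by apply: compact_closed => //; exact: norm_hausdorff.
  by rewrite -(setCK K); apply: measurableC; apply: open_measurable_rV; rewrite openC.
have [P1 Q1] := PQE i mEE; have [mPi mQi] := mPQ i.
have h (mm : {measure set 'rV[R]_n -> \bar R}) : (mm K < +oo)%E -> (mm E < +oo)%E.
  by apply: le_lt_trans; rewrite le_measure ?inE.
split; apply/integrableP; split.
- by apply/measurable_EFinP; exact: measurable_funTS.
- under eq_integral do rewrite /= ger0_norm ?(PQ0 _ _).1//.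
  by rewrite -P1; apply: h; exact: rpos_lty.
- by apply/measurable_EFinP; exact: measurable_funTS.
- under eq_integral do rewrite /= ger0_norm ?(PQ0 _ _).2//.
  by rewrite -Q1; apply: h; exact: rneg_lty.
Qed.

Let ig i (E K : set 'rV[R]_n) : measurable E -> compact K -> E `<=` K ->
  lam.-integrable E (EFin \o (fun x => g x ord0 i)).
Proof.
move=> mEE cK EK; have [i1 i2] := iP i mEE cK EK.
rewrite (_ : _ \o _ = ((EFin \o P i) \- (EFin \o Q i))%E); last first.
  by apply/funext => x /=; rewrite mxE EFinB.
exact: integrableB.
Qed.

Let ieg (E K : set 'rV[R]_n) : measurable E -> compact K -> E `<=` K ->
  lam.-integrable E (EFin \o (fun x => enorm (g x))).
Proof.
move=> mEE cK EK.
have : lam.-integrable E (fun x => \sum_i `|(g x ord0 i)%:E|)%E.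
  apply: integrable_sum => // i _; apply: integrable_abse => //; exact: ig cK EK.
apply: le_integrable => //.
  by apply/measurable_EFinP; exact: measurable_funTS.
move=> x _ /=; rewrite sumEFin lee_fin ger0_norm ?enorm_ge0//.
  by rewrite ger0_norm ?enorm_ge0//; exact: enorm_le_sum.
exact: sumr_ge0.
Qed.

Let mfin (E K : set 'rV[R]_n) : measurable E -> compact K -> E `<=` K ->
  (m E < +oo)%E.
Proof.
move=> mEE cK EK; rewrite mE//; have /integrableP[_] := ieg mEE cK EK.
by under eq_integral do rewrite /= ger0_norm ?enorm_ge0//.
Qed.

Let dot_val v (E K : set 'rV[R]_n) : measurable E -> compact K -> E `<=` K ->
  dot v (radon_val nu E) = \int[lam]_(x in E) dot v (g x).
Proof.
move=> mEE cK EK; rewrite /dot Rintegral_sum//; last first.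
  move=> i; rewrite (_ : _ \o _ =
    (fun x => (v ord0 i)%:E * (g x ord0 i)%:E)%E).
    by apply: integrableZl => //; exact: ig cK EK.
  by apply/funext => x /=; rewrite EFinM.
apply: eq_bigr => i _; rewrite RintegralZl//; last exact: ig cK EK.
congr (_ * _); rewrite mxE; have [i1 i2] := iP i mEE cK EK.
have [-> ->] := PQE i mEE.
rewrite -[LHS]/(\int[lam]_(x in E) P i x - \int[lam]_(x in E) Q i x).
by rewrite -RintegralB//; apply: eq_Rintegral => x _; rewrite mxE.
Qed.

Let idot v (E K : set 'rV[R]_n) : measurable E -> compact K -> E `<=` K ->
  lam.-integrable E (EFin \o (fun x => dot v (g x))).
Proof.
move=> mEE cK EK; rewrite (_ : _ \o _ =
    (fun x => \sum_i (v ord0 i)%:E * (g x ord0 i)%:E)%E); last first.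
  by apply/funext => x /=; rewrite -sumEFin.
by apply: integrable_sum => // i _; apply: integrableZl => //; exact: ig cK EK.
Qed.

(** The vector nu(E) is tested against itself: |nu(E)|^2 is the integral of nu(E) . g over E, at
    most |nu(E)| m(E) by Cauchy-Schwarz. *)
Let val_le (E K : set 'rV[R]_n) : measurable E -> compact K -> E `<=` K ->
  ((enorm (radon_val nu E))%:E <= m E)%E.
Proof.
move=> mEE cK EK; set a := radon_val nu E.
have mEf : m E \is a fin_num by rewrite ge0_fin_numE//; exact: mfin cK EK.
rewrite -(fineK mEf) lee_fin.
have [->|a0] := eqVneq (enorm a) 0; first exact: fine_ge0.
have a_gt0 : 0 < enorm a by rewrite lt0r a0 enorm_ge0.
rewrite -(ler_pM2l a_gt0) -expr2 enorm_sqr {2}/a (dot_val _ mEE cK EK).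
rewrite mE// -[leRHS]/(enorm a * \int[lam]_(x in E) enorm (g x)).
rewrite -RintegralZl//; last exact: ieg cK EK.
apply: le_Rintegral => //; first exact: idot cK EK.
  rewrite (_ : _ \o _ = (fun x => (enorm a)%:E * (enorm (g x))%:E)%E).
    by apply: integrableZl => //; exact: ieg cK EK.
  by apply/funext => x /=; rewrite EFinM.
by move=> x _; exact: dot_le_enorm.
Qed.

Lemma radon_variation_le_polar B : (radon_variation nu B <= m B)%E.
Proof.
apply: ge_ereal_sup => _ [E [mEE pE tE EB] <-].
rewrite -EB measure_bigcup//.
rewrite [leRHS](eq_eseriesl (Q := xpredT)); last by move=> k; rewrite in_setT.
apply: lee_nneseries => [k _ _|k _]; first by rewrite lee_fin enorm_ge0.
apply: (@val_le _ (closure (E k))) => //; last exact: subset_closure.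
by rewrite -precompactE.
Qed.

(** Where the density g is close to a constant v there is little cancellation: testing against v
    gives |nu(S)| >= (|v| - d) lam(S), while m(S) <= (|v| + d) lam(S), with d = n e. *)
Let piece (v : 'rV[R]_n) (e : R) (S K : set 'rV[R]_n) : 0 <= e ->
  measurable S -> compact K -> S `<=` K ->
  (forall x, S x -> forall i, `|g x ord0 i - v ord0 i| <= e) ->
  (m S <= (enorm (radon_val nu S))%:E + (2 * (n%:R * e))%:E * lam S)%E.
Proof.
move=> e0 mS cK SK gv.
have lamS : lam S \is a fin_num by exact: fin_num_measure.
have mSf : m S \is a fin_num by rewrite ge0_fin_numE//; exact: mfin cK SK.
rewrite -(fineK lamS) -(fineK mSf) -EFinM -EFinD lee_fin.
set d := n%:R * e; have d0 : 0 <= d by rewrite mulr_ge0.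
have gvd x : S x -> enorm (g x - v) <= d.
  move=> Sx; apply: le_trans (enorm_le_sum _) _.
  rewrite /d -[n in n%:R]card_ord mulr_natl -sumr_const.
  by apply: ler_sum => i _; rewrite !mxE; have := gv x Sx i; rewrite mxE.
have gv1 x : S x -> enorm (g x) <= enorm v + d.
  move=> Sx; rewrite -[g x](subrK v) addrC.
  by apply: le_trans (enormD _ _) _; rewrite lerD2l gvd.
have lamS0 : 0 <= fine (lam S) by exact: fine_ge0.
have mSle : fine (m S) <= (enorm v + d) * fine (lam S).
  rewrite mE// -Rintegral_cst//; apply: le_Rintegral => //.
  - exact: ieg cK SK.
  - exact: finite_measure_integrable_cst.
have [v0|v0] := eqVneq (enorm v) 0.
  rewrite (le_trans mSle)// v0 add0r (_ : 2 * d = d + d); last by lra.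
  by rewrite mulrDl addrA lerDr addr_ge0 ?enorm_ge0 ?mulr_ge0.
have v_gt0 : 0 < enorm v by rewrite lt0r v0 enorm_ge0.
suff : (enorm v - d) * fine (lam S) <= enorm (radon_val nu S) by lra.
rewrite -(ler_pM2l v_gt0); apply: le_trans (dot_le_enorm _ _).
rewrite (dot_val _ mS cK SK) mulrA -Rintegral_cst//; apply: le_Rintegral => //.
- exact: finite_measure_integrable_cst.
- exact: idot cK SK.
move=> x Sx; rewrite -[g x](subrK v) dotDr mulrBr -expr2 enorm_sqr [leRHS]addrC lerD2l.
rewrite lerNl -dotNr; apply: le_trans (dot_le_enorm _ _) _.
by rewrite enormN ler_wpM2l ?enorm_ge0// gvd.
Qed.

(** The converse of [radon_variation_le_polar] up to an error: [B] is cut into countably many pieces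
    on which each coordinate of g varies by at most e, and the errors of [piece] add up to a
    multiple of lam(setT), which is finite. *)
Let lower (B : set 'rV[R]_n) (e : R) : measurable B -> 0 < e ->
  (m B <= radon_variation nu B + (2 * (n%:R * e))%:E * lam setT)%E.
Proof.
move=> mB e0.
(* Cells of mesh e for the values of g, intersected with the shells k <= |x| < k + 1 of the sup
   norm; the shells make the pieces precompact, as [radon_variation] demands. *)
pose S (c : 'rV[int]_n * nat) : set 'rV[R]_n := B `&`
  (\bigcap_(i in [set: 'I_n]) [set x | (c.1 ord0 i)%:~R * e <= g x ord0 i < (c.1 ord0 i + 1)%:~R * e]) `&`
  [set x | c.2%:R <= `|x| < c.2.+1%:R].
have mS c : measurable (S c).
  apply: measurableI; first (apply: measurableI => //).
    apply: fin_bigcap_measurable => [|i _]; first exact: finite_finset.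
    rewrite -[X in measurable X]setTI.
    have := mg i measurableT
      (measurable_itv `[(c.1 ord0 i)%:~R * e, (c.1 ord0 i + 1)%:~R * e[).
    by congr measurable; apply/seteqP; split => x /=; rewrite ?in_itv/= => -[].
  rewrite -[X in measurable X]setTI.
  have mn : measurable_fun setT (Num.norm : 'rV[R]_n -> R).
    by apply: continuous_measurable_rV => x; exact: norm_continuous.
  have := mn measurableT _ (measurable_itv `[c.2%:R, c.2.+1%:R[).
  by congr measurable; apply/seteqP; split => x /=; rewrite ?in_itv/= => -[].
have tS c c' x : S c x -> S c' x -> c = c'.
  case: c c' => [q k] [q' k'] [[_ /= h1] /andP[k1 k2]] [[_ /= h2] /andP[k3 k4]].
  congr pair.
    apply/rowP => i; have := h1 i I; have := h2 i I => /= /andP[a1 a2] /andP[b1 b2].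
    have lt1 (z t : int) (u : R) : z%:~R * e <= u -> u < (t + 1)%:~R * e -> (z <= t)%R.
      move=> zu ut; rewrite -ltzD1 -(ltr_int R) -(ltr_pM2r e0).
      exact: le_lt_trans zu ut.
    by apply/eqP; rewrite eq_le (lt1 _ _ _ a1 b2) (lt1 _ _ _ b1 a2).
  apply/eqP; rewrite eqn_leq -ltnS -(ltr_nat R) (le_lt_trans k1 k4)/=.
  by rewrite -ltnS -(ltr_nat R) (le_lt_trans k3 k2).
(* The countable index type is enumerated by [pickle]; integers that encode nothing give empty
   pieces. *)
pose E j : set 'rV[R]_n := if pickle_inv j is Some c then S c else set0.
have mEj j : measurable (E j) by rewrite /E; case: pickle_inv.
have EB : \bigcup_j E j = B.
  apply/seteqP; split => [x [j _]|x Bx].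
    by rewrite /E; case: pickle_inv => // c [[]].
  pose c : 'rV[int]_n * nat := (\row_i Num.floor (g x ord0 i / e), Num.trunc `|x|).
  exists (pickle c) => //; rewrite /E pickleK_inv; split; first split => //.
    move=> i _ /=; rewrite mxE -ler_pdivlMr// -ltr_pdivrMr//.
    by have := floor_itv (g x ord0 i / e).
  by rewrite /=; apply: truncn_itv.
have tE : trivIset setT E.
  apply/trivIsetP => i j _ _ ij; rewrite -subset0 => x [].
  rewrite /E; have := @pickle_invK ('rV[int]_n * nat)%type i; have := @pickle_invK ('rV[int]_n * nat)%type j.
  case: (pickle_inv i) => //= c; case: (pickle_inv j) => //= c' cj ci Sc Sc'.
  by move: ij; rewrite -(ci : pickle c = i) -(cj : pickle c' = j) (tS _ _ _ Sc Sc') eqxx.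
have subE j : exists k : nat, E j `<=` cube k%:R.
  rewrite /E; case: pickle_inv => [c|]; last by exists 0%N.
  by exists c.2.+1 => x [_ /= /andP[_ /ltW]].
have pE j : precompact (E j).
  have [k Ek] := subE j; apply: (precompact_subset Ek).
  rewrite precompact_closed; [exact: compact_cube|exact: closed_cube].
rewrite -{1}EB measure_bigcup//.
rewrite [leLHS](eq_eseriesl (Q := xpredT)); last by move=> k; rewrite in_setT.
apply: (@le_trans _ _ (\sum_(j <oo) ((enorm (radon_val nu (E j)))%:E +
    (2 * (n%:R * e))%:E * lam (E j)))%E).
  apply: lee_nneseries => // j _; have [k Ek] := subE j.
  have e0' := ltW e0.
  move: Ek (mEj j); rewrite /E; case: pickle_inv => [c|] Sk mSc.
    apply: (@piece (\row_i ((c.1 ord0 i)%:~R * e)) _ _ (cube k%:R)) => //.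
      exact: compact_cube.
    move=> x [[_ /= h] _] i; have := h i I => /= /andP[h1 h2].
    rewrite [X in _ - X]mxE ger0_norm ?subr_ge0// lerBlDl.
    by move: h2; rewrite intrD mulrDl mul1r => /ltW.
  by rewrite measure0 adde_ge0 ?lee_fin ?enorm_ge0// mule_ge0// lee_fin !mulr_ge0.
have c0 : 0 <= 2 * (n%:R * e) by rewrite !mulr_ge0// ltW.
rewrite nneseriesD; last 2 first.
- by move=> j _ _; rewrite lee_fin enorm_ge0.
- by move=> j _ _; rewrite mule_ge0// lee_fin.
apply: leeD; first by apply: ereal_sup_ubound; exists E.
rewrite nneseriesZl// lee_wpmul2l ?lee_fin//.
rewrite [leLHS](eq_eseriesl (Q := fun j => j \in setT)); last by move=> k; rewrite in_setT.
by rewrite -measure_bigcup// le_measure ?inE//; exact: bigcup_measurable.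
Qed.

Lemma radon_variation_polar B : measurable B -> radon_variation nu B = m B.
Proof.
move=> mB; apply/eqP; rewrite eq_le radon_variation_le_polar/=.
apply/lee_addgt0Pr => e e0.
have lamT : lam setT \is a fin_num by exact: fin_num_measure.
pose c := 2 * n%:R * fine (lam setT).
have c0 : 0 <= c by rewrite !mulr_ge0// fine_ge0.
have e1 : 0 < e / (c + 1) by rewrite divr_gt0// ltr_wpDl.
apply: le_trans (lower mB e1) _; rewrite leeD2l// -(fineK lamT) -EFinM lee_fin.
rewrite (_ : _ * _ = c / (c + 1) * e); last by rewrite /c; field; rewrite gt_eqF// ltr_wpDl.
by rewrite ler_piMl ?(ltW e0)// ler_pdivrMr ?ltr_wpDl// mul1r lerDl.
Qed.

Lemma polar_lty K : compact K -> (m K < +oo)%E.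
Proof.
move=> cK; have [k Kk] := compact_sub_cube cK.
apply: (@le_lt_trans _ _ (m (cube k%:R))).
  apply: le_measure => //; rewrite inE; last exact: measurable_cube.
  have cl : closed K by apply: compact_closed => //; exact: norm_hausdorff.
  by rewrite -(setCK K); apply: measurableC; apply: open_measurable_rV; rewrite openC.
apply: (@mfin _ (cube k%:R)) => //; [exact: measurable_cube|exact: compact_cube].
Qed.

(** Boundedness and bounded support make phi integrable against the positive and the negative parts
    separately, so that a difference of integrals becomes the integral of one density. *)
Lemma radon_pairing_polar (sg phi : 'rV[R]_n -> 'rV[R]_n) M r :
  (forall x, g x = enorm (g x) *: sg x) ->
  (forall i, measurable_fun setT (fun x => sg x ord0 i)) ->
  (forall i, measurable_fun setT (fun x => phi x ord0 i)) ->
  (forall i x, `|phi x ord0 i| <= M) -> (forall x, phi x != 0 -> `|x| <= r) ->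
  radon_pairing nu phi = \int[m]_x dot (phi x) (sg x).
Proof.
move=> gsg msg mphi phiM phir.
have phir' i x : phi x ord0 i != 0 -> `|x| <= r.
  by move=> h; apply: phir; apply: contraNN h => /eqP ->; rewrite mxE.
rewrite (Rintegral_density (mu := lam) (k := fun x => enorm (g x)))//; last first.
- exact: measurable_dot.
- by move=> x; exact: enorm_ge0.
have PQE1 i E : measurable E -> rpos nu i E = (\int[lam]_(x in E) (P i x)%:E)%E.
  by move=> /(PQE i)[].
have PQE2 i E : measurable E -> rneg nu i E = (\int[lam]_(x in E) (Q i x)%:E)%E.
  by move=> /(PQE i)[].
have i1 i : lam.-integrable setT (fun x => (phi x ord0 i * P i x)%:E).
  apply: (integrable_density _ _ (PQE1 i) _).1 => //.
  - by move=> x; have [] := PQ0 i x.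
  - by have [] := mPQ i.
  - apply: (@bounded_supp_integrable _ _ M r) => //; [exact: rpos_lty|exact: phir'].
have i2 i : lam.-integrable setT (fun x => (phi x ord0 i * Q i x)%:E).
  apply: (integrable_density _ _ (PQE2 i) _).1 => //.
  - by move=> x; have [] := PQ0 i x.
  - by have [] := mPQ i.
  - apply: (@bounded_supp_integrable _ _ M r) => //; [exact: rneg_lty|exact: phir'].
transitivity (\sum_i \int[lam]_x (phi x ord0 i * g x ord0 i)).
  apply: eq_bigr => i _.
  rewrite (Rintegral_density _ _ (PQE1 i))//; last 2 first.
  - by move=> x; have [] := PQ0 i x.
  - by have [] := mPQ i.
  rewrite (Rintegral_density _ _ (PQE2 i))//; last 2 first.
  - by move=> x; have [] := PQ0 i x.
  - by have [] := mPQ i.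
  rewrite -RintegralB//; [|exact: i1|exact: i2].
  by apply: eq_Rintegral => x _; rewrite mxE mulrBr.
rewrite -Rintegral_sum//; last first.
  move=> i; have := integrableB measurableT (i1 i) (i2 i); congr integrable.
  by apply/funext => x /=; rewrite -EFinB mxE mulrBr.
apply: eq_Rintegral => x _; rewrite mulrC -dotZr -gsg //.
Qed.

End polar.

Lemma radon_polar (R : realType) (n : nat) (nu : radon R n) : (0 < n)%N ->
  exists (m : {measure set 'rV[R]_n -> \bar R}) (sg : 'rV[R]_n -> 'rV[R]_n),
  [/\ forall K, compact K -> (m K < +oo)%E,
    forall i, measurable_fun setT (fun x => sg x ord0 i),
    forall x, dot (sg x) (sg x) = 1,
    forall B, measurable B -> radon_variation nu B = m B &
    forall (phi : 'rV[R]_n -> 'rV[R]_n) M r, (forall i, measurable_fun setT (fun x => phi x ord0 i)) ->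
      (forall i x, `|phi x ord0 i| <= M) -> (forall x, phi x != 0 -> `|x| <= r) ->
      radon_pairing nu phi = \int[m]_x dot (phi x) (sg x)].
Proof.
case: n nu => // n nu _.
have [lam [P [Q [PQ0 mPQ PQE]]]] := radon_density nu.
pose g x : 'rV[R]_n.+1 := \row_i (P i x - Q i x).
have mg i : measurable_fun setT (fun x => g x ord0 i).
  rewrite (_ : (fun x => _) = P i \- Q i); last by apply/funext => x; rewrite mxE.
  by have [] := mPQ i => *; exact: measurable_funB.
have meg : measurable_fun setT (fun x => enorm (g x)) by exact: measurable_enorm.
have [m mE] : exists m : {measure set 'rV[R]_n.+1 -> \bar R},
    forall E, measurable E -> m E = (\int[lam]_(x in E) (enorm (g x))%:E)%E.
  apply: density_measure; first by move=> x; rewrite lee_fin enorm_ge0.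
  exact/measurable_EFinP.
(* Where g vanishes any unit vector will do, [m] having density 0 there; that a unit vector exists
   is where n > 0 is used. *)
pose sg x : 'rV[R]_n.+1 := if enorm (g x) == 0 then e_ R ord0 else (enorm (g x))^-1 *: g x.
have msg i : measurable_fun setT (fun x => sg x ord0 i).
  rewrite (_ : (fun x => _) = (fun x => if enorm (g x) == 0 then e_ R ord0 ord0 i
      else (enorm (g x)) `^ (-1) * g x ord0 i)); last first.
    apply/funext => x; rewrite /sg; case: ifP => // _.
    by rewrite mxE powR_inv1// enorm_ge0.
  apply: measurable_fun_ifT => //.
    exact: measurable_fun_eqr.
  apply: measurable_funM => //.
  by apply: (measurableT_comp (measurable_powR (-1))).
exists m, sg; split => //.
- by move=> K; apply: (polar_lty PQ0 mPQ PQE mE).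
- move=> x; rewrite /sg; case: ifPn => [_|g0].
    rewrite /dot (bigD1 ord0)//= big1 ?addr0; first by rewrite mxE !eqxx mulr1.
    by move=> i i0; rewrite mxE eqxx/= (negbTE i0) mul0r.
  rewrite dotZr dotC dotZr -enorm_sqr expr2 mulKf// mulVf//.
- by move=> B; apply: (radon_variation_polar PQ0 mPQ PQE mE).
- move=> phi M r; apply: (radon_pairing_polar PQ0 mPQ PQE mE) => // x.
  rewrite -/(g x) /sg; case: ifPn => [/eqP/enorm_eq0 ->|g0].
    by rewrite enorm0 scale0r.
  by rewrite scalerA divff// scale1r.
Qed.

(** * Density of Lipschitz functions and duality *)

Section lipschitz_functions.
Context (R : realType) (n : nat).
Implicit Types (h f : 'rV[R]_n -> R).

Definition klip (K : R) h := forall x y, `|h x - h y| <= K * `|x - y|.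

Definition blip h :=
  (exists M, forall x, `|h x| <= M) /\ (exists2 K, 0 <= K & klip K h).

Lemma klip_continuous K h : 0 <= K -> klip K h -> continuous h.
Proof.
move=> K0 hK x; apply/(@cvgrPdist_lt _ _ _ (nbhs x) (nbhs_filter x)) => e e0.
have d0 : 0 < e / (K + 1) by rewrite divr_gt0// ltr_wpDl.
apply/nbhs_ballP; exists (e / (K + 1)) => //= y.
rewrite mx_norm_ball /ball_/= => xy; apply: le_lt_trans (hK _ _) _.
apply: (@le_lt_trans _ _ ((K + 1) * `|x - y|)).
  by rewrite ler_wpM2r// lerDl.
by rewrite mulrC -ltr_pdivlMr ?ltr_wpDl.
Qed.

Lemma klip_measurable K h : 0 <= K -> klip K h -> measurable_fun setT h.
Proof. by move=> K0 /(klip_continuous K0)/continuous_measurable_rV. Qed.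

Lemma blip_measurable h : blip h -> measurable_fun setT h.
Proof. by move=> [_ [K K0 hK]]; exact: klip_measurable hK. Qed.

Lemma klip_le K K' h : K <= K' -> klip K h -> klip K' h.
Proof. by move=> KK hK x y; rewrite (le_trans (hK x y))// ler_wpM2r. Qed.

Lemma klip_max K h f : klip K h -> klip K f -> klip K (fun x => Num.max (h x) (f x)).
Proof.
move=> hK fK x y; have := hK x y; have := fK x y; set t := K * _.
by rewrite !ler_norml; case: (leP (h x)); case: (leP (h y)); lra.
Qed.

Lemma klip_min K h f : klip K h -> klip K f -> klip K (fun x => Num.min (h x) (f x)).
Proof.
move=> hK fK x y; have := hK x y; have := fK x y; set t := K * _.
by rewrite !ler_norml; case: (leP (h x)); case: (leP (h y)); lra.
Qed.

Lemma klip_cst (c : R) K : 0 <= K -> klip K (cst c).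
Proof. by move=> K0 x y; rewrite subrr normr0 mulr_ge0. Qed.

Lemma blip_cst (c : R) : blip (cst c).
Proof.
by split; [exists (Num.norm c)|exists 0 => //; exact: klip_cst].
Qed.

Lemma blipD h f : blip h -> blip f -> blip (fun x => h x + f x).
Proof.
move=> [[M hM] [K K0 hK]] [[M' fM] [K' K'0 fK]]; split.
  by exists (M + M') => x; rewrite (le_trans (ler_normD _ _))// lerD.
exists (K + K'); first exact: addr_ge0.
move=> x y; rewrite opprD addrACA mulrDl.
by rewrite (le_trans (ler_normD _ _))// lerD.
Qed.

Lemma blipM h f : blip h -> blip f -> blip (fun x => h x * f x).
Proof.
move=> [[M hM] [K K0 hK]] [[M' fM] [K' K'0 fK]]; split.
  by exists (M * M') => x; rewrite normrM ler_pM.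
have x0 : 'rV[R]_n := 0.
have M0 : 0 <= M by exact: le_trans (hM x0).
have M'0 : 0 <= M' by exact: le_trans (fM x0).
exists (M * K' + M' * K); first by rewrite addr_ge0// mulr_ge0.
move=> x y; have -> : h x * f x - h y * f y = h x * (f x - f y) + f y * (h x - h y).
  by ring.
rewrite mulrDl -!mulrA (le_trans (ler_normD _ _))// !normrM.
by rewrite lerD// ler_pM.
Qed.

Lemma blip_sum (I : Type) (s : seq I) (h : I -> 'rV[R]_n -> R) :
  (forall i, blip (h i)) -> blip (fun x => \sum_(i <- s) h i x).
Proof.
move=> hb; elim: s => [|i s IH].
  rewrite (_ : (fun x => _) = cst 0); first exact: blip_cst.
  by apply/funext => x; rewrite big_nil.
rewrite (_ : (fun x => _) = (fun x => h i x + \sum_(i <- s) h i x)).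
  exact: blipD.
by apply/funext => x; rewrite big_cons.
Qed.

Lemma blip_max h k : blip h -> blip k -> blip (fun x => Num.max (h x) (k x)).
Proof.
move=> [[M hM] [K K0 hK]] [[M' kM] [K' K'0 kK]]; split.
  exists (Num.max M M') => x; have := hM x; have := kM x.
  rewrite !ler_norml; case: (leP (h x) (k x)); case: (leP M M'); lra.
exists (Num.max K K'); first by rewrite le_max K0.
by apply: klip_max; [apply: klip_le hK|apply: klip_le kK]; rewrite le_max lexx ?orbT.
Qed.

Lemma blip_clamp h : blip h -> blip (fun x => Num.max (- 1) (Num.min 1 (h x))).
Proof.
move=> [_ [K K0 hK]]; split.
  by exists 1 => x; rewrite ler_norml le_max lexx ge_max ge_min lexx/= andbT; lra.
exists K => //; apply: klip_max; first exact: (klip_cst (- 1) K0).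
by apply: klip_min => //; exact: (klip_cst 1 K0).
Qed.

Lemma blip_inv h : blip h -> (forall x, 1 <= h x) -> blip (fun x => (h x)^-1).
Proof.
move=> [_ [K K0 hK]] h1.
have h0 x : 0 < h x by exact: lt_le_trans (h1 x).
split; first by exists 1 => x; rewrite normfV invf_le1 ?normr_gt0 ?gt_eqF// ger0_norm// ltW.
exists K => // x y; apply: le_trans (hK x y).
have -> : (h x)^-1 - (h y)^-1 = (h y - h x) * ((h x)^-1 * (h y)^-1).
  by field; rewrite !gt_eqF.
rewrite normrM distrC ler_piMr// -invfM ger0_norm; last first.
  by rewrite invr_ge0 mulr_ge0// ltW.
by rewrite invf_le1 ?mulr_gt0// mulr_ege1.
Qed.

(** The Pasch-Hausdorff envelopes inf_y (f y + k |x - y|) are k-Lipschitz minorants, and they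
    increase to f because f is lower semicontinuous. *)
Lemma inf_convolution f : (forall x, 0 <= f x) ->
  (forall x e, 0 < e -> exists2 d, 0 < d & forall y, `|x - y| < d -> f x - e <= f y) ->
  exists f_ : nat -> 'rV[R]_n -> R, [/\ forall k x, 0 <= f_ k x <= f x,
    forall k, klip k%:R (f_ k), forall x, nondecreasing_seq (f_ ^~ x) &
    forall x, f_ k x @[k --> \oo] --> f x].
Proof.
move=> f0 lsc.
pose A (k : nat) x := [set f y + k%:R * `|x - y| | y in [set: 'rV[R]_n]].
have A0 k x : A k x !=set0 by exists (f x + k%:R * `|x - x|); exists x.
have Ab k x : lbound (A k x) 0 by move=> _ [y _ <-]; rewrite addr_ge0// mulr_ge0.
have Alb k x : has_lbound (A k x) by exists 0; exact: Ab.
pose f_ k x := inf (A k x).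
have f_le k x y : f_ k x <= f y + k%:R * `|x - y|.
  by apply: (ge_inf (Alb k x)); exists y.
have f_ge k x c : (forall y, c <= f y + k%:R * `|x - y|) -> c <= f_ k x.
  by move=> h; apply: lb_le_inf => // _ [y _ <-].
have f_f k x : f_ k x <= f x by have := f_le k x x; rewrite subrr normr0 mulr0 addr0.
exists f_; split.
- by move=> k x; rewrite f_f andbT; apply: f_ge => y; rewrite addr_ge0// mulr_ge0.
- have h k x y : f_ k x - k%:R * `|x - y| <= f_ k y.
    apply: f_ge => z; rewrite lerBlDr; apply: le_trans (f_le k x z) _.
    rewrite -addrA -mulrDr lerD2l ler_wpM2l//.
    by rewrite -(subrKA y x) (le_trans (ler_normD _ _))// addrC.
  move=> k x y; have := h k x y; have := h k y x.
  by rewrite distrC ler_norml; lra.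
- move=> x a b ab; apply: f_ge => y; apply: le_trans (f_le a x y) _.
  by rewrite lerD2l ler_wpM2r// ler_nat.
move=> x; apply/cvgrPdist_le => e e0.
have [d d0 fd] := lsc x e e0.
near=> k.
rewrite ger0_norm ?subr_ge0// lerBlDr -lerBlDl; apply: f_ge => y.
(* Within distance d of x, lower semicontinuity bounds f y from below; beyond it the penalty k d
   reaches f x once k >= f x / d. *)
have [/fd fy|dy] := ltP `|x - y| d.
  by rewrite (le_trans fy)// lerDl mulr_ge0.
apply: (@le_trans _ _ (k%:R * d)); last first.
  by rewrite ler_wpDl// ler_wpM2l.
apply: (@le_trans _ _ (f x)); first by rewrite lerBlDr lerDl ltW.
rewrite -ler_pdivrMr//; near: k; exact: nbhs_infty_ger.
Unshelve. all: by end_near. Qed.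

End lipschitz_functions.

Section lipschitz_dense.
Local Open Scope ereal_scope.
Context (R : realType) (n : nat) (mu : {finite_measure set 'rV[R]_n -> \bar R}).

Import HBSimple.

Definition lip_approx (f : 'rV[R]_n -> R) := measurable_fun setT f /\
  forall e : R, (0 < e)%R -> exists2 h, blip h & \int[mu]_x `|(f x - h x)%:E| <= e%:E.

Lemma dist_integral_le (a b c : 'rV[R]_n -> R) :
  measurable_fun setT a -> measurable_fun setT b -> measurable_fun setT c ->
  \int[mu]_x `|(a x - c x)%:E| <=
  \int[mu]_x `|(a x - b x)%:E| + \int[mu]_x `|(b x - c x)%:E|.
Proof.
move=> ma mb mc.
have m1 : measurable_fun setT (fun x => `|(a x - b x)%:E|).
  by do 2 apply: measurableT_comp => //; exact: measurable_funB.
have m2 : measurable_fun setT (fun x => `|(b x - c x)%:E|).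
  by do 2 apply: measurableT_comp => //; exact: measurable_funB.
rewrite -ge0_integralD//; apply: ge0_le_integral => //.
- by do 2 apply: measurableT_comp => //; exact: measurable_funB.
- exact: emeasurable_funD.
- move=> x _; rewrite -EFinD lee_fin -(subrKA (b x)); exact: ler_normD.
Qed.

Lemma lip_approx_lim (f : 'rV[R]_n -> R) (f_ : nat -> 'rV[R]_n -> R) :
  measurable_fun setT f -> (forall k, lip_approx (f_ k)) ->
  \int[mu]_x `|(f_ k x - f x)%:E| @[k --> \oo] --> 0 -> lip_approx f.
Proof.
move=> mf fk lim; split => // e e0.
have e20 : (0 < e / 2)%R by rewrite divr_gt0.
have [k kle] : exists k, \int[mu]_x `|(f_ k x - f x)%:E| <= (e / 2)%:E.
  have : \forall k \near \oo, \int[mu]_x `|(f_ k x - f x)%:E| < (e / 2)%:E.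
    apply: (lim [set u | u < (e / 2)%:E]).
    apply: open_nbhs_nbhs; split; first exact: open_ereal_lt_ereal.
    by rewrite /= lte_fin.
  by move=> [N _ h]; exists N; apply/ltW/(h N) => /=.
have [mfk /(_ _ e20)[h bh hle]] := fk k.
exists h => //; apply: le_trans (dist_integral_le mf mfk (blip_measurable bh)) _.
rewrite [e]splitr EFinD leeD//.
by under eq_integral do rewrite EFinB -abseN -EFinB -EFinN opprB.
Qed.

Lemma lip_approx_bounded_lim (f : 'rV[R]_n -> R) (f_ : nat -> 'rV[R]_n -> R) :
  (forall k, lip_approx (f_ k)) -> (forall k x, (`|f_ k x| <= 1)%R) ->
  (forall x, f_ k x @[k --> \oo] --> f x) -> lip_approx f.
Proof.
move=> fk fk1 lim.
have mfk k : measurable_fun setT (f_ k) by have [] := fk k.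
have mf : measurable_fun setT f by apply: (measurable_fun_cvg mfk) => x _; exact: lim.
have [_ h _] : [/\ mu.-integrable setT (EFin \o f),
    \int[mu]_x `|(f_ k x)%:E - (f x)%:E| @[k --> \oo] --> 0 &
    \int[mu]_x (f_ k x)%:E @[k --> \oo] --> \int[mu]_x (f x)%:E].
  apply: (@dominated_convergence _ _ _ _ _ _ _ _ (cst 1)) => //.
  - by move=> k; exact/measurable_EFinP.
  - exact/measurable_EFinP.
  - by apply: aeW => x _; apply/cvg_EFin; [exact: nearW|exact: lim].
  - exact: finite_measure_integrable_cst.
  - by apply: aeW => x k _; rewrite lee_fin.
exact: lip_approx_lim h.
Qed.

Lemma lip_approx_blip h : blip h -> lip_approx h.
Proof.
move=> bh; split; first exact: blip_measurable.
move=> e e0; exists h => //.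
by under eq_integral do rewrite subrr abse0; rewrite integral0 lee_fin ltW.
Qed.

Lemma lip_approxD f g : lip_approx f -> lip_approx g ->
  lip_approx (fun x => f x + g x)%R.
Proof.
move=> [mf hf] [mg hg]; split; first exact: measurable_funD.
move=> e e0; have e20 : (0 < e / 2)%R by rewrite divr_gt0.
have [h bh hle] := hf _ e20; have [k bk kle] := hg _ e20.
have mh := blip_measurable bh; have mk := blip_measurable bk.
exists (fun x => h x + k x)%R; first exact: blipD.
have mfh : measurable_fun setT (fun x => `|(f x - h x)%:E|).
  by do 2 apply: measurableT_comp => //; exact: measurable_funB.
have mgk : measurable_fun setT (fun x => `|(g x - k x)%:E|).
  by do 2 apply: measurableT_comp => //; exact: measurable_funB.
rewrite [e]splitr EFinD; apply: le_trans (leeD hle kle).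
rewrite -ge0_integralD//; apply: ge0_le_integral => //.
- do 2 apply: measurableT_comp => //; apply: measurable_funB;
  exact: measurable_funD.
- exact: emeasurable_funD.
- by move=> x _; rewrite -EFinD lee_fin opprD addrACA ler_normD.
Qed.

Lemma lip_approxZ (r : R) f : lip_approx f -> lip_approx (fun x => r * f x)%R.
Proof.
move=> [mf hf]; split; first exact: measurable_funM.
move=> e e0; have r1 : (0 < `|r| + 1)%R by rewrite ltr_wpDl.
have e10 : (0 < e / (`|r| + 1))%R by rewrite divr_gt0.
have [h bh hle] := hf _ e10; exists (fun x => r * h x)%R.
  exact: (blipM (blip_cst _ r)).
under eq_integral do rewrite -mulrBr EFinM abseM.
rewrite ge0_integralZl//; last first.
  do 2 apply: measurableT_comp => //; apply: measurable_funB => //.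
  exact: blip_measurable.
apply: (@le_trans _ _ ((`|r|)%:E * (e / (`|r| + 1))%:E)).
  by rewrite lee_wpmul2l// lee_fin.
rewrite -EFinM lee_fin mulrCA ler_piMr ?(ltW e0)//.
by rewrite ler_pdivrMr// mul1r lerDl.
Qed.

Lemma lip_approx_sum (I : Type) (s : seq I) (f : I -> 'rV[R]_n -> R) :
  (forall i, lip_approx (f i)) -> lip_approx (fun x => \sum_(i <- s) f i x)%R.
Proof.
move=> hf; elim: s => [|i s IH].
  rewrite (_ : (fun x => _) = cst 0%R); first exact/lip_approx_blip/blip_cst.
  by apply/funext => x; rewrite big_nil.
rewrite (_ : (fun x => _) = (fun x => f i x + \sum_(j <- s) f j x)%R).
  exact: lip_approxD.
by apply/funext => x; rewrite big_cons.
Qed.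

(** Open sets have lower semicontinuous indicators, which are limits of their Lipschitz envelopes.
    Stability under complements and finite unions, then under bounded pointwise limits, makes [good]
    a sigma-algebra containing them. *)
Let good := [set E : set 'rV[R]_n | lip_approx \1_E].

Let good_open (U : set 'rV[R]_n) : open U -> good U.
Proof.
move=> oU; have i0 x : (0 <= (\1_U x : R))%R by [].
have [|f_ [f01 fk _ lim]] := @inf_convolution _ _ (\1_U : 'rV[R]_n -> R) i0.
  move=> x e e0; rewrite indicE; have [/set_mem Ux|Ux] := boolP (x \in U); last first.
    by exists 1%R => // y _; rewrite (@le_trans _ _ 0%R)// sub0r oppr_le0 ltW.
  have /nbhs_ballP[d /= d0 xU] := open_nbhs_nbhs (conj oU Ux).
  exists d => // y xy; rewrite indicE mem_set ?lerBlDr ?lerDl ?ltW//.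
  by apply: xU; rewrite mx_norm_ball.
apply: (lip_approx_bounded_lim _ _ lim).
  move=> k; apply: lip_approx_blip; split; last by exists k%:R.
  exists 1%R => x; have /andP[a b] := f01 k x.
  by rewrite ger0_norm// (le_trans b).
by move=> k x; have /andP[a b] := f01 k x; rewrite ger0_norm// (le_trans b).
Qed.

Let good_setC (A : set 'rV[R]_n) : good A -> good (~` A).
Proof.
move=> gA; rewrite /good/= (_ : \1_(~` A) = (fun x => 1 + -1 * \1_A x)%R).
  apply: lip_approxD; first exact/lip_approx_blip/blip_cst.
  exact: lip_approxZ.
apply/funext => x; rewrite !indicE in_setC; case: (x \in A) => /=; ring.
Qed.

Let good_setU (A B : set 'rV[R]_n) : good A -> good B -> good (A `|` B).
Proof.
move=> [mA hA] [mB hB]; split.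
  have m h : measurable_fun setT (\1_h : 'rV[R]_n -> R) -> measurable h.
    move=> mh; have := mh measurableT _ (measurable_set1 (1%R : R)).
    rewrite setTI; congr measurable; apply/seteqP; split => x /=.
      by rewrite indicE; have [/set_mem//|_ /esym/eqP] := boolP (x \in h); rewrite oner_eq0.
    by move=> hx; rewrite indicE mem_set.
  by apply: measurable_indic; apply: measurableU; exact: m.
move=> e e0; have e20 : (0 < e / 2)%R by rewrite divr_gt0.
have [h bh hle] := hA _ e20; have [k bk kle] := hB _ e20.
have mh := blip_measurable bh; have mk := blip_measurable bk.
exists (fun x => Num.max (h x) (k x)); first exact: blip_max.
have mfh : measurable_fun setT (fun x => `|(\1_A x - h x)%:E|).
  by do 2 apply: measurableT_comp => //; exact: measurable_funB.
have mgk : measurable_fun setT (fun x => `|(\1_B x - k x)%:E|).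
  by do 2 apply: measurableT_comp => //; exact: measurable_funB.
have mAB : measurable_fun setT (fun x => Num.max (\1_A x) (\1_B x) : R).
  exact: measurable_maxr.
rewrite [e]splitr EFinD; apply: le_trans (leeD hle kle).
rewrite -ge0_integralD//.
have -> : \1_(A `|` B) = (fun x => Num.max (\1_A x) (\1_B x)) :> ('rV[R]_n -> R).
  apply/funext => x; rewrite !indicE in_setU.
  by case: (x \in A); case: (x \in B) => /=; rewrite ?maxxx//; case: leP; lra.
apply: ge0_le_integral => //.
- do 2 apply: measurableT_comp => //; apply: measurable_funB => //.
  exact: measurable_maxr.
- exact: emeasurable_funD.
- move=> x _; rewrite -EFinD lee_fin.
  move: (\1_A x) (\1_B x) => a b.
  have := ler_norm (a - h x); have := ler_norm (b - k x).
  have := ler_norm (- (a - h x)); have := ler_norm (- (b - k x)); rewrite !normrN.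
  by rewrite ler_norml; case: (leP a b); case: (leP (h x) (k x)); lra.
Qed.

Let good_bigcup (F : (set 'rV[R]_n)^nat) :
  (forall i, good (F i)) -> good (\bigcup_i F i).
Proof.
move=> gF; pose G k := \big[setU/set0]_(i < k) F i.
have gG k : good (G k).
  rewrite /G; elim: k => [|k IH]; last by rewrite big_ord_recr; exact: good_setU.
  rewrite big_ord0 /good/= indic0; exact/lip_approx_blip/blip_cst.
apply: (@lip_approx_bounded_lim _ (fun k => \1_(G k))) => //.
  by move=> k x; rewrite ger0_norm// indicE lern1 leq_b1.
move=> x; apply: cvg_near_cst.
have [[i _ Fix]|nF] := pselect ((\bigcup_i F i) x).
  exists i.+1 => // k /= ik; rewrite !indicE !mem_set//; first by exists i.
  by rewrite /G -bigcup_mkord; exists i.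
apply: nearW => k; rewrite !indicE !memNset//.
by rewrite /G -bigcup_mkord => -[i _ Fix]; apply: nF; exists i.
Qed.

Lemma lip_approx_indic (E : set 'rV[R]_n) : measurable E -> lip_approx \1_E.
Proof.
apply: (@smallest_sub _ (sigma_algebra setT) [set U : set 'rV[R]_n | open U] good).
  split => //.
  - by rewrite /good/= indic0; exact/lip_approx_blip/blip_cst.
  - by move=> A gA; rewrite setTD; exact: good_setC.
by move=> U; exact: good_open.
Qed.

Lemma lip_approx_integrable f : mu.-integrable setT (EFin \o f) -> lip_approx f.
Proof.
move=> fi; have [g_ [gi _ lim]] := approximation_sfun_integrable measurableT fi.
refine (@lip_approx_lim f (fun k x => g_ k x) _ _ _).
- by apply/measurable_EFinP; exact: measurable_int fi.
- move=> k; rewrite (_ : (fun x => g_ k x) = (fun x =>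
      \sum_(y <- finmap.enum_fset (fset_set (range (g_ k)))) y * \1_(g_ k @^-1` [set y]) x)%R).
    by apply: lip_approx_sum => y; apply: lip_approxZ; exact: lip_approx_indic.
  by apply/funext => x; rewrite [LHS]fimfunE fsbig_finite.
- move: lim; apply: cvg_trans; apply: near_eq_cvg; apply: nearW => k /=.
  by apply: eq_integral => x _ /=; rewrite distrC.
Qed.

End lipschitz_dense.

(** * Duality between total variation and test fields *)

Section duality.
Context (R : realType) (n : nat).
Variable m : {measure set 'rV[R]_n -> \bar R}.
Hypothesis mK : forall K, compact K -> (m K < +oo)%E.
Variable sg : 'rV[R]_n -> 'rV[R]_n.
Hypothesis msg : forall i, measurable_fun setT (fun x => sg x ord0 i).
Hypothesis sg1 : forall x, dot (sg x) (sg x) = 1.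

Lemma coord_unit_le1 i x : `|sg x ord0 i| <= 1.
Proof.
by apply: le_trans (coord_le_enorm _ _) _; rewrite /enorm sg1 sqrtr1.
Qed.

Lemma lip_c_props (phi : 'rV[R]_n -> 'rV[R]_n) : lip_c phi -> exists M r : R,
  [/\ forall i, measurable_fun setT (fun x => phi x ord0 i),
      forall i x, `|phi x ord0 i| <= M & forall x, phi x != 0 -> `|x| <= r].
Proof.
move=> /lip_cP[L [r [L0 r0 phiL phir]]].
exists (L * (r + (r + 1))), r; split => //.
  by move=> i; apply: (@klip_measurable _ _ L) => // x y; exact: phiL.
move=> i x; have [->|/phir xr] := eqVneq (phi x) 0.
  by rewrite mxE normr0 mulr_ge0// !addr_ge0.
(* The uniform bound comes from the Lipschitz one: y lies just outside the support, at distance at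
   most r + (r + 1) from any of its points. *)
pose y : 'rV[R]_n := const_mx (r + 1).
have yr : `|y| <= r + 1.
  by apply: rV_norm_le => [|j]; rewrite ?addr_ge0// mxE ger0_norm ?addr_ge0.
have phiy : phi y = 0.
  apply: contraPeq (rV_coord_le_norm y i) => /phir yr'.
  by apply/negP; rewrite -ltNge mxE ger0_norm ?addr_ge0//; lra.
have := phiL i x y; rewrite phiy mxE subr0 => /le_trans; apply.
by rewrite ler_wpM2l// (le_trans (ler_normB _ _))// lerD.
Qed.

Lemma pairing_integrable (phi : 'rV[R]_n -> 'rV[R]_n) : lip_c phi ->
  m.-integrable setT (EFin \o (fun x => dot (phi x) (sg x))).
Proof.
move=> /lip_c_props[M [r [mphi phiM phir]]].
rewrite /dot (_ : _ \o _ = (fun x => \sum_i (phi x ord0 i * sg x ord0 i)%:E)%E); last first.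
  by apply/funext => x /=; rewrite sumEFin.
apply: integrable_sum => // i _.
apply: (@bounded_supp_integrable _ _ _ _ M r) => //.
- exact: measurable_funM.
- by move=> x; rewrite normrM -[leRHS]mulr1 ler_pM// coord_unit_le1.
- by move=> x h; apply: phir; apply: contraNN h => /eqP ->; rewrite mxE mul0r.
Qed.

Lemma pairing_le (phi : 'rV[R]_n -> 'rV[R]_n) (psi : 'rV[R]_n -> R) : lip_c phi ->
  measurable_fun setT psi -> (forall x, enorm (phi x) <= psi x) ->
  ((\int[m]_x dot (phi x) (sg x))%:E <= \int[m]_x (psi x)%:E)%E.
Proof.
move=> lphi mpsi phipsi; have ip := pairing_integrable lphi.
rewrite /Rintegral fineK; last exact: integrable_fin_num ip.
apply: (@le_trans _ _ (\int[m]_x `|(dot (phi x) (sg x))%:E|)%E).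
  apply: le_integral => //; first by apply: integrable_abse.
  by move=> x _; rewrite lee_fin ler_norm.
have [M [r [mphi _ _]]] := lip_c_props lphi.
apply: ge0_le_integral => //.
- by do 2 apply: measurableT_comp => //; exact: measurable_dot.
- exact/measurable_EFinP.
- move=> x _; rewrite lee_fin; apply: le_trans (phipsi x).
  by apply: le_trans (normr_dot_le _ _) _; rewrite /(enorm (sg x)) /enorm sg1 sqrtr1 mulr1.
Qed.

(** A substitute for h / |h| without singularity at h = 0: |h| / max(1, |h|^2) never exceeds 1, and
    the value stays close to the unit vector u when h does. *)
Lemma unit_projection (h u : 'rV[R]_n) : dot u u = 1 ->
  (forall i, `|h ord0 i| <= 1) ->
  let q := Num.max 1 (dot h h) in
  enorm (q^-1 *: h) <= 1 /\
  1 - 3 * (\sum_i `|u ord0 i - h ord0 i|) <= dot (q^-1 *: h) u.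
Proof.
move=> u1 h1 q; have q1 : 1 <= q by rewrite le_max lexx.
have q0 : 0 < q by exact: lt_le_trans q1.
have hq : dot h h <= q by rewrite le_max lexx orbT.
have eu : enorm u = 1 by rewrite /enorm u1 sqrtr1.
have ui i : `|u ord0 i| <= 1 by rewrite -eu coord_le_enorm.
set d := \sum_i _.
have d0 : 0 <= d by exact: sumr_ge0.
(* Two thirds of the factor 3: |h|^2 - |u|^2 factors coordinate by coordinate, with |h_i + u_i| <=
   2. The last third is 1 - h . u <= d. *)
have qd : q - 1 <= 2 * d.
  rewrite /q; case: (leP 1 (dot h h)) => _; last by rewrite subrr mulr_ge0.
  rewrite -u1 -sumrB mulr_sumr; apply: ler_sum => i _.
  rewrite -(mulrN (u ord0 i)) mulrN (_ : _ - _ = (h ord0 i - u ord0 i) * (h ord0 i + u ord0 i)); last by ring.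
  apply: le_trans (ler_norm _) _; rewrite normrM mulrC distrC ler_pM//.
  by rewrite (le_trans (ler_normD _ _))//; have := h1 i; have := ui i; lra.
have ud : 1 - dot h u <= d.
  rewrite -u1 -sumrB; apply: ler_sum => i _.
  rewrite -mulrBl; apply: le_trans (ler_norm _) _; rewrite normrM.
  by rewrite ler_piMr.
split.
  rewrite -ler_sqr ?nnegrE ?enorm_ge0// enorm_sqr dotZr dotC dotZr expr1n.
  rewrite mulrA -invfM mulrC ler_pdivrMr ?mulr_gt0// mul1r.
  by apply: le_trans hq _; rewrite ler_peMl// ltW.
rewrite dotC dotZr dotC.
have h2 : q - dot h u <= 3 * d by lra.
have -> : q^-1 * dot h u = 1 - q^-1 * (q - dot h u).
  by field; rewrite gt_eqF.
rewrite lerD2l lerN2; have [neg|pos] := leP (q - dot h u) 0.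
  by apply: (@le_trans _ _ 0); rewrite ?mulr_ge0// mulr_ge0_le0// invr_ge0 ltW.
apply: le_trans h2; rewrite ler_piMl ?(ltW pos)// invf_le1//.
Qed.

Lemma continuous_lsc (psi : 'rV[R]_n -> R) : continuous psi ->
  forall x e, 0 < e -> exists2 d, 0 < d & forall y, `|x - y| < d -> psi x - e <= psi y.
Proof.
move=> cpsi x e e0.
have /(@cvgrPdist_lt _ _ _ (nbhs x) (nbhs_filter x))/(_ e e0) := cpsi x.
move=> /nbhs_ballP[d /= d0 dP]; exists d => // y xy.
have /dP : ball x d y by rewrite mx_norm_ball.
by rewrite /= ltr_norml => /andP[_]; lra.
Qed.

(** Taking the minimum of an envelope and a cutoff keeps the Lipschitz constant k and the
    monotonicity in k, so that monotone convergence applies to integrals of the [rho k]. *)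
Lemma lip_truncations (psi : 'rV[R]_n -> R) : continuous psi -> (forall x, 0 <= psi x) ->
  exists rho : nat -> 'rV[R]_n -> R, [/\ forall k x, 0 <= rho k x <= psi x,
    forall k, klip k%:R (rho k) /\ (forall x, rho k x <= k%:R),
    forall k x, rho k x != 0 -> `|x| <= k%:R, forall x, nondecreasing_seq (rho ^~ x) &
    forall x, rho k x @[k --> \oo] --> psi x].
Proof.
move=> cpsi psi0.
have [f_ [f01 fk ndf lim]] := inf_convolution psi0 (continuous_lsc cpsi).
(* A plateau of height k descending with slope k to 0 at the boundary of the cube; it tends to +oo
   at each point, so the minimum with [f_ k] still converges to psi. *)
pose chi (k : nat) (x : 'rV[R]_n) : R := Num.max 0 (Num.min k%:R (k%:R * (k%:R - `|x|))).
have chi0 k x : 0 <= chi k x by rewrite le_max lexx.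
have chik k x : chi k x <= k%:R by rewrite ge_max ler0n ge_min lexx.
have chil k : klip k%:R (chi k).
  apply: klip_max; first exact: klip_cst.
  apply: klip_min; first exact: (klip_cst (k%:R)).
  move=> x y; rewrite -mulrBr normrM ger0_norm// ler_wpM2l//.
  by rewrite opprD opprK addrACA subrr add0r addrC distrC ler_dist_dist.
have chis k x : chi k x != 0 -> `|x| <= k%:R.
  apply: contraNT; rewrite -ltNge => kx; rewrite eq_le chi0 andbT.
  by rewrite /chi ge_max lexx/= ge_min mulr_ge0_le0 ?orbT// subr_le0 ltW.
exists (fun k x => Num.min (f_ k x) (chi k x)); split.
- move=> k x; have /andP[a b] := f01 k x.
  by rewrite le_min a chi0/= ge_min b.
- move=> k; split; first exact: klip_min.
  by move=> x; rewrite ge_min chik orbT.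
- move=> k x h; apply: chis; apply: contraNN h => /eqP ->.
  by have /andP[a b] := f01 k x; rewrite min_r.
- move=> x a b ab; rewrite le_min !ge_min ndf//=; apply/orP; right.
  rewrite /chi le_max ge_max lexx/=; apply/orP.
  have ab' : (a%:R : R) <= b%:R by rewrite ler_nat.
  have [xb|bx] := leP `|x| b%:R; last first.
    left; rewrite ge_min; apply/orP; right.
    by rewrite mulr_ge0_le0// subr_le0; lra.
  right; rewrite ge_max; apply/andP; split.
    by rewrite le_min ler0n mulr_ge0// subr_ge0.
  have [ax|xa] := ltP a%:R `|x|.
    rewrite (le_trans (_ : _ <= 0)) ?le_min ?ler0n ?mulr_ge0 ?subr_ge0//.
    by rewrite ge_min; apply/orP; right; rewrite mulr_ge0_le0// subr_le0 ltW.
  rewrite le_min !ge_min ab'/=; apply/orP; right.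
  by apply: ler_pM => //; [rewrite subr_ge0|lra].
move=> x; apply: cvg_trans (lim x); apply: near_eq_cvg; near=> k.
have xk : `|x| + 1 <= k%:R by near: k; exact: nbhs_infty_ger.
have psik : psi x <= k%:R by near: k; exact: nbhs_infty_ger.
have /andP[a b] := f01 k x.
rewrite min_l// /chi le_max le_min; apply/orP; right.
rewrite (le_trans b)//= (le_trans b)// (le_trans psik)// ler_peMr//; lra.
Unshelve. all: by end_near. Qed.

(** The optimal field is psi sg, which in general is neither Lipschitz nor compactly supported.
    Monotone convergence replaces psi by a truncation [rho k], and sg is replaced by a Lipschitz
    field close to it in L^1 on the cube that carries [rho k]. *)
Lemma duality_lower (psi : 'rV[R]_n -> R) (c : R) : continuous psi ->
  (forall x, 0 <= psi x) -> (c%:E < \int[m]_x (psi x)%:E)%E ->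
  exists phi : 'rV[R]_n -> 'rV[R]_n, [/\ lip_c phi,
    forall x, enorm (phi x) <= psi x & c <= \int[m]_x dot (phi x) (sg x)].
Proof.
move=> cpsi psi0 cint.
have [rho [rho01 rhok rhos ndrho lim]] := lip_truncations cpsi psi0.
have rho0 k x : 0 <= rho k x by have /andP[] := rho01 k x.
have rhoM k x : `|rho k x| <= k%:R by rewrite ger0_norm//; exact: (rhok k).2.
have mrho k : measurable_fun setT (rho k).
  by apply: (@klip_measurable _ _ k%:R) => //; exact: (rhok k).1.
have [k ck] : exists k, (c%:E < \int[m]_x (rho k x)%:E)%E.
  have : (\int[m]_x (rho k x)%:E)%E @[k --> \oo] --> (\int[m]_x (psi x)%:E)%E.
    rewrite [X in _ --> X](_ : _ = \int[m]_x limn (fun k => (rho k x)%:E))%E; last first.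
      apply: eq_integral => x _; apply/esym/cvg_lim => //.
      by apply/cvg_EFin; [exact: nearW|exact: lim].
    apply: cvg_monotone_convergence => //.
    - by move=> k; exact/measurable_EFinP.
    - by move=> k x _; rewrite lee_fin.
    - by move=> x _ a b ab; rewrite lee_fin; exact: ndrho.
  move=> /(_ [set u | c%:E < u]%E)[|N _ h].
    by apply: open_nbhs_nbhs; split; first exact: open_ereal_gt_ereal.
  by exists N; apply: (h N) => /=.
have irho : m.-integrable setT (EFin \o rho k).
  by apply: (@bounded_supp_integrable _ _ _ _ k%:R k%:R) => //; exact: rhos.
pose K : set 'rV[R]_n := cube k%:R.
have mKK : measurable K by exact: measurable_cube.
have mKoo : (m K < +oo)%E by apply: mK; exact: compact_cube.
(* Approximation by Lipschitz functions is available for finite measures, hence the restriction of m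
   to the cube. *)
pose mu : {finite_measure set 'rV[R]_n -> \bar R} := mfrestr mKK mKoo.
pose I := \int[m]_x rho k x.
have cI : c < I by rewrite -lte_fin /I /Rintegral fineK//; exact: integrable_fin_num irho.
(* Replacing sg costs at most 3 k n e, which this choice keeps below I - c; the shifts by 1 avoid a
   division by 0. *)
pose e := (I - c) / (3 * (k%:R + 1) * (n%:R + 1)).
have e0 : 0 < e by rewrite /e divr_gt0 ?subr_gt0// !mulr_gt0// ltr_wpDl.
have isg i : mu.-integrable setT (EFin \o (fun x => sg x ord0 i)).
  apply: measurable_bounded_integrable => //; first exact: fin_num_fun_lty.
  exists 1; split; first exact: num_real.
  by move=> M M1 x _; exact: le_trans (coord_unit_le1 _ _) (ltW M1).
have /choice[h hP] i : exists h : 'rV[R]_n -> R, [/\ blip h, forall x, `|h x| <= 1 &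
    (\int[mu]_x `|(sg x ord0 i - h x)%:E| <= e%:E)%E].
  have [_ /(_ e e0)[h bh hle]] := lip_approx_integrable (isg i).
  exists (fun x => Num.max (- 1) (Num.min 1 (h x))); split.
  - exact: blip_clamp.
  - by move=> x; rewrite ler_norml le_max lexx ge_max ge_min lexx/= andbT; lra.
  apply: le_trans hle; apply: ge0_le_integral => //.
  - do 2 apply: measurableT_comp => //; apply: measurable_funB => //.
    by apply: blip_measurable; exact: blip_clamp.
  - do 2 apply: measurableT_comp => //; apply: measurable_funB => //.
    exact: blip_measurable.
  move=> x _; rewrite lee_fin; have := coord_unit_le1 i x; rewrite !ler_norml.
  move: (sg x ord0 i) => s; have := ler_norm (s - h x); have := ler_norm (- (s - h x)).
  rewrite normrN; have [h1|h1] := leP 1 (h x); first by rewrite max_r; lra.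
  by have [h2|h2] := leP (- 1) (h x); lra.
pose hh x : 'rV[R]_n := \row_i h i x.
pose q x := Num.max 1 (dot (hh x) (hh x)).
have bh i : blip (h i) by have [] := hP i.
have bq : blip q.
  apply: blip_max; first exact: (blip_cst _ 1).
  rewrite (_ : (fun x => _) = (fun x => \sum_i h i x * h i x)).
    by apply: blip_sum => i; exact: blipM.
  by apply/funext => x; apply: eq_bigr => i _; rewrite !mxE.
have biq : blip (fun x => (q x)^-1).
  by apply: blip_inv => // x; rewrite le_max lexx.
have brho : blip (rho k).
  by split; [exists k%:R|exists k%:R => //; exact: (rhok k).1].
pose phi x : 'rV[R]_n := rho k x *: ((q x)^-1 *: hh x).
have hh1 x i : `|hh x ord0 i| <= 1 by rewrite mxE; have [] := hP i.
have proj x := unit_projection (sg1 x) (hh1 x).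
have lphi : lip_c phi.
  have /choice[L LP] i : exists L, 0 <= L /\ klip L (fun x => phi x ord0 i).
    have [_ [L L0 Ll]] := blipM brho (blipM biq (bh i)).
    by exists L; split => // x y; rewrite !mxE; exact: Ll.
  apply/lip_cP; exists (\sum_i L i), k%:R; split => //.
  - by apply: sumr_ge0 => i _; have [] := LP i.
  - move=> i x y; have [L0 /(_ x y)/le_trans] := LP i; apply.
    rewrite ler_wpM2r// (bigD1 i)//= lerDl.
    by apply: sumr_ge0 => j _; have [] := LP j.
  - move=> x phix; apply: rhos; apply: contraNN phix => /eqP.
    by rewrite /phi => ->; rewrite scale0r.
exists phi; split => //.
  move=> x; have /andP[_] := rho01 k x; apply: le_trans.
  have [] := proj x; rewrite -/(q x) => hq _.
  rewrite -ler_sqr ?nnegrE ?enorm_ge0// enorm_sqr dotZr dotC dotZr -enorm_sqr.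
  by rewrite mulrA -expr2 ler_piMr ?sqr_ge0// expr_le1 ?enorm_ge0.
pose D i x := `|sg x ord0 i - h i x| * \1_K x.
have mD i : measurable_fun setT (D i).
  apply: measurable_funM; last exact: measurable_indic.
  apply: measurableT_comp => //; apply: measurable_funB => //; exact: blip_measurable.
have DM i x : `|D i x| <= 2.
  rewrite normrM normr_id (@ger0_norm _ (\1_K x))//.
  rewrite -[leRHS]mulr1 ler_pM// ?indicE ?lern1 ?leq_b1//.
  have [_ + _] := hP i => /(_ x); have := coord_unit_le1 i x => a b.
  by apply: le_trans (ler_normB _ _) _; lra.
have Ds i x : D i x != 0 -> `|x| <= k%:R.
  rewrite /D indicE; have [/set_mem//|_] := boolP (x \in K).
  by rewrite mulr0 eqxx.
have iD i : m.-integrable setT (EFin \o D i).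
  by apply: (@bounded_supp_integrable _ _ _ _ 2 k%:R) => //; exact: Ds.
have De i : \int[m]_x D i x <= e.
  rewrite -lee_fin /Rintegral fineK; last exact: integrable_fin_num (iD i).
  have [_ _ hi] := hP i; apply: le_trans hi.
  apply: (@le_trans _ _ (\int[mu]_(x in K) `|(sg x ord0 i - h i x)%:E|)%E); last first.
    apply: ge0_subset_integral => //.
    do 2 apply: measurableT_comp => //; apply: measurable_funB => //; exact: blip_measurable.
  rewrite (@eq_measure_integral _ _ _ K m); last first.
    by move=> A mA AK; rewrite /mu /= /mfrestr /mrestr setIidl.
  rewrite [leRHS]integral_mkcond; apply: ge0_le_integral => //.
  - by move=> x _; rewrite lee_fin mulr_ge0.
  - exact/measurable_EFinP.
  - apply/(measurable_restrictT _ _).1 => //; apply: measurable_funTS.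
    do 2 apply: measurableT_comp => //; apply: measurable_funB => //; exact: blip_measurable.
  - move=> x _; rewrite patchE /D indicE; case: (x \in K); first by rewrite mulr1.
    by rewrite mulr0.
have c3 : I - 3 * k%:R * (\sum_i \int[m]_x D i x) <= \int[m]_x dot (phi x) (sg x).
  have iS : m.-integrable setT (EFin \o (fun x => \sum_i D i x)).
    rewrite (_ : _ \o _ = (fun x => \sum_i (D i x)%:E)%E).
      by apply: integrable_sum => // i _; exact: iD.
    by apply/funext => x /=; rewrite sumEFin.
  have iS3 : m.-integrable setT (EFin \o (fun x => 3 * k%:R * \sum_i D i x)).
    rewrite (_ : _ \o _ = (fun x => (3 * k%:R)%:E * (\sum_i D i x)%:E)%E).
      exact: integrableZl.
    by apply/funext => x /=; rewrite EFinM.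
  rewrite -Rintegral_sum// -RintegralZl// -RintegralB//.
  apply: le_Rintegral => //.
  - rewrite (_ : _ \o _ = ((EFin \o rho k) \- (EFin \o (fun x => (3 * k%:R * \sum_i D i x)%R)))%E).
      exact: integrableB.
    by apply/funext => x /=; rewrite EFinB.
  - exact: pairing_integrable.
  move=> x _; have [xK|xK] := boolP (x \in K); last first.
    have -> : rho k x = 0.
      by apply: contraNeq xK => /rhos xk; rewrite inE.
    rewrite big1 ?mulr0 ?subr0; last by move=> i _; rewrite /D indicE (negbTE xK) mulr0.
    rewrite /phi; have -> : rho k x = 0 by apply: contraNeq xK => /rhos xk; rewrite inE.
    by rewrite scale0r dotC dot0r.
  have [_] := proj x; rewrite -/(q x) => hq.
  have -> : dot (phi x) (sg x) = rho k x * dot ((q x)^-1 *: hh x) (sg x).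
    by rewrite /phi dotC dotZr dotC.
  have -> : \sum_i D i x = \sum_i `|sg x ord0 i - hh x ord0 i|.
    by apply: eq_bigr => i _; rewrite /D indicE xK mulr1 mxE.
  move: hq; set s := \sum_i _; set t := dot _ _ => hq.
  have s0 : 0 <= s by exact: sumr_ge0.
  have r0 := rho0 k x; have rk := (rhok k).2 x.
  apply: (@le_trans _ _ (rho k x * (1 - 3 * s))); last by rewrite ler_wpM2l.
  rewrite mulrBr mulr1 lerD2l lerN2 mulrCA mulrA ler_wpM2r// ler_wpM2l//.
apply: le_trans c3.
have : \sum_i \int[m]_x D i x <= n%:R * e.
  rewrite -[n in n%:R]card_ord mulr_natl -sumr_const.
  by apply: ler_sum => i _; exact: De.
have ke : 3 * k%:R * (n%:R * e) <= I - c.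
  have -> : 3 * k%:R * (n%:R * e) = (I - c) * ((k%:R / (k%:R + 1)) * (n%:R / (n%:R + 1))).
    by rewrite /e; field; rewrite !gt_eqF// ltr_wpDl.
  rewrite ler_piMr ?subr_ge0 ?(ltW cI)//.
  have q1 (j : nat) : 0 <= (j%:R / (j%:R + 1) : R) <= 1.
    by rewrite divr_ge0//= ler_pdivrMr ?ltr_wpDl// mul1r lerDl.
  by have /andP[a b] := q1 k; have /andP[a' b'] := q1 n; rewrite mulr_ile1.
move=> /(ler_wpM2l (_ : 0 <= 3 * k%:R)); rewrite mulr_ge0// => /(_ isT); lra.
Qed.

End duality.

(** * Gaussian densities *)

Section lebesgue_rV_product.
Local Open Scope ereal_scope.
Context (R : realType).

Lemma measurable_cons_rV n : measurable_fun setT (@cons_rV R n).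
Proof.
apply: measurable_fun_rV => i; rewrite /cons_rV.
under eq_fun do rewrite mxE.
case: unliftP => [j _|_]; last exact: measurable_fst.
exact: (measurableT_comp (measurable_coord_rV j) measurable_snd).
Qed.

Lemma ge0_integral_lebesgue_rVS n (f : 'rV[R]_n.+1 -> \bar R) :
  (forall x, 0 <= f x) -> measurable_fun setT f ->
  \int[lebesgue_rV R n.+1]_x f x =
  \int[lebesgue_measure]_t \int[lebesgue_rV R n]_v f (cons_rV (t, v)).
Proof.
move=> f0 mf; have mc := @measurable_cons_rV n.
transitivity (\int[pushforward (lebesgue_measure \x lebesgue_rV R n) (@cons_rV R n)]_x f x).
  by [].
rewrite ge0_integral_pushforward// preimage_setT.
by rewrite fubini_tonelli1//=; exact: measurableT_comp.
Qed.

(** Reduces Gaussian integrals over R^n to the line: Tonelli splits off the first coordinate, along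
    the recursion that defines [lebesgue_rV]. *)
Lemma integral_lebesgue_rV_prod n (h : 'I_n -> R -> R) (c : 'I_n -> R) :
  (forall i t, (0 <= h i t)%R) -> (forall i, measurable_fun setT (h i)) ->
  (forall i, \int[lebesgue_measure]_t (h i t)%:E = (c i)%:E) ->
  \int[lebesgue_rV R n]_x (\prod_i h i (x ord0 i))%:E = (\prod_i c i)%:E.
Proof.
elim: n h c => [|n IH] h c h0 mh hc.
  rewrite /= integral_dirac//=; last by apply/measurable_EFinP; under eq_fun do rewrite big_ord0; exact: measurable_cst.
  by rewrite diracE mem_set// mul1e !big_ord0.
have mprod k (h' : 'I_k -> R -> R) : (forall i, measurable_fun setT (h' i)) ->
    measurable_fun setT (fun x : 'rV[R]_k => \prod_i h' i (x ord0 i))%R.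
  move=> mh'; apply: measurable_prod => i _.
  by apply: (measurableT_comp (mh' i)); exact: measurable_coord_rV.
rewrite ge0_integral_lebesgue_rVS; last 2 first.
- by move=> x; rewrite lee_fin prodr_ge0.
- by apply/measurable_EFinP; exact: mprod.
have -> : \int[lebesgue_measure]_t \int[lebesgue_rV R n]_v
    (\prod_i h i (cons_rV (t, v) ord0 i))%:E =
    \int[lebesgue_measure]_t ((h ord0 t)%:E * (\prod_i c (lift ord0 i))%:E).
  apply: eq_integral => t _.
  have E v : (\prod_i h i (cons_rV (t, v) ord0 i))%R =
      (h ord0 t * \prod_i h (lift ord0 i) (v ord0 i))%R.
    rewrite big_ord_recl mxE unlift_none; congr (_ * _)%R.
    by apply: eq_bigr => i _; rewrite mxE liftK.
  under eq_integral do rewrite E EFinM.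
  rewrite ge0_integralZl//; last 3 first.
  - by apply/measurable_EFinP; apply: (mprod _ (fun i => h (lift ord0 i))).
  - by move=> x _; rewrite lee_fin prodr_ge0.
  - by rewrite lee_fin.
  by rewrite (IH (fun i => h (lift ord0 i)) (fun i => c (lift ord0 i))).
have c0 i : (0 <= c i)%R by rewrite -lee_fin -hc integral_ge0// => t _; rewrite lee_fin.
rewrite ge0_integralZr//; last 3 first.
- by apply/measurable_EFinP; exact: mh.
- by move=> x _; rewrite lee_fin.
- by rewrite lee_fin prodr_ge0.
by rewrite hc -EFinM big_ord_recl.
Qed.

End lebesgue_rV_product.

Section gauss1.
Context (R : realType).
Notation mu := (@lebesgue_measure R).
Implicit Types (u t m : R).

(** Normal density of variance 1 / (2 u), that is, the heat kernel at time 1 / (4 u): it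
    concentrates at 0 as u grows. *)
Definition g1 u t : R := Num.sqrt (u / pi) * expR (- (u * t ^+ 2)).

Lemma g1_ge0 u t : 0 <= g1 u t.
Proof. by rewrite mulr_ge0// expR_ge0. Qed.

Lemma g1N u t : g1 u (- t) = g1 u t.
Proof. by rewrite /g1 sqrrN. Qed.

Lemma measurable_g1 d (T : measurableType d) (U Z : T -> R) :
  measurable_fun setT U -> measurable_fun setT Z ->
  measurable_fun setT (fun x => g1 (U x) (Z x)).
Proof.
move=> mU mZ; apply: measurable_funM.
  apply: measurableT_comp; first exact: continuous_measurable_fun (@sqrt_continuous R).
  exact: measurable_funM.
apply: measurableT_comp => //; apply: measurableT_comp => //.
by apply: measurable_funM => //; apply: measurable_funX.
Qed.

Lemma integral_g1 u m : 0 < u -> (\int[mu]_t (g1 u (t - m))%:E = 1)%E.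
Proof.
move=> u0; pose s := Num.sqrt (2 * u)^-1.
have s2 : s ^+ 2 = (2 * u)^-1 by rewrite sqr_sqrtr// invr_ge0 mulr_ge0// ltW.
have s0 : s != 0 by rewrite gt_eqF// sqrtr_gt0 invr_gt0 mulr_gt0.
rewrite -(integral_normal_pdf m s); apply: eq_integral => t _; congr EFin.
rewrite normal_pdfE// /g1 /normal_peak /normal_fun s2; congr (_ * expR _).
  rewrite -sqrtrV; last by rewrite mulrn_wge0// mulr_ge0 ?pi_ge0// invr_ge0 mulr_ge0// ltW.
  congr Num.sqrt; rewrite -mulr_natr; move: (pi_gt0 R).
  move: (@pi R) => p p0; field.
  by rewrite !lt0r_neq0.
rewrite -mulNr -[in RHS]mulr_natr; field; exact: lt0r_neq0.
Qed.

Lemma mul_expN_le1 t : 0 <= t -> t * expR (- t) <= 1.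
Proof.
move=> t0; rewrite expRN ler_pdivrMr ?expR_gt0// mul1r.
by apply: le_trans (expR_ge1Dx t); rewrite lerDr.
Qed.

Lemma mul_gauss_le1 t : `|t| * expR (- t ^+ 2) <= 1.
Proof.
rewrite expRN ler_pdivrMr ?expR_gt0// mul1r.
apply: le_trans (expR_ge1Dx _).
by rewrite -(real_normK (num_real t)); have := sqr_ge0 (`|t| - 1); nra.
Qed.

(** Half of the exponent absorbs the factor t, the other half survives as a Gaussian of parameter u
    / 2, which keeps the bound integrable. *)
Lemma gauss_moment1 u t : 0 < u -> 0 <= t ->
  t * expR (- (u * t ^+ 2)) <= 2 / Num.sqrt u * expR (- (u / 2 * t ^+ 2)).
Proof.
move=> u0 t0; rewrite -[u in expR (- (u * _))](_ : u / 2 + u / 2 = u); last by lra.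
rewrite mulrDl opprD expRD mulrA ler_wpM2r ?expR_ge0//.
have su : 0 < Num.sqrt u by rewrite sqrtr_gt0.
have := mul_gauss_le1 (Num.sqrt u * t / Num.sqrt 2).
rewrite ger0_norm ?divr_ge0 ?mulr_ge0//.
rewrite (_ : (_ / _) ^+ 2 = u / 2 * t ^+ 2); last first.
  by rewrite expr_div_n exprMn !sqr_sqrtr// ?ltW//; ring.
move=> h; rewrite ler_pdivlMr//.
have s22 : Num.sqrt 2 <= 2 :> R.
  by rewrite -ler_sqr ?nnegrE ?sqrtr_ge0// sqr_sqrtr//; lra.
apply: le_trans s22.
rewrite -[leRHS]mul1r -ler_pdivrMr//; apply: le_trans h.
by rewrite le_eqVlt; apply/orP; left; apply/eqP; field; exact: lt0r_neq0.
Qed.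

Lemma gauss_moment2 u t : 0 < u ->
  t ^+ 2 * expR (- (u * t ^+ 2)) <= 2 / u * expR (- (u / 2 * t ^+ 2)).
Proof.
move=> u0; rewrite -[u in expR (- (u * _))](_ : u / 2 + u / 2 = u); last by lra.
rewrite mulrDl opprD expRD mulrA ler_wpM2r ?expR_ge0//.
have p0 : 0 <= u / 2 * t ^+ 2 by apply: mulr_ge0; [lra|exact: sqr_ge0].
have h := mul_expN_le1 p0; rewrite ler_pdivlMr// -[leRHS]mulr1.
rewrite (_ : _ * u = 2 * (u / 2 * t ^+ 2 * expR (- (u / 2 * t ^+ 2)))).
  by rewrite ler_wpM2l.
by field.
Qed.

Lemma continuous_g1 u : continuous (g1 u).
Proof.
move=> x; apply: cvgM; first exact: cvg_cst.
apply: (cvg_comp _ expR); last exact: continuous_expR.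
apply: (@cvgN _ R^o); apply: cvgM; first exact: cvg_cst.
exact: sqr_continuous.
Qed.

(** Twice the positive part of t, times the Gaussian. Signed first moments are split into
    nonnegative integrals, because the product formula [integral_lebesgue_rV_prod] is for
    nonnegative factors. *)
Let k u t : R := (`|t| + t) * g1 u t.

Let k_ge0 u t : 0 <= k u t.
Proof. by rewrite mulr_ge0 ?g1_ge0// -lerBlDr sub0r lerNl lerNnormlW. Qed.

Let continuous_k u : continuous (k u).
Proof.
move=> x; apply: cvgM; last exact: continuous_g1.
apply: (@cvgD _ R^o); [exact: (@norm_continuous _ R^o)|exact: cvg_id].
Qed.

Let shift_int (G : R -> R) m : continuous G -> (forall t, 0 <= G t) ->
  (\int[mu]_t (G (t - m))%:E = \int[mu]_t (G t)%:E)%E.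
Proof.
move=> cG G0; pose F (t : R) := t - m.
have F' : F^`()%classic = cst 1.
  by apply/funext => x; rewrite derive1E deriveB// derive_id derive_cst subr0.
rewrite [RHS](@increasing_ge0_integration_by_substitutionT _ F)//.
- by apply: eq_integral => t _; rewrite F' /= fctE /= mulr1.
- by move=> x y xy; rewrite /F ltrD2r.
- by rewrite F' => ?; exact: cvg_cst.
- by rewrite F'; exact: is_cvg_cst.
- by rewrite F'; exact: is_cvg_cst.
- exact: cvg_addrr_Ny.
- exact: cvg_addrr.
Qed.

Let refl_int (G : R -> R) : measurable_fun setT G -> (forall t, 0 <= G t) ->
  (\int[mu]_t (G (- t))%:E = \int[mu]_t (G t)%:E)%E.
Proof.
move=> mG G0.
transitivity (\int[pushforward mu (-%R : _ -> measurableTypeR R)]_t (G t)%:E)%E.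
  rewrite ge0_integral_pushforward ?preimage_setT//; first exact/measurable_EFinP.
  by move=> t _; rewrite lee_fin.
by apply: eq_measure_integral => A mA _; exact: lebesgue_measureN.
Qed.

(** Reflection exchanges the two halves. Their common finite value makes the first moment vanish
    once the other coordinates are put back. *)
Lemma gauss_half_moments u m : 0 < u -> exists c : R,
  (\int[mu]_t ((`|t - m| + (t - m)) * g1 u (t - m))%:E = c%:E)%E /\
  (\int[mu]_t ((`|t - m| - (t - m)) * g1 u (t - m))%:E = c%:E)%E.
Proof.
move=> u0.
have mk : measurable_fun setT (k u) by apply: continuous_measurable_fun; exact: continuous_k.
have fin : (\int[mu]_t (k u t)%:E)%E \is a fin_num.
  have u20 : 0 < u / 2 by rewrite divr_gt0.
  rewrite ge0_fin_numE; last by apply: integral_ge0 => t _; rewrite lee_fin.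
  pose C := 2 * (2 / Num.sqrt u) * 2.
  have C0 : 0 <= C by rewrite !mulr_ge0 ?invr_ge0.
  apply: (@le_lt_trans _ _ (\int[mu]_t (C%:E * (g1 (u / 2) (t - 0))%:E))%E); last first.
    rewrite ge0_integralZl//; last 2 first.
    - by apply/measurable_EFinP; apply: measurable_g1 => //; exact: measurable_funB.
    - by move=> t _; rewrite lee_fin g1_ge0.
    by rewrite integral_g1// mule1 ltry.
  apply: ge0_le_integral => //.
  - by move=> t _; rewrite lee_fin.
  - exact/measurable_EFinP.
  - apply/measurable_EFinP; apply: measurable_funM => //.
    by apply: measurable_g1 => //; exact: measurable_funB.
  move=> t _; rewrite -EFinM lee_fin subr0 /k /g1.
  apply: (@le_trans _ _ (2 * `|t| * (Num.sqrt (u / pi) * expR (- (u * t ^+ 2))))).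
    rewrite ler_wpM2r ?mulr_ge0 ?expR_ge0// mulr_natl mulr2n lerD2l; exact: ler_norm.
  have h := gauss_moment1 u0 (normr_ge0 t); rewrite real_normK ?num_real// in h.
  have s1 : Num.sqrt (u / pi) <= 2 * Num.sqrt (u / 2 / pi).
    have up : 0 < u / pi by rewrite divr_gt0 ?pi_gt0.
    rewrite -ler_sqr ?nnegrE ?mulr_ge0 ?sqrtr_ge0// exprMn [u / 2 / _]mulrAC.
    move: up; move: (u / pi) => v v0.
    by rewrite !sqr_sqrtr ?divr_ge0 ?ltW//; lra.
  rewrite [leLHS](_ : _ = 2 * Num.sqrt (u / pi) * (`|t| * expR (- (u * t ^+ 2)))); last by ring.
  rewrite [leRHS](_ : _ = 2 * (2 * Num.sqrt (u / 2 / pi)) * (2 / Num.sqrt u * expR (- (u / 2 * t ^+ 2)))); last by rewrite /C; ring.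
  by apply: ler_pM => //; rewrite ?mulr_ge0 ?expR_ge0// ler_wpM2l.
exists (fine (\int[mu]_t (k u t)%:E)%E); rewrite fineK//; split.
  by rewrite -(shift_int m (@continuous_k u)).
rewrite -refl_int// -(shift_int m)//; last first.
  move=> x; apply: continuous_comp; [exact: opp_continuous|exact: continuous_k].
apply: eq_integral => t _; congr EFin.
by rewrite /k normrN g1N.
Qed.

End gauss1.

Section gauss_rV.
Context (R : realType) (n : nat).
Notation mu := (lebesgue_rV R n).
Implicit Types (u : R) (x y z : 'rV[R]_n).

Definition gam u z : R := \prod_i g1 u (z ord0 i).

Lemma gam_ge0 u z : 0 <= gam u z.
Proof. by apply: prodr_ge0 => i _; exact: g1_ge0. Qed.

Lemma gamN u z : gam u (- z) = gam u z.
Proof. by apply: eq_bigr => i _; rewrite mxE g1N. Qed.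

Lemma gamC u x y : gam u (x - y) = gam u (y - x).
Proof. by rewrite -gamN opprB. Qed.

Lemma measurable_gam d (T : measurableType d) (U : T -> R) (Z : T -> 'rV[R]_n) :
  measurable_fun setT U -> (forall i, measurable_fun setT (fun t => Z t ord0 i)) ->
  measurable_fun setT (fun t => gam (U t) (Z t)).
Proof. by move=> mU mZ; apply: measurable_prod => i _; exact: measurable_g1. Qed.

Lemma measurable_coordB d (T : measurableType d) (Y X : T -> 'rV[R]_n) i :
  (forall i, measurable_fun setT (fun t => Y t ord0 i)) ->
  (forall i, measurable_fun setT (fun t => X t ord0 i)) ->
  measurable_fun setT (fun t => (Y t - X t) ord0 i).
Proof. by move=> mY mX; under eq_fun do rewrite !mxE; exact: measurable_funB. Qed.

Lemma measurable_gamB u x : measurable_fun setT (fun y => gam u (y - x)).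
Proof.
apply: measurable_gam => // i; apply: measurable_coordB => // j.
exact: measurable_coord_rV.
Qed.

Lemma integral_gam u x : 0 < u -> (\int[mu]_y (gam u (y - x))%:E = 1)%E.
Proof.
move=> u0.
have := integral_lebesgue_rV_prod (h := fun i t => g1 u (t - x ord0 i)) (c := fun i : 'I_n => 1).
rewrite big1_eq => <- //.
- by apply: eq_integral => y _; congr EFin; apply: eq_bigr => i _; rewrite !mxE.
- by move=> i t; exact: g1_ge0.
- by move=> i; apply: measurable_g1 => //; exact: measurable_funB.
- by move=> i; exact: integral_g1.
Qed.

Lemma integral_gamC u y : 0 < u -> (\int[mu]_x (gam u (y - x))%:E = 1)%E.
Proof. by move=> u0; under eq_integral do rewrite gamC; exact: integral_gam. Qed.

Lemma gamE u z : gam u z = Num.sqrt (u / pi) ^+ n * expR (- (u * dot z z)).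
Proof.
rewrite /gam big_split/= prodr_const card_ord; congr (_ * _).
rewrite -expR_sum; congr expR; rewrite sumrN; congr (- _).
by rewrite /dot mulr_sumr; apply: eq_bigr => i _; rewrite expr2.
Qed.

(** The 2 comes from the one-variable moment bounds, 2^n from comparing the normalising factors of
    [gam u] and [gam (u / 2)]. *)
Definition Cg : R := 2 * 2 ^+ n.

Lemma Cg_ge0 : 0 <= Cg. Proof. by rewrite mulr_ge0// exprn_ge0. Qed.

Let sqrt_half u : 0 < u ->
  Num.sqrt (u / pi) ^+ n <= 2 ^+ n * Num.sqrt (u / 2 / pi) ^+ n.
Proof.
move=> u0; rewrite -exprMn lerXn2r ?nnegrE ?mulr_ge0 ?sqrtr_ge0//.
have up : 0 < u / pi by rewrite divr_gt0 ?pi_gt0.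
rewrite -ler_sqr ?nnegrE ?mulr_ge0 ?sqrtr_ge0// exprMn [u / 2 / _]mulrAC.
move: up; move: (u / pi) => v v0.
by rewrite !sqr_sqrtr ?divr_ge0 ?ltW//; lra.
Qed.

Lemma gam_moment1 u z : 0 < u ->
  enorm z * gam u z <= Cg / Num.sqrt u * gam (u / 2) z.
Proof.
move=> u0; rewrite !gamE -!enorm_sqr.
have := gauss_moment1 u0 (enorm_ge0 z); have := sqrt_half u0.
have e0 := expR_ge0 (- (u * enorm z ^+ 2)).
have e0' := expR_ge0 (- (u / 2 * enorm z ^+ 2)).
have s0 : 0 <= Num.sqrt (u / pi) ^+ n by rewrite exprn_ge0.
rewrite /Cg => h1 h2; rewrite mulrCA.
rewrite [leRHS](_ : _ = (2 ^+ n * Num.sqrt (u / 2 / pi) ^+ n) * (2 / Num.sqrt u * expR (- (u / 2 * enorm z ^+ 2)))); last by ring.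
by apply: ler_pM => //; rewrite mulr_ge0 ?enorm_ge0.
Qed.

Lemma gam_moment2 u z : 0 < u ->
  enorm z ^+ 2 * gam u z <= Cg / u * gam (u / 2) z.
Proof.
move=> u0; rewrite !gamE -!enorm_sqr.
have := gauss_moment2 (enorm z) u0; have := sqrt_half u0.
have e0 := expR_ge0 (- (u * enorm z ^+ 2)).
have e0' := expR_ge0 (- (u / 2 * enorm z ^+ 2)).
have s0 : 0 <= Num.sqrt (u / pi) ^+ n by rewrite exprn_ge0.
rewrite /Cg => h1 h2; rewrite mulrCA.
rewrite [leRHS](_ : _ = (2 ^+ n * Num.sqrt (u / 2 / pi) ^+ n) * (2 / u * expR (- (u / 2 * enorm z ^+ 2)))); last by ring.
by apply: ler_pM => //; rewrite mulr_ge0 ?sqr_ge0.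
Qed.

Lemma gam_le u z : 0 < u -> gam u z <= Num.sqrt u ^+ n.
Proof.
move=> u0; rewrite gamE; apply: (@le_trans _ _ (Num.sqrt (u / pi) ^+ n)).
  rewrite ler_piMr ?exprn_ge0// -expR0 ler_expR oppr_le0 mulr_ge0 ?dot_ge0 ?ltW//.
apply: lerXn2r; rewrite ?nnegrE ?sqrtr_ge0//; apply: ler_wsqrtr.
rewrite ler_pdivrMr ?pi_gt0//.
by rewrite ler_peMr ?(ltW u0)// (le_trans _ (pi_ge2 R))// ler1n.
Qed.

(** Source of the factor sqrt u near u = 0; in dimension 0 the empty product [gam] would be
    constantly 1. *)
Lemma gam_le_sqrt u z : (0 < n)%N -> 0 < u -> u <= 1 -> gam u z <= Num.sqrt u.
Proof.
move=> n0 u0 u1; apply: le_trans (gam_le z u0) _.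
have s1 : Num.sqrt u <= 1 by rewrite -[leRHS]sqrtr1 ler_wsqrtr.
by rewrite -(prednK n0) exprS ler_piMr ?sqrtr_ge0// exprn_ile1.
Qed.

Lemma integrable_gam u x : 0 < u -> mu.-integrable setT (EFin \o (fun y => gam u (y - x))).
Proof.
move=> u0; apply/integrableP; split.
  by apply/measurable_EFinP; exact: measurable_gamB.
under eq_integral do rewrite /= ger0_norm ?gam_ge0//.
by rewrite integral_gam// ltry.
Qed.

Lemma integrable_gam_coord u x i : 0 < u ->
  mu.-integrable setT (EFin \o (fun y => (y - x) ord0 i * gam u (y - x))).
Proof.
move=> u0; have u20 : 0 < u / 2 by rewrite divr_gt0.
have := integrableZl measurableT (Cg / Num.sqrt u) (integrable_gam x u20).
apply: le_integrable => //.
  apply/measurable_EFinP; apply: measurable_funM; last exact: measurable_gamB.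
  by apply: measurable_coordB => // j; exact: measurable_coord_rV.
move=> y _; rewrite /= lee_fin normrM (ger0_norm (gam_ge0 _ _)).
apply: le_trans (ler_norm _); apply: le_trans (gam_moment1 _ u0).
by rewrite ler_wpM2r ?gam_ge0 ?coord_le_enorm.
Qed.

(** The integrand is odd about x, but no substitution in R^n is made: twice the i-th coordinate t is
    the difference of |t| + t and |t| - t, and the two resulting products have the same integral
    [c]. *)
Lemma Rintegral_gam_coord u x i : 0 < u ->
  \int[mu]_y ((y - x) ord0 i * gam u (y - x)) = 0.
Proof.
move=> u0; have [c [c1 c2]] := gauss_half_moments (x ord0 i) u0.
have half (H : R -> R) : (forall t, 0 <= H t) -> measurable_fun setT H ->
   (\int[lebesgue_measure]_t (H t)%:E = c%:E)%E ->
   (\int[mu]_y (H (y ord0 i) * \prod_(j < n | j != i) g1 u ((y - x) ord0 j))%:E = c%:E)%E.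
  move=> H0 mH Hc.
  have := integral_lebesgue_rV_prod
    (h := fun j => if j == i then H else fun t => g1 u (t - x ord0 j))
    (c := fun j : 'I_n => if j == i then c else 1).
  rewrite (bigD1 i)//= eqxx big1 ?mulr1; last by move=> j /negbTE ->.
  move=> <-.
  - apply: eq_integral => y _; congr EFin; rewrite [RHS](bigD1 i)//= eqxx.
    by congr (_ * _); apply: eq_bigr => j /negbTE ->; rewrite !mxE.
  - by move=> j t; case: ifP => // _; exact: g1_ge0.
  - move=> j; case: ifP => // _; apply: measurable_g1 => //.
    exact: measurable_funB.
  - by move=> j; case: ifP => // _; exact: integral_g1.
have mB : measurable_fun setT (fun t : R => t - x ord0 i) by exact: measurable_funB.
have mg : measurable_fun setT (fun t : R => g1 u (t - x ord0 i)).
  exact: measurable_g1.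
pose Hp (t : R) := (`|t - x ord0 i| + (t - x ord0 i)) * g1 u (t - x ord0 i).
pose Hm (t : R) := (`|t - x ord0 i| - (t - x ord0 i)) * g1 u (t - x ord0 i).
have Hp0 t : 0 <= Hp t.
  by rewrite mulr_ge0 ?g1_ge0// -lerBlDr sub0r lerNl lerNnormlW.
have Hm0 t : 0 <= Hm t by rewrite mulr_ge0 ?g1_ge0// subr_ge0 ler_norm.
have mp : measurable_fun setT Hp.
  by apply: measurable_funM => //; apply: measurable_funD => //; exact: measurableT_comp.
have mm : measurable_fun setT Hm.
  by apply: measurable_funM => //; apply: measurable_funB => //; exact: measurableT_comp.
have ep := half Hp Hp0 mp c1; have em := half Hm Hm0 mm c2.
pose P (y : 'rV[R]_n) := \prod_(j < n | j != i) g1 u ((y - x) ord0 j).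
have P0 y : 0 <= P y by apply: prodr_ge0 => j _; exact: g1_ge0.
have mP : measurable_fun setT P.
  rewrite (_ : P = fun y => \prod_(j < n) (if j != i then g1 u ((y - x) ord0 j) else 1)); last first.
    by apply/funext => y; rewrite /P big_mkcond.
  apply: measurable_prod => j _; case: (j != i) => //; apply: measurable_g1 => //.
  by apply: measurable_coordB => // k; exact: measurable_coord_rV.
have mH H : measurable_fun setT H -> measurable_fun setT (fun y : 'rV[R]_n => H (y ord0 i) : R).
  by move=> mH; apply: (measurableT_comp mH); exact: measurable_coord_rV.
have int (H : R -> R) : (forall t, 0 <= H t) -> measurable_fun setT H ->
    (\int[mu]_y (H (y ord0 i) * P y)%:E = c%:E)%E ->
    mu.-integrable setT (EFin \o (fun y => H (y ord0 i) * P y)).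
  move=> H0 mH0 Hc; apply/integrableP; split.
    by apply/measurable_EFinP; apply: measurable_funM => //; exact: mH.
  under eq_integral do rewrite /= ger0_norm ?mulr_ge0//.
  by rewrite Hc ltry.
have : \int[mu]_y (2 * ((y - x) ord0 i * gam u (y - x))) = 0.
  transitivity (\int[mu]_y (Hp (y ord0 i) * P y) - \int[mu]_y (Hm (y ord0 i) * P y)).
    rewrite -RintegralB//; [|exact: int|exact: int].
    apply: eq_Rintegral => y _; rewrite /gam (bigD1 i)//= -/(P y) /Hp /Hm !mxE; ring.
  by rewrite /Rintegral ep em subrr.
rewrite RintegralZl//; last exact: integrable_gam_coord.
by move/eqP; rewrite mulf_eq0 pnatr_eq0/= => /eqP.
Qed.

End gauss_rV.

(** * Integration by parts against Gaussians *)

Section smooth1.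
Context (R : realType).
Implicit Types (h k : R -> R) (t a b : R).

Fixpoint smooth1 (j : nat) h : Prop :=
  if j is j'.+1 then exists2 h', (forall t, is_derive t 1 h (h' t)) & smooth1 j' h'
  else continuous h.

Lemma is_derive_continuous h h' : (forall t, is_derive t 1 h (h' t)) -> continuous h.
Proof.
move=> dh t; apply: differentiable_continuous; apply/derivable1_diffP.
by have [] := dh t.
Qed.

Lemma smooth1_continuous j h : smooth1 j h -> continuous h.
Proof. by case: j => [//|j /= [h' dh _]]; exact: is_derive_continuous dh. Qed.

Lemma smooth1W j h : smooth1 j.+1 h -> smooth1 j h.
Proof.
elim: j h => [|j IH] h; first by move=> [h' dh _]; exact: is_derive_continuous dh.
by move=> [h' dh sh']; exists h' => //; exact: IH.
Qed.

Lemma smooth1_cst (c : R) j : smooth1 j (cst c).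
Proof.
elim: j c => [|j IH] c /=; first exact: cst_continuous.
by exists (cst 0) => // t; exact: is_derive_cst.
Qed.

Lemma smooth1D j h k : smooth1 j h -> smooth1 j k -> smooth1 j (fun t => h t + k t).
Proof.
elim: j h k => [|j IH] h k /=.
  by move=> ch ck t; apply: (@cvgD _ R^o); [exact: ch|exact: ck].
move=> [h' dh sh] [k' dk sk]; exists (fun t => h' t + k' t); last exact: IH.
by move=> t; exact: is_deriveD.
Qed.

Lemma smooth1M j h k : smooth1 j h -> smooth1 j k -> smooth1 j (fun t => h t * k t).
Proof.
elim: j h k => [|j IH] h k.
  by move=> ch ck t; apply: cvgM; [exact: ch|exact: ck].
move=> sh sk; have sh0 := smooth1W sh; have sk0 := smooth1W sk.
move: sh sk => [h' dh sh] [k' dk sk].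
exists (fun t => h t * k' t + k t * h' t).
  by move=> t; exact: is_deriveM.
by apply: smooth1D; apply: IH.
Qed.

Lemma smooth1_affine j h a b : smooth1 j h -> smooth1 j (fun t => h (a * t + b)).
Proof.
elim: j h => [|j IH] h.
  move=> ch t; apply: (@continuous_comp _ _ _ (fun t => a * t + b) h); last exact: ch.
  apply: (@cvgD _ R^o); last exact: cvg_cst.
  by apply: cvgM; [exact: cvg_cst|exact: cvg_id].
move=> [h' dh sh]; exists (fun t => a * h' (a * t + b)); last first.
  by apply: smooth1M; [exact: smooth1_cst|exact: IH].
move=> t.
have d1 : is_derive t 1 (fun s : R => a * s + b) (a *: 1 + 0).
  by apply: is_deriveD; apply: is_deriveZ.
have := @is_derive1_comp _ h (fun s => a * s + b) t _ _ (dh _) d1.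
by rewrite addr0 scaler1 mulrC.
Qed.

Lemma smooth1_linear j a b : smooth1 j (fun t => a * t + b).
Proof.
case: j => [|j] /=.
  move=> t; apply: (@cvgD _ R^o); last exact: cvg_cst.
  by apply: cvgM; [exact: cvg_cst|exact: cvg_id].
exists (cst a); last exact: smooth1_cst.
move=> t; have : is_derive t 1 (fun s : R => a * s + b) (a *: 1 + 0).
  by apply: is_deriveD; apply: is_deriveZ.
by rewrite addr0 scaler1.
Qed.

Lemma is_derive_g1 u y t :
  is_derive t 1 (fun t => g1 u (t - y)) (- (2 * u * (t - y)) * g1 u (t - y)).
Proof.
pose p (t : R) := - u * ((t - y) * (t - y)).
have d1 : is_derive t 1 (fun s : R => s - y) 1.
  have : is_derive t 1 (fun s : R => s - y) (1 - 0) by apply: is_deriveB.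
  by rewrite subr0.
have dp : is_derive t 1 p (- u *: ((t - y) *: 1 + (t - y) *: 1)).
  by apply: is_deriveZ; apply: is_deriveM.
have de : is_derive t 1 (expR \o p) (expR (p t) * (- u *: ((t - y) *: 1 + (t - y) *: 1))).
  exact: is_derive1_comp.
have -> : (fun t => g1 u (t - y)) = Num.sqrt (u / pi) \*: (expR \o p).
  by apply/funext => s; rewrite /g1 /p fctE /= -expr2 mulNr.
apply: is_derive_eq (is_deriveZ _ de) _.
by rewrite /g1 /p -expr2 mulNr /GRing.scale /=; ring.
Qed.

Lemma smooth1_g1 j u y : smooth1 j (fun t => g1 u (t - y)).
Proof.
elim: j => [|j IH]; first exact: is_derive_continuous (is_derive_g1 u y).
exists (fun t => - (2 * u * (t - y)) * g1 u (t - y)); first exact: is_derive_g1.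
apply: smooth1M => //.
rewrite (_ : (fun t => _) = (fun t => - (2 * u) * t + 2 * u * y)).
  exact: smooth1_linear.
by apply/funext => t; ring.
Qed.

(** The flat functions t^-m exp(-1/t). As a family they are closed under differentiation, the
    derivative of [bf m] being a combination of [bf m.+1] and [bf m.+2], so smoothness of all orders
    follows by induction. *)
Definition bf (m : nat) t : R := if 0 < t then t^-1 ^+ m * expR (- t^-1) else 0.

Lemma bf_ge0 m t : 0 <= bf m t.
Proof. by rewrite /bf; case: ifP => // t0; rewrite mulr_ge0 ?expR_ge0// exprn_ge0// invr_ge0 ltW. Qed.

Lemma bf_bound m t : bf m.+1 t <= m.+1`!%:R.
Proof.
rewrite /bf; case: ifP => t0; last by [].
have s0 : 0 <= t^-1 by rewrite invr_ge0 ltW.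
rewrite expRN ler_pdivrMr ?expR_gt0// mulrC -ler_pdivrMr ?ltr0n ?fact_gt0//.
by apply: le_trans (expR_ge1Dxn m s0); rewrite lerDr.
Qed.

Lemma bfS m t : bf m t = t * bf m.+1 t.
Proof.
rewrite /bf; case: ifP => t0; last by rewrite mulr0.
by rewrite exprS !mulrA divff ?mul1r// gt_eqF.
Qed.

Lemma bf0_le1 t : bf 0 t <= 1.
Proof.
rewrite /bf; case: ifP => // t0.
by rewrite expr0 mul1r -expR0 ler_expR oppr_le0 invr_ge0 ltW.
Qed.

Lemma is_derive_bf m t : is_derive t 1 (bf m) (- m%:R * bf m.+1 t + bf m.+2 t).
Proof.
have [t0|t0|<-] := ltgtP 0 t; last 2 first.
- have : is_derive t 1 (cst (0 : R)) 0 by exact: is_derive_cst.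
  rewrite /bf; have -> : (0 < t) = false by apply/negbTE; rewrite -leNgt ltW.
  rewrite mulr0 add0r => d0; apply: near_eq_is_derive d0; near=> s.
  rewrite ifF//; apply/negbTE; rewrite -leNgt ltW//.
  by near: s; exact: lt_nbhsl.
- have bf0 j : bf j 0 = 0 by rewrite /bf ltxx.
  rewrite !bf0 mulr0 add0r.
  pose C := m.+2`!%:R : R.
  (* At the origin two powers are traded for a bounded factor, [bf m s] being s^2 times [bf m.+2 s],
     so the difference quotient is O(|h|). *)
  have bC s : `|bf m s| <= `|s| ^+ 2 * C.
    rewrite bfS bfS mulrA -expr2 normrM normrX ler_wpM2l// ?sqr_ge0//.
    by rewrite ger0_norm ?bf_ge0//; exact: bf_bound.
  have C1 : 0 < C + 1 by rewrite ltr_wpDl.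
  have lim : h^-1 *: ((bf m \o shift 0) (h *: (1 : R)) - bf m 0) @[h --> (0 : R)^'] --> (0 : R).
    apply/(@cvgrPdist_lt _ R^o) => e e0; near=> h.
    rewrite sub0r normrN /= scaler1 addr0 bf0 subr0.
    have h0 : h != 0 by near: h; exact: nbhs_dnbhs_neq.
    rewrite [_ *: _]/(_ * _) normrM normfV.
    apply: (@le_lt_trans _ _ (`|h|^-1 * (`|h| ^+ 2 * C))); first by rewrite ler_wpM2l ?invr_ge0.
    rewrite expr2 -mulrA mulKf ?normr_eq0//.
    apply: (@le_lt_trans _ _ (`|h| * (C + 1))); first by rewrite ler_wpM2l// lerDl.
    rewrite -ltr_pdivlMr//; near: h.
    by apply: dnbhs0_lt; exact: divr_gt0.
  split; first by apply/cvg_ex; exists 0; exact: lim.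
  by apply: cvg_lim => //; exact: lim.
have di : is_derive t 1 (fun s : R => s^-1) (- t ^- 2).
  have := @is_deriveV _ id t 1 1 (lt0r_neq0 t0) (is_derive_id _ _).
  by rewrite scaler1.
have dX : is_derive t 1 ((fun s : R => s^-1) ^+ m) ((m%:R * t^-1 ^+ m.-1) *: (- t ^- 2)).
  exact: is_deriveX.
have de : is_derive t 1 (expR \o (fun s : R => - s^-1)) (expR (- t^-1) * (- - t ^- 2)).
  exact: is_derive1_comp.
have dM := is_deriveM dX de.
have near1 : \near t, (((fun s : R => s^-1) ^+ m) * (expR \o (fun s : R => - s^-1))) t = bf m t.
  near=> s; have s0 : 0 < s by near: s; exact: lt_nbhsr.
  by rewrite /bf s0 fctE exprfctE.
apply: is_derive_eq (near_eq_is_derive near1 dM) _.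
rewrite exprfctE /=.
rewrite /bf t0 /GRing.scale/= opprK -!exprVn.
case: m {dX dM near1} => [|m]; first by rewrite !mulr0n /=; ring.
by rewrite /= !exprS; ring.
Unshelve. all: by end_near. Qed.

Lemma smooth1_bf j m : smooth1 j (bf m).
Proof.
elim: j m => [|j IH] m; first exact: is_derive_continuous (is_derive_bf m).
exists (fun t => - m%:R * bf m.+1 t + bf m.+2 t); first exact: is_derive_bf.
by apply: smooth1D => //; apply: smooth1M => //; exact: smooth1_cst.
Qed.

Lemma smooth_bump : exists b b' : R -> R, [/\ forall j, smooth1 j b,
  forall t, is_derive t 1 b (b' t), forall t, 0 <= b t <= 1,
  0 < b 0 /\ (forall t, b t != 0 -> `|t| <= 1) & exists C, forall t, `|b' t| <= C].
Proof.
(* Not normalised: b 0 = exp(-2), a factor that is cancelled at the end of [gauss_ibp]. *)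
pose b t := bf 0 (1 * t + 1) * bf 0 (-1 * t + 1).
have sb j : smooth1 j b by apply: smooth1M; apply: smooth1_affine; exact: smooth1_bf.
have db (a t : R) : is_derive t 1 (fun s => bf 0 (a * s + 1)) (a * bf 2 (a * t + 1)).
  have d1 : is_derive t 1 (fun s : R => a * s + 1) (a *: 1 + 0).
    by apply: is_deriveD; apply: is_deriveZ.
  have := @is_derive1_comp _ (bf 0) (fun s => a * s + 1) t _ _ (is_derive_bf 0 _) d1.
  by rewrite addr0 scaler1 mulr0n oppr0 mul0r add0r mulrC.
exists b, (fun t => bf 0 (1 * t + 1) * (-1 * bf 2 (-1 * t + 1)) +
   bf 0 (-1 * t + 1) * (1 * bf 2 (1 * t + 1))); split => //.
- by move=> t; apply: is_deriveM.
- by move=> t; rewrite mulr_ge0 ?bf_ge0//= mulr_ile1 ?bf_ge0 ?bf0_le1.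
- split; first by rewrite /b /bf !mulr0 !add0r ltr01 !mulr_gt0// ?expR_gt0.
  move=> t; rewrite mulf_eq0 negb_or /bf => /andP[].
  case: ifP; last by rewrite eqxx.
  case: ifP; last by rewrite eqxx.
  by rewrite ler_norml => h1 h2 _ _; lra.
exists (2`!%:R + 2`!%:R) => t; apply: le_trans (ler_normD _ _) _.
rewrite !normrM !(ger0_norm (bf_ge0 _ _)) normrN !normr1 !mul1r.
by apply: lerD; rewrite -[leRHS]mul1r ler_pM ?bf_ge0 ?bf0_le1// bf_bound.
Qed.

End smooth1.

Section smooth_products.
Context (R : realType) (n : nat).
Implicit Types (h : 'I_n -> R -> R) (x : 'rV[R]_n).

Lemma is_derive_prod h x (i : 'I_n) (d : R) : is_derive (x ord0 i) 1 (h i) d ->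
  is_derive x (e_ R i) (fun y : 'rV[R]_n => \prod_j h j (y ord0 j))
    (d * \prod_(j < n | j != i) h j (x ord0 j)).
Proof.
move=> [dh dE]; set P := \prod_(j < n | j != i) _.
pose F := fun y : 'rV[R]_n => \prod_j h j (y ord0 j).
have FE t : F (t *: e_ R i + x) = h i (t *: (1 : R) + x ord0 i) * P.
  rewrite /F (bigD1 i)//= !mxE !eqxx; congr (_ * _).
  by apply: eq_bigr => j ji; rewrite !mxE eqxx/= (negbTE ji) mulr0 add0r.
have F0 : F x = h i (x ord0 i) * P by rewrite /F (bigD1 i).
have lim : t^-1 *: ((F \o shift x) (t *: e_ R i) - F x) @[t --> (0 : R)^'] --> (d * P : R).
  rewrite [X in X @ _ --> _](_ : _ = (fun t : R =>
     (t^-1 *: ((h i \o shift (x ord0 i)) (t *: (1 : R)) - h i (x ord0 i))) * P)).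
    apply: cvgM; last exact: cvg_cst.
    by move: dh => /cvg_ex[l hl]; move: dE; rewrite /derive (cvg_lim _ hl)// => <-.
  apply/funext => t /=; rewrite FE F0 -mulrBl.
  by rewrite /GRing.scale/= mulrA.
split; first by apply/cvg_ex; exists (d * P); exact: lim.
by apply: cvg_lim => //; exact: lim.
Qed.

Lemma continuous_prod_coord h : (forall i, continuous (h i)) ->
  continuous (fun x : 'rV[R]_n => \prod_j h j (x ord0 j)).
Proof.
move=> ch x; elim: (index_enum _) => [|j s IH].
  have -> : (fun y : 'rV[R]_n => \prod_(k <- [::]) h k (y ord0 k)) = cst 1.
    by apply/funext => y; rewrite big_nil.
  exact: cst_continuous.
have -> : (fun y : 'rV[R]_n => \prod_(k <- j :: s) h k (y ord0 k)) =
    (fun y : 'rV[R]_n => h j (y ord0 j) * \prod_(k <- s) h k (y ord0 k)).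
  by apply/funext => y; rewrite big_cons.
have c1 : {for x, continuous (fun y : 'rV[R]_n => h j (y ord0 j))}.
  apply: (@continuous_comp _ _ _ (fun y : 'rV[R]_n => y ord0 j) (h j)); last exact: ch.
  exact: coord_continuous.
exact: (@cvgM _ _ (nbhs x) (nbhs_filter x) _ _ _ _ c1 IH).
Qed.

(** A partial derivative only replaces one factor of the product, so the product form is preserved
    and induction on k applies. *)
Lemma Ck_prod k h : (forall i, smooth1 k (h i)) ->
  Ck k (fun x : 'rV[R]_n => \prod_j h j (x ord0 j)).
Proof.
elim: k h => [|k IH] h sh; split.
- by apply: continuous_prod_coord => i; exact: smooth1_continuous (sh i).
- by [].
- by apply: continuous_prod_coord => i; exact: smooth1_continuous (sh i).
move=> i; have [h' dh sh'] := sh i.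
have dP x := is_derive_prod (dh (x ord0 i)).
split; first by move=> x; have [] := dP x.
rewrite (_ : (fun x => _) = (fun x : 'rV[R]_n =>
    \prod_j (if j == i then h' else h j) (x ord0 j))); last first.
  apply/funext => x; have [_ ->] := dP x; rewrite [RHS](bigD1 i)//= eqxx.
  by congr (_ * _); apply: eq_bigr => j /negbTE ->.
apply: (IH (fun j => if j == i then h' else h j)) => j.
by case: ifP => // _; exact: smooth1W.
Qed.

Lemma Ck_cst0 k : Ck k (cst 0 : 'rV[R]_n -> R).
Proof.
elim: k => [|k IH]; split => //; try exact: cst_continuous.
move=> i; split; first by move=> x; exact: derivable_cst.
by rewrite (_ : (fun x => _) = cst 0)//; apply/funext => x; exact: derive_cst.
Qed.

End smooth_products.

Section tame.
Context (R : realType) (n : nat).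
Notation mu := (lebesgue_rV R n).

(* Common feature of [L^1] and [L^oo]: |f| h is integrable for every bounded
   integrable h. *)
Definition tame (f : 'rV[R]_n -> R) (M : R) := [/\ 0 <= M, measurable_fun setT f &
  forall (h : 'rV[R]_n -> R) (c : R), (forall x, 0 <= h x) -> measurable_fun setT h ->
    (forall x, h x <= c) -> (\int[mu]_x (h x)%:E <= c%:E)%E ->
    (\int[mu]_x (`|f x| * h x)%:E <= (M * c)%:E)%E].

Lemma tame_integrable f M (h : 'rV[R]_n -> R) c : tame f M -> measurable_fun setT h ->
  (forall x, `|h x| <= c) -> (\int[mu]_x (`|h x|)%:E <= c%:E)%E ->
  mu.-integrable setT (EFin \o (fun x => f x * h x)).
Proof.
move=> [M0 mf ft] mh hc hi; apply/integrableP; split.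
  exact/measurable_EFinP/measurable_funM.
have := ft (fun x => `|h x|) c (fun x => normr_ge0 _) _ hc hi.
move=> /(_ (measurableT_comp (@normr_measurable R setT) mh)) => h1.
under eq_integral do rewrite /= normrM.
by apply: le_lt_trans h1 _; rewrite ltry.
Qed.

Lemma Lfun1_tame f : f \in Lfun mu 1 -> exists M, tame f M.
Proof.
move=> f1; have /integrableP[/measurable_EFinP mf ioo] := (iffLR (Lfun1_integrable _ _)) f1.
have fin : (\int[mu]_x (`|f x|)%:E)%E \is a fin_num.
  by rewrite ge0_fin_numE// integral_ge0.
exists (fine (\int[mu]_x (`|f x|)%:E)%E); split => //.
  by apply: fine_ge0; exact: integral_ge0.
move=> h c h0 mh hc _; have c0 : 0 <= c by exact: le_trans (h0 0) (hc 0).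
have mnf : measurable_fun setT (fun x => (`|f x|)%:E).
  by apply/measurable_EFinP; exact: measurableT_comp.
rewrite EFinM fineK// -ge0_integralZr//.
apply: ge0_le_integral => //.
- by move=> x _; rewrite lee_fin mulr_ge0.
- by apply/measurable_EFinP; apply: measurable_funM => //; exact: measurableT_comp.
- by apply/measurable_EFinP; apply: measurable_funM => //; exact: measurableT_comp.
by move=> x _; rewrite -EFinM lee_fin ler_wpM2l.
Qed.

Lemma Lfuny_tame f : f \in Lfun mu +oo%E -> exists M, tame f M.
Proof.
rewrite inE => /andP[/[!inE] mf fin].
have {}mf : measurable_fun setT f by [].
have [M fM] : exists M, \forall x \ae mu, `|f x| <= M.
  move: fin; rewrite /finite_norm unlock /=.
  case: ifPn => [_|mu0 _]; last first.
    exists 0; exists setT; split => //.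
    by apply/eqP; rewrite -measure_le0 leNgt.
  by move=> /ess_supr_bounded[M]; exists M.
exists (Num.max M 0); split => //; first by rewrite le_max lexx orbT.
move=> h c h0 mh hc hi; have c0 : 0 <= c by exact: le_trans (h0 0) (hc 0).
apply: (@le_trans _ _ (\int[mu]_x ((Num.max M 0)%:E * (h x)%:E))%E).
  apply: ae_ge0_le_integral => //.
  - by move=> x _; rewrite lee_fin mulr_ge0.
  - by apply/measurable_EFinP; apply: measurable_funM => //; exact: measurableT_comp.
  - by move=> x _; rewrite mule_ge0// lee_fin// le_max lexx orbT.
  - by apply: emeasurable_funM => //; exact/measurable_EFinP.
  apply: filterS fM => x fxM _.
  by rewrite -EFinM lee_fin ler_wpM2r// le_max fxM.
have mhE : measurable_fun setT (fun x => (h x)%:E) by exact/measurable_EFinP.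
have M0 : (0 <= (Num.max M 0)%:E)%E by rewrite lee_fin le_max lexx orbT.
rewrite ge0_integralZl//; last by move=> x _; rewrite lee_fin.
by rewrite EFinM lee_wpmul2l// lee_fin le_max lexx orbT.
Qed.

End tame.

Section Rdominated.
Context d (T : measurableType d) (R : realType) (mu : {measure set T -> \bar R}).

Lemma Rdominated_convergence (f_ : nat -> T -> R) (f g : T -> R) :
  (forall k, measurable_fun setT (f_ k)) ->
  (forall x, f_ k x @[k --> \oo] --> f x) ->
  mu.-integrable setT (EFin \o g) -> (forall k x, `|f_ k x| <= g x) ->
  \int[mu]_x f_ k x @[k --> \oo] --> \int[mu]_x f x.
Proof.
move=> mf_ lim ig fg.
have mf : measurable_fun setT f by apply: (measurable_fun_cvg mf_) => x _; exact: lim.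
have [fi _ h] : [/\ mu.-integrable setT (EFin \o f),
    (\int[mu]_x `|(f_ k x)%:E - (f x)%:E|)%E @[k --> \oo] --> 0%E &
    (\int[mu]_x (f_ k x)%:E)%E @[k --> \oo] --> (\int[mu]_x (f x)%:E)%E].
  apply: (@dominated_convergence _ _ _ _ _ _ _ _ (EFin \o g)) => //.
  - by move=> k; exact/measurable_EFinP.
  - exact/measurable_EFinP.
  - by apply: aeW => x _; apply/cvg_EFin; [exact: nearW|exact: lim].
  - by apply: aeW => x k _; rewrite lee_fin.
apply: fine_cvg; rewrite /Rintegral fineK//; exact: integrable_fin_num fi.
Qed.

End Rdominated.

Lemma cvg_prod_seq (R : realType) (I : Type) (s : seq I) (F : I -> nat -> R) (l : I -> R) :
  (forall i, F i k @[k --> \oo] --> l i) ->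
  \prod_(i <- s) F i k @[k --> \oo] --> \prod_(i <- s) l i.
Proof.
move=> Fl; elim: s => [|i s IH].
  under eq_fun do rewrite big_nil.
  by rewrite big_nil; exact: cvg_cst.
under eq_fun do rewrite big_cons.
by rewrite big_cons; apply: cvgM.
Qed.

Section gauss_ibp.
Context (R : realType) (n : nat).
Notation mu := (lebesgue_rV R n).
Variables (f : 'rV[R]_n -> R) (M : R).
Hypothesis ft : tame f M.

Let mf : measurable_fun setT f. Proof. by have [] := ft. Qed.

Lemma tame_integrable_gam u y : 0 < u ->
  mu.-integrable setT (EFin \o (fun x => f x * gam u (x - y))).
Proof.
move=> u0; apply: (@tame_integrable _ _ _ M _ (Num.max 1 (Num.sqrt u ^+ n))) => //.
- exact: measurable_gamB.
- by move=> x; rewrite ger0_norm ?gam_ge0// le_max gam_le ?orbT.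
under eq_integral do rewrite ger0_norm ?gam_ge0//.
by rewrite integral_gam// lee_fin le_max lexx.
Qed.

Lemma integral_moment1 u y : 0 < u ->
  (\int[mu]_x (enorm (x - y) * gam u (x - y))%:E <= (Cg R n / Num.sqrt u)%:E)%E.
Proof.
move=> u0; have u20 : 0 < u / 2 by rewrite divr_gt0.
have C0 : 0 <= Cg R n / Num.sqrt u by rewrite divr_ge0 ?Cg_ge0.
have mz i : measurable_fun setT (fun x : 'rV[R]_n => (x - y) ord0 i).
  by apply: measurable_coordB => // j; exact: measurable_coord_rV.
apply: (@le_trans _ _ (\int[mu]_x ((Cg R n / Num.sqrt u)%:E * (gam (u / 2) (x - y))%:E))%E).
  apply: ge0_le_integral => //.
  - by move=> x _; rewrite lee_fin mulr_ge0 ?enorm_ge0 ?gam_ge0.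
  - apply/measurable_EFinP; apply: measurable_funM; last exact: measurable_gamB.
    exact: measurable_enorm.
  - apply: emeasurable_funM => //; apply/measurable_EFinP; exact: measurable_gamB.
  by move=> x _; rewrite -EFinM lee_fin; exact: gam_moment1.
rewrite ge0_integralZl//.
- by rewrite integral_gam// mule1.
- by apply/measurable_EFinP; exact: measurable_gamB.
- by move=> x _; rewrite lee_fin gam_ge0.
Qed.

Lemma tame_integrable_moment u y : 0 < u ->
  mu.-integrable setT (EFin \o (fun x => f x * (enorm (x - y) * gam u (x - y)))).
Proof.
move=> u0; have u20 : 0 < u / 2 by rewrite divr_gt0.
have C0 : 0 <= Cg R n / Num.sqrt u by rewrite divr_ge0 ?Cg_ge0.
have mz i : measurable_fun setT (fun x : 'rV[R]_n => (x - y) ord0 i).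
  by apply: measurable_coordB => // j; exact: measurable_coord_rV.
apply: (@tame_integrable _ _ _ M _ (Cg R n / Num.sqrt u * Num.max 1 (Num.sqrt (u / 2) ^+ n))) => //.
- apply: measurable_funM; last exact: measurable_gamB.
  exact: measurable_enorm.
- move=> x; rewrite ger0_norm ?mulr_ge0 ?enorm_ge0 ?gam_ge0//.
  apply: le_trans (gam_moment1 _ u0) _; rewrite ler_wpM2l//.
  by rewrite le_max gam_le ?orbT.
under eq_integral do rewrite ger0_norm ?mulr_ge0 ?enorm_ge0 ?gam_ge0//.
apply: le_trans (integral_moment1 y u0) _; rewrite lee_fin.
by rewrite ler_peMr// le_max lexx.
Qed.

Lemma tame_integrable_coord u y i : 0 < u ->
  mu.-integrable setT (EFin \o (fun x => f x * (2 * u * (y - x) ord0 i * gam u (x - y)))).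
Proof.
move=> u0.
have mz : measurable_fun setT (fun x : 'rV[R]_n => (y - x) ord0 i).
  by apply: measurable_coordB => // j; exact: measurable_coord_rV.
have mg : measurable_fun setT (fun x : 'rV[R]_n => gam u (x - y)) by exact: measurable_gamB.
have := integrableZl measurableT (2 * u) (tame_integrable_moment y u0).
apply: le_integrable => //.
  by apply/measurable_EFinP; apply: measurable_funM => //; do 2 apply: measurable_funM => //.
move=> x _ /=; rewrite lee_fin.
rewrite (_ : 2 * u * (f x * _) = f x * (2 * u * enorm (x - y) * gam u (x - y))); last by ring.
rewrite [leLHS]normrM [leRHS]normrM ler_wpM2l// [leLHS]normrM [leRHS]normrM ler_wpM2r//.
rewrite [leLHS]normrM [leRHS]normrM ler_wpM2l// (ger0_norm (enorm_ge0 _)).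
by rewrite -enormN opprB coord_le_enorm.
Qed.

Variables (nu : radon R n) (m : {measure set 'rV[R]_n -> \bar R}) (sg : 'rV[R]_n -> 'rV[R]_n).
Hypothesis msg : forall i, measurable_fun setT (fun x => sg x ord0 i).
Hypothesis sg1 : forall x, dot (sg x) (sg x) = 1.
Hypothesis moo : (m setT < +oo)%E.
Hypothesis pairing : forall (phi : 'rV[R]_n -> 'rV[R]_n) M r,
  (forall i, measurable_fun setT (fun x => phi x ord0 i)) ->
  (forall i x, `|phi x ord0 i| <= M) -> (forall x, phi x != 0 -> `|x| <= r) ->
  radon_pairing nu phi = \int[m]_x dot (phi x) (sg x).
Hypothesis gradf : is_grad f nu.

Lemma integrable_gam_sg u y i : 0 < u ->
  m.-integrable setT (EFin \o (fun x => gam u (x - y) * sg x ord0 i)).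
Proof.
move=> u0; have mg : measurable_fun setT (fun x : 'rV[R]_n => gam u (x - y)) by exact: measurable_gamB.
apply: measurable_bounded_integrable => //; first exact: measurable_funM.
exists (Num.sqrt u ^+ n); split; first exact: num_real.
move=> M' MM' x _; apply: le_trans (ltW MM'); rewrite /= normrM (ger0_norm (gam_ge0 _ _)).
rewrite -[leRHS]mulr1; apply: ler_pM; rewrite ?gam_ge0 ?gam_le//.
exact: coord_unit_le1.
Qed.

(** [gam u] is not compactly supported, hence not a test function. It is multiplied by a product of
    bumps b(c x_j) with c --> 0: the derivative that falls on a bump carries a factor c, and
    dominated convergence passes to the limit in the other terms. *)
Lemma gauss_ibp u y i : 0 < u ->
  \int[mu]_x (f x * (2 * u * (y - x) ord0 i * gam u (x - y))) =
  - \int[m]_x (gam u (x - y) * sg x ord0 i).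
Proof.
move=> u0; have [b [b' [sb db b01 [b0 bs] [C b'C]]]] := smooth_bump R.
have C0 : 0 <= C by apply: le_trans (b'C 0).
have bge0 t : 0 <= b t by have /andP[] := b01 t.
have ble1 t : b t <= 1 by have /andP[] := b01 t.
have cb : continuous b by exact: smooth1_continuous (sb 0%N).
have mb' : measurable_fun setT b'.
  have [h' dh ch'] := sb 1%N.
  have -> : b' = h'.
    by apply/funext => t; have [_ <-] := db t; have [_ <-] := dh t.
  exact: continuous_measurable_fun.
pose c (k : nat) : R := k.+1%:R^-1.
have c0 k : 0 < c k by rewrite invr_gt0.
have c1 k : c k <= 1 by rewrite invf_le1// ler1n.
(* The [+ 0] gives the argument the affine shape expected by [smooth1_affine]. *)
pose h k (j : 'I_n) (t : R) := g1 u (t - y ord0 j) * b (c k * t + 0).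
pose B k (x : 'rV[R]_n) := \prod_j b (c k * x ord0 j + 0).
pose F k (x : 'rV[R]_n) := \prod_j h k j (x ord0 j).
have FE k x : F k x = gam u (x - y) * B k x.
  rewrite /F /h big_split/=; congr (_ * _).
  by apply: eq_bigr => j _; rewrite !mxE.
have B01 k x : 0 <= B k x <= 1.
  by rewrite prodr_ge0//= prodr_ile1// => j; rewrite bge0 ble1.
have sh k j p : smooth1 p (h k j).
  by apply: smooth1M; [exact: smooth1_g1|exact: smooth1_affine].
have mbc k j : measurable_fun setT (fun x : 'rV[R]_n => c k * x ord0 j + 0).
  apply: measurable_funD => //; apply: measurable_funM => //.
  exact: measurable_coord_rV.
have mb : measurable_fun setT b by exact: continuous_measurable_fun.
have mB k : measurable_fun setT (B k).
  by apply: measurable_prod => j _; exact: (measurableT_comp mb).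
have mg : measurable_fun setT (fun x : 'rV[R]_n => gam u (x - y)) by exact: measurable_gamB.
have mF k : measurable_fun setT (F k).
  by rewrite (_ : F k = (fun x => gam u (x - y) * B k x)); [exact: measurable_funM|apply/funext => x; rewrite FE].
have F0 k x : 0 <= F k x <= gam u (x - y).
  have /andP[x1 x2] := B01 k x; rewrite FE mulr_ge0 ?gam_ge0//=.
  by rewrite ler_piMr ?gam_ge0.
(* With a single nonzero coordinate, the divergence is one partial derivative and the pairing one
   scalar integral. *)
pose phi k x : 'rV[R]_n := \row_j (if j == i then F k x else 0).
have phiE k j : (fun x => phi k x ord0 j) = if j == i then F k else cst 0.
  by apply/funext => x; rewrite mxE; case: ifP.
have phis k x : phi k x != 0 -> `|x| <= k.+1%:R.
  move=> phix; have Fx : F k x != 0.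
    apply: contraNN phix => /eqP Fx; apply/eqP/rowP => j; rewrite !mxE Fx.
    by case: ifP.
  apply: rV_norm_le => // j; have /bs : b (c k * x ord0 j + 0) != 0.
    apply: contraNN Fx => /eqP bx; rewrite FE /B (bigD1 j)//= bx mul0r mulr0//.
  by rewrite addr0 normrM gtr0_norm// /c ler_pdivrMl// mulr1.
have sphi k : smooth_c (phi k).
  split; last exact: sub_compact_supp (phis k).
  move=> j p; rewrite phiE; case: ifP => _; last exact: Ck_cst0.
  by apply: Ck_prod => l; exact: sh.
(* [A1] comes from differentiating the Gaussian, [A2] from differentiating the bump in the i-th
   variable. *)
pose A1 k (x : 'rV[R]_n) : R := 2 * u * (y - x) ord0 i * gam u (x - y) * B k x.
pose A2 k (x : 'rV[R]_n) : R := gam u (x - y) * (c k * b' (c k * x ord0 i + 0) *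
   \prod_(j < n | j != i) b (c k * x ord0 j + 0)).
have divE k x : divergence (phi k) x = A1 k x + A2 k x.
  rewrite /divergence (bigD1 i)//= big1 ?addr0; last first.
    by move=> j ji; rewrite phiE (negbTE ji); exact: derive_cst.
  rewrite phiE eqxx.
  have d1 (t : R) : is_derive t 1 (fun s : R => c k * s + 0) (c k *: 1 + 0).
    by apply: is_deriveD; apply: is_deriveZ.
  have d2 (t : R) : is_derive t 1 (fun s : R => b (c k * s + 0)) (b' (c k * t + 0) * (c k *: 1 + 0)).
    exact: (@is_derive1_comp _ b (fun s => c k * s + 0) t _ _ (db _) (d1 t)).
  have d3 (t : R) := is_deriveM (is_derive_g1 u (y ord0 i) t) (d2 t).
  have [_ ->] := is_derive_prod (h := h k) (d3 (x ord0 i)).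
  have -> : \prod_(j < n | j != i) h k j (x ord0 j) =
      (\prod_(j < n | j != i) g1 u ((x - y) ord0 j)) *
      \prod_(j < n | j != i) b (c k * x ord0 j + 0).
    by rewrite /h big_split/=; congr (_ * _); apply: eq_bigr => j _; rewrite !mxE.
  have -> : A1 k x = 2 * u * (y ord0 i - x ord0 i) * (g1 u (x ord0 i - y ord0 i) *
      \prod_(j < n | j != i) g1 u ((x - y) ord0 j)) * (b (c k * x ord0 i + 0) *
      \prod_(j < n | j != i) b (c k * x ord0 j + 0)).
    by rewrite /A1 /B (bigD1 i)//= /gam (bigD1 i)//= !mxE.
  have -> : A2 k x = (g1 u (x ord0 i - y ord0 i) *
      \prod_(j < n | j != i) g1 u ((x - y) ord0 j)) * (c k * b' (c k * x ord0 i + 0) *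
      \prod_(j < n | j != i) b (c k * x ord0 j + 0)).
    by rewrite /A2 /gam (bigD1 i)//= !mxE.
  by rewrite addr0 scaler1 /GRing.scale/=; ring.
have ibp k : \int[mu]_x (f x * divergence (phi k) x) =
    - \int[m]_x (F k x * sg x ord0 i).
  rewrite (gradf (sphi k)) (@pairing (phi k) (Num.sqrt u ^+ n) k.+1%:R); last 3 first.
  - by move=> j; rewrite [X in measurable_fun _ X]phiE; case: ifP.
  - move=> j x; rewrite mxE; case: ifP => _; last by rewrite normr0 exprn_ge0.
    have /andP[x1 x2] := F0 k x; rewrite ger0_norm// (le_trans x2)//.
    exact: gam_le.
  - exact: phis.
  congr (- _); apply: eq_Rintegral => x _; rewrite /dot (bigD1 i)//= big1 ?addr0.
    by rewrite mxE eqxx.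
  by move=> j ji; rewrite mxE (negbTE ji) mul0r.
have clim : c k @[k --> \oo] --> (0 : R) by exact: cvg_harmonic.
have bclim t : b (c k * t + 0) @[k --> \oo] --> b 0.
  have cl : c k * t + 0 @[k --> \oo] --> (0 * t + 0 : R).
    by apply: cvgD; [apply: cvgM => //; exact: cvg_cst|exact: cvg_cst].
  rewrite mul0r addr0 in cl.
  exact: (cvg_comp (fun k => c k * t + 0) b cl (cb 0)).
have Blim x : B k x @[k --> \oo] --> b 0 ^+ n.
  have := @cvg_prod_seq _ _ (index_enum 'I_n) _ _ (fun j => bclim (x ord0 j)).
  by rewrite prodr_const card_ord.
have Flim x : F k x @[k --> \oo] --> gam u (x - y) * b 0 ^+ n.
  under eq_fun do rewrite FE.
  by apply: cvgM; [exact: cvg_cst|exact: Blim].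
have P01 k (x : 'rV[R]_n) : 0 <= \prod_(j < n | j != i) b (c k * x ord0 j + 0) <= 1.
  by rewrite prodr_ge0//= prodr_ile1// => j _; rewrite bge0 ble1.
have A2b k x : `|A2 k x| <= c k * (C * gam u (x - y)).
  rewrite /A2 !normrM (ger0_norm (gam_ge0 _ _)) (gtr0_norm (c0 k)).
  have /andP[x1 x2] := P01 k x; rewrite (ger0_norm x1) mulrC -!mulrA.
  rewrite ler_wpM2l ?(ltW (c0 k))// mulrA ler_wpM2r ?gam_ge0//.
  by rewrite -[leRHS]mulr1 ler_pM.
have divlim x : divergence (phi k) x @[k --> \oo] -->
    2 * u * (y - x) ord0 i * gam u (x - y) * b 0 ^+ n.
  under eq_fun do rewrite divE.
  have A1lim : A1 k x @[k --> \oo] --> 2 * u * (y - x) ord0 i * gam u (x - y) * b 0 ^+ n.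
    by rewrite /A1; apply: cvgM; [exact: cvg_cst|exact: Blim].
  suff A2lim : A2 k x @[k --> \oo] --> (0 : R).
    by have h2 := cvgD A1lim A2lim; rewrite (addr0 (_ * b 0 ^+ n)) in h2; exact: h2.
  have cl : c k * (C * gam u (x - y)) @[k --> \oo] --> (0 * (C * gam u (x - y)) : R).
    by apply: cvgM => //; exact: cvg_cst.
  rewrite mul0r in cl.
  apply: norm_cvg0.
  apply: (@squeeze_cvgr _ _ _ _ (cst 0) (fun k => c k * (C * gam u (x - y)))).
  - by apply: nearW => k; rewrite normr_ge0 A2b.
  - exact: cvg_cst.
  - exact: cl.
have mz : measurable_fun setT (fun x : 'rV[R]_n => (y - x) ord0 i).
  by apply: measurable_coordB => // j; exact: measurable_coord_rV.
have mdiv k : measurable_fun setT (divergence (phi k)).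
  rewrite (_ : divergence (phi k) = (fun x => A1 k x + A2 k x)); last first.
    by apply/funext => x; exact: divE.
  apply: measurable_funD; first by do 2 apply: measurable_funM => //; exact: measurable_funM.
  apply: measurable_funM => //; apply: measurable_funM.
    by apply: measurable_funM => //; exact: (measurableT_comp mb').
  rewrite (_ : (fun x => _) = fun x : 'rV[R]_n =>
     \prod_(j < n) (if j != i then b (c k * x ord0 j + 0) else 1)); last first.
    by apply/funext => x; rewrite big_mkcond.
  by apply: measurable_prod => j _; case: (j != i) => //; exact: (measurableT_comp mb).
have lhs : \int[mu]_x (f x * divergence (phi k) x) @[k --> \oo] -->
   \int[mu]_x (f x * (2 * u * (y - x) ord0 i * gam u (x - y) * b 0 ^+ n)).
  apply: (@Rdominated_convergence _ _ _ _ _ _ (fun x =>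
    2 * u * `|f x * (enorm (x - y) * gam u (x - y))| + C * `|f x * gam u (x - y)|)).
  - by move=> k; exact: measurable_funM.
  - by move=> x; apply: cvgM; [exact: cvg_cst|exact: divlim].
  - rewrite (_ : _ \o _ = (fun x => (2 * u)%:E * `|(f x * (enorm (x - y) * gam u (x - y)))%:E| +
        C%:E * `|(f x * gam u (x - y))%:E|)%E); last first.
      by apply/funext => x /=; rewrite EFinD !EFinM.
    apply: integrableD => //; apply: integrableZl => //; apply: integrable_abse => //.
    + exact: tame_integrable_moment.
    + exact: tame_integrable_gam.
  move=> k x; rewrite divE mulrDr; apply: le_trans (ler_normD _ _) _.
  rewrite (normrM (f x) (A1 k x)) (normrM (f x) (A2 k x)).
  rewrite [`|f x * (_ * _)|]normrM [`|f x * gam _ _|]normrM.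
  have g0 := gam_ge0 u (x - y); have e0 := enorm_ge0 (x - y).
  rewrite (ger0_norm g0) (ger0_norm (mulr_ge0 e0 g0)).
  have /andP[x1 x2] := B01 k x.
  apply: lerD; last first.
    rewrite mulrCA ler_wpM2l//; apply: le_trans (A2b k x) _.
    by rewrite ler_piMl ?mulr_ge0.
  have A1b : `|A1 k x| <= 2 * u * (enorm (x - y) * gam u (x - y)).
    rewrite /A1 !normrM (ger0_norm x1) (ger0_norm g0) (gtr0_norm u0) normr_nat.
    rewrite -!mulrA !ler_wpM2l ?(ltW u0)// ler_pM ?mulr_ge0//; last by rewrite ler_piMr.
    by rewrite -enormN opprB coord_le_enorm.
  by rewrite mulrCA ler_wpM2l.
have rhs : \int[m]_x (F k x * sg x ord0 i) @[k --> \oo] -->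
   \int[m]_x (gam u (x - y) * b 0 ^+ n * sg x ord0 i).
  apply: (@Rdominated_convergence _ _ _ _ _ _ (cst (Num.sqrt u ^+ n))).
  - by move=> k; exact: measurable_funM.
  - by move=> x; apply: cvgM; [exact: Flim|exact: cvg_cst].
  - apply: measurable_bounded_integrable => //.
    exists (Num.sqrt u ^+ n); split; first exact: num_real.
    by move=> M' MM' x _; rewrite /= ger0_norm ?exprn_ge0// ltW.
  - move=> k x; have /andP[x1 x2] := F0 k x; rewrite normrM (ger0_norm x1).
    rewrite -[leRHS]mulr1; apply: ler_pM => //.
      by apply: le_trans x2 _; exact: gam_le.
    exact: coord_unit_le1.
have : \int[mu]_x (f x * (2 * u * (y - x) ord0 i * gam u (x - y) * b 0 ^+ n)) =
   - \int[m]_x (gam u (x - y) * b 0 ^+ n * sg x ord0 i).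
  apply: (cvg_unique _ lhs) => //.
  rewrite (_ : (fun k => _) = (fun k => - \int[m]_x (F k x * sg x ord0 i))).
    exact: cvgN.
  by apply/funext => k; exact: ibp.
have i1 := tame_integrable_coord y i u0.
have i2 := integrable_gam_sg y i u0.
(* Both limits carry the constant b 0 ^ n, which is nonzero and cancels. *)
under eq_Rintegral do rewrite mulrA.
under [in X in _ = - X]eq_Rintegral do rewrite mulrAC.
rewrite !RintegralZr// -mulNr => /mulIf; apply.
by rewrite expf_neq0// gt_eqF.
Qed.

End gauss_ibp.

(** * Subordination *)

Section power_integrals.
Context (R : realType).
Notation mu := (@lebesgue_measure R).
Implicit Types (a b r q t u : R).

Lemma continuous_powR r u : 0 < u -> {for u, continuous (fun x => x `^ r)}.
Proof.
move=> u0; apply: differentiable_continuous; apply/derivable1_diffP.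
by have [] := is_derive1_powR r u0.
Qed.

Lemma integral_powR_itv a b r : 0 < a -> a < b -> r != 0 ->
  (\int[mu]_(u in `[a, b]) (u `^ (r - 1))%:E = ((b `^ r - a `^ r) / r)%:E)%E.
Proof.
move=> a0 ab r0; pose F (u : R) := r^-1 * u `^ r.
have b0 : 0 < b by exact: lt_trans ab.
have dF u : 0 < u -> is_derive u 1 F (u `^ (r - 1)).
  move=> u0; have := is_deriveZ r^-1 (is_derive1_powR r u0).
  by move=> /is_derive_eq; apply; rewrite /GRing.scale/= mulKf.
have cF u : 0 < u -> {for u, continuous F}.
  move=> u0; apply: differentiable_continuous; apply/derivable1_diffP.
  by have [] := dF u u0.
rewrite (@continuous_FTC2 _ _ F)//.
- by rewrite /F -EFinB -mulrBr mulrC.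
- apply: continuous_in_subspaceT => u; rewrite inE/= in_itv/= => /andP[au _].
  by apply: continuous_powR; exact: lt_le_trans au.
- split.
  + move=> u; rewrite in_itv/= => /andP[au _].
    by have [] := dF u (lt_trans a0 au).
  + by apply: cvg_at_right_filter; exact: cF.
  + by apply: cvg_at_left_filter; exact: cF.
- move=> u; rewrite in_itv/= => /andP[au _]; rewrite derive1E.
  by have [_ ->] := dF u (lt_trans a0 au).
Qed.

Lemma cvg_natSS_powRN q : 0 < q -> (k.+2%:R : R) `^ (- q) @[k --> \oo] --> 0.
Proof.
move=> q0; apply/cvgrPdist_le => e e0; near=> k.
rewrite sub0r normrN ger0_norm ?powR_ge0// powRN.
rewrite -[leRHS]invrK lef_pV2 ?posrE ?invr_gt0 ?powR_gt0//.
have -> : e^-1 = (e^-1 `^ q^-1) `^ q.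
  by rewrite -powRrM mulVf ?gt_eqF// powRr1// invr_ge0 ltW.
apply: ge0_ler_powR; rewrite ?nnegrE ?powR_ge0 ?(ltW q0)//.
apply: (@le_trans _ _ k%:R); last by rewrite ler_nat (leq_trans (leqnSn k)).
by near: k; exact: nbhs_infty_ger.
Unshelve. all: by end_near. Qed.

Lemma measurable_powRE r (D : set R) : measurable_fun D (fun u => (u `^ r)%:E).
Proof. by apply/measurable_EFinP/measurable_funTS; exact: measurable_powR. Qed.

Lemma integral_powR_1y q : 0 < q ->
  (\int[mu]_(u in `[1%R, +oo[) (u `^ (- q - 1))%:E = (q^-1)%:E)%E.
Proof.
(* [k.+2] rather than [k.+1], as [integral_powR_itv] requires a nondegenerate interval already for k
   = 0. *)
move=> q0; pose F (k : nat) := `[1, k.+2%:R]%classic : set R.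
have FU : \bigcup_k F k = `[1, +oo[%classic.
  apply/seteqP; split=> [u [k _]|u]; rewrite /F /= !in_itv/= => /andP[u1 _].
    by rewrite u1.
  exists (Num.trunc u).+1 => //; rewrite /= in_itv/= u1/=.
  by apply: ltW; apply: lt_trans (truncnS_gt u) _; rewrite ltr_nat.
have : (\int[mu]_(u in F k) (u `^ (- q - 1))%:E)%E @[k --> \oo] -->
    (\int[mu]_(u in \bigcup_k F k) (u `^ (- q - 1))%:E)%E.
  apply: ge0_nondecreasing_set_cvg_integral => //.
  - move=> i j ij; apply/subsetPset => u; rewrite /F /= !in_itv/= => /andP[-> h].
    by rewrite (le_trans h)// ler_nat !ltnS.
  - by move=> k; exact: measurable_itv.
  - by move=> k; exact: measurable_powRE.
  - by move=> k u _; rewrite lee_fin powR_ge0.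
rewrite FU => /cvg_lim <-//; apply/cvg_lim => //.
rewrite (_ : (fun _ => _) = (fun k => (q^-1 * (1 - k.+2%:R `^ (- q)))%:E)); last first.
  apply/funext => k; rewrite integral_powR_itv ?ltr1n ?oppr_eq0 ?gt_eqF//.
  by congr EFin; rewrite powR1; field; exact: lt0r_neq0.
apply/cvg_EFin; first exact: nearW.
have h : q^-1 * (1 - k.+2%:R `^ (- q)) @[k --> \oo] --> q^-1 * (1 - 0).
  apply: cvgM; first exact: cvg_cst.
  by apply: cvgB; [exact: cvg_cst|exact: cvg_natSS_powRN].
by rewrite subr0 mulr1 in h.
Qed.

Lemma integral_powR_01 q : 0 < q ->
  (\int[mu]_(u in `]0%R, 1%R]) (u `^ (q - 1))%:E = (q^-1)%:E)%E.
Proof.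
move=> q0; pose F (k : nat) := `[k.+2%:R^-1, 1]%classic : set R.
have FU : \bigcup_k F k = `]0, 1]%classic.
  apply/seteqP; split=> [u [k _]|u]; rewrite /F /= !in_itv/= => /andP[u1 u2].
    by rewrite u2 (lt_le_trans _ u1)// invr_gt0.
  exists (Num.trunc u^-1) => //; rewrite /= in_itv/= u2 andbT.
  rewrite -[leRHS]invrK lef_pV2 ?posrE ?invr_gt0//.
  by apply: ltW; apply: lt_trans (truncnS_gt _) _; rewrite ltr_nat.
have : (\int[mu]_(u in F k) (u `^ (q - 1))%:E)%E @[k --> \oo] -->
    (\int[mu]_(u in \bigcup_k F k) (u `^ (q - 1))%:E)%E.
  apply: ge0_nondecreasing_set_cvg_integral => //.
  - move=> i j ij; apply/subsetPset => u; rewrite /F /= !in_itv/= => /andP[h ->].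
    by rewrite andbT (le_trans _ h)// lef_pV2 ?posrE// ler_nat !ltnS.
  - by move=> k; exact: measurable_itv.
  - by move=> k; exact: measurable_powRE.
  - by move=> k u _; rewrite lee_fin powR_ge0.
rewrite FU => /cvg_lim <-//; apply/cvg_lim => //.
rewrite (_ : (fun _ => _) = (fun k => (q^-1 * (1 - k.+2%:R `^ (- q)))%:E)); last first.
  apply/funext => k; rewrite integral_powR_itv ?invr_gt0 ?invf_lt1 ?ltr1n ?gt_eqF//.
  by congr EFin; rewrite powR1 -[k.+2%:R^-1]powR_inv1// -powRrM mulN1r mulrC.
apply/cvg_EFin; first exact: nearW.
have h : q^-1 * (1 - k.+2%:R `^ (- q)) @[k --> \oo] --> q^-1 * (1 - 0).
  apply: cvgM; first exact: cvg_cst.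
  by apply: cvgB; [exact: cvg_cst|exact: cvg_natSS_powRN].
by rewrite subr0 mulr1 in h.
Qed.

End power_integrals.

(** * Estimates of the Gamma function *)

Section gamma_function.
Context (R : realType).
Notation mu := (@lebesgue_measure R).
Implicit Types (r p q t u : R).

Definition gintegrand p t : R := t `^ (p - 1) * expR (- t).

Lemma gintegrand_ge0 p t : 0 <= gintegrand p t.
Proof. by rewrite mulr_ge0 ?powR_ge0 ?expR_ge0. Qed.

Lemma measurable_gintegrand p (D : set R) : measurable_fun D (fun t => (gintegrand p t)%:E).
Proof.
apply/measurable_EFinP/measurable_funTS; apply: measurable_funM.
  exact: measurable_powR.
by apply: measurableT_comp => //; exact: oppr_measurable.
Qed.

Let GE p := (\int[mu]_(t in `]0%R, +oo[) (gintegrand p t)%:E)%E.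

Let GE_split p : (GE p <= \int[mu]_(t in `]0%R, 1%R]) (gintegrand p t)%:E +
   \int[mu]_(t in `[1%R, +oo[) (gintegrand p t)%:E)%E.
Proof.
pose A := `]0, 1]%classic : set R; pose B := `]1, +oo[%classic : set R.
have mA : measurable A by exact: measurable_itv.
have mB : measurable B by exact: measurable_itv.
have AB : A `|` B = `]0, +oo[%classic.
  apply/seteqP; split=> u; rewrite /A /B /= !in_itv/= ?andbT.
    by move=> [/andP[]//|]; exact: lt_trans.
  by move=> u0; rewrite u0; case: (leP u 1); [left|right].
rewrite /GE -AB ge0_integral_setU//=; last 3 first.
- by apply: measurable_gintegrand.
- by move=> t _; rewrite lee_fin gintegrand_ge0.
- apply/disj_set2P; apply/seteqP; split=> // u; rewrite /A /B /= !in_itv/= andbT.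
  by move=> [/andP[_ u1]]; rewrite ltNge u1.
rewrite leeD2l//; apply: ge0_subset_integral => //=.
- by apply: measurable_gintegrand.
- by move=> t _; rewrite lee_fin gintegrand_ge0.
- by move=> t; rewrite /B /= !in_itv/= !andbT => /ltW.
Qed.

Let int01 p : 0 < p -> (\int[mu]_(t in `]0%R, 1%R]) (gintegrand p t)%:E <= (p^-1)%:E)%E.
Proof.
move=> p0; rewrite -integral_powR_01//; apply: ge0_le_integral => //=.
- by move=> t _; rewrite lee_fin gintegrand_ge0.
- by apply: measurable_gintegrand.
- by apply: measurable_powRE.
move=> t; rewrite in_itv/= => /andP[t0 t1]; rewrite lee_fin /gintegrand.
by rewrite ler_piMr ?powR_ge0// -expR0 ler_expR oppr_le0 ltW.
Qed.

(** From exp t >= t^(N+2) / (N+2)!, the integrand is at most (N+2)! t^-2 on [1, +oo[. *)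
Let int1y p (N : nat) : p - 1 <= N%:R ->
  (\int[mu]_(t in `[1%R, +oo[) (gintegrand p t)%:E <= (N.+2`!%:R)%:E)%E.
Proof.
move=> pN; apply: (@le_trans _ _
    (\int[mu]_(t in `[1%R, +oo[) ((N.+2`!%:R)%:E * (t `^ (- 1 - 1))%:E))%E).
  apply: ge0_le_integral => //=.
  - by move=> t _; rewrite lee_fin gintegrand_ge0.
  - by apply: measurable_gintegrand.
  - by apply: emeasurable_funM => //; exact: measurable_powRE.
  move=> t; rewrite in_itv/= andbT => t1; rewrite -EFinM lee_fin /gintegrand.
  have t0 : 0 < t by exact: lt_le_trans t1.
  apply: (@le_trans _ _ (t ^+ N * expR (- t))).
    by rewrite ler_wpM2r ?expR_ge0// -powR_mulrn ?(ltW t0)// ler_powR.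
  rewrite -opprD powRN -[1 + 1]/(2%:R) powR_mulrn ?(ltW t0)//.
  rewrite ler_pdivlMr ?exprn_gt0// expRN mulrAC -exprD addn2 ler_pdivrMr ?expR_gt0//.
  rewrite mulrC -ler_pdivrMr ?ltr0n ?fact_gt0//.
  by apply: le_trans (expR_ge1Dxn N.+1 (ltW t0)); rewrite lerDr.
rewrite ge0_integralZl//=; last 2 first.
- by apply: measurable_powRE.
- by move=> t _; rewrite lee_fin powR_ge0.
by rewrite integral_powR_1y// invr1 mule1.
Qed.

Lemma gamma_lty p : 0 < p -> (GE p < +oo)%E.
Proof.
move=> p0; apply: le_lt_trans (GE_split p) _.
apply: lte_add_pinfty.
  by apply: le_lt_trans (int01 p0) _; rewrite ltry.
have pN : p - 1 <= (Num.trunc p).+1%:R.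
  by have := truncnS_gt p; lra.
by apply: le_lt_trans (int1y pN) _; rewrite ltry.
Qed.

Lemma gammaE p : 0 < p ->
  (\int[mu]_(t in `]0%R, +oo[) (gintegrand p t)%:E = (Gamma p)%:E)%E.
Proof.
move=> p0; rewrite /Gamma /Rintegral fineK// ge0_fin_numE; first exact: gamma_lty.
by apply: integral_ge0 => t _; rewrite lee_fin gintegrand_ge0.
Qed.

Lemma Gamma_ub q : 0 < q <= 1 -> Gamma q <= q^-1 + 2.
Proof.
move=> /andP[q0 q1]; rewrite -lee_fin -gammaE//; apply: le_trans (GE_split q) _.
rewrite EFinD; apply: leeD; first exact: int01.
by have := @int1y q 0; rewrite subr_le0 q1 => /(_ isT).
Qed.

(** From exp(-t) >= 1 - t on ]0, 1]. Together with [Gamma_ub] it places Gamma(q) within a bounded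
    distance of 1/q, which determines q Gamma(q) in the limit q --> 0. *)
Lemma Gamma_lb q : 0 < q -> q^-1 - (q + 1)^-1 <= Gamma q.
Proof.
move=> q0; rewrite lerBlDr -lee_fin EFinD -gammaE//.
have q10 : 0 < q + 1 by rewrite ltr_wpDl ?ltW.
rewrite -(integral_powR_01 q0) -(integral_powR_01 q10).
apply: (@le_trans _ _ (\int[mu]_(t in `]0%R, 1%R]) (gintegrand q t)%:E +
    \int[mu]_(u in `]0%R, 1%R]) (u `^ (q + 1 - 1))%:E)%E); last first.
  rewrite leeD2r//; apply: ge0_subset_integral => //=.
  - by apply: measurable_gintegrand.
  - by move=> t _; rewrite lee_fin gintegrand_ge0.
  - by move=> t; rewrite /= !in_itv/= andbT => /andP[].
rewrite -ge0_integralD//=; last 4 first.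
- by move=> t _; rewrite lee_fin gintegrand_ge0.
- by apply: measurable_gintegrand.
- by move=> t _; rewrite lee_fin powR_ge0.
- by apply: measurable_powRE.
apply: ge0_le_integral => //=.
- by move=> t _; rewrite lee_fin powR_ge0.
- by apply: measurable_powRE.
- by apply: emeasurable_funD; [exact: measurable_gintegrand|exact: measurable_powRE].
move=> t; rewrite in_itv/= => /andP[t0 t1]; rewrite lee_fin /gintegrand addrK.
rewrite -[in X in _ <= _ + X](mulr_powRB1 (ltW t0) q0) mulrC -mulrDl.
rewrite -[leLHS]mul1r ler_wpM2r ?powR_ge0//.
by have := expR_ge1Dx (- t); lra.
Qed.

(** Lebesgue measure is r times its image under the dilation of ratio r: the two agree on half-open
    intervals, and uniqueness extends this to all measurable sets. *)
Lemma integral_scale r (G : R -> R) : 0 < r -> measurable_fun setT G ->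
  (forall t, 0 <= G t) ->
  (\int[mu]_t (G t)%:E = r%:E * \int[mu]_u (G (r * u))%:E)%E.
Proof.
move=> r0 mG G0.
pose f : measurableTypeR R -> measurableTypeR R := fun u => r * u.
have mf : measurable_fun setT f by exact: measurable_funM.
have r00 : 0 <= r by exact: ltW.
pose rn : {nonneg R} := NngNum r00.
pose nu : {measure set (measurableTypeR R) -> \bar R} :=
  mscale rn (measure_function_pushforward__canonical__measure_function_Measure
     (@lebesgue_measure R) mf).
have nuE A : measurable A -> mu A = nu A.
  apply: lebesgue_measure_unique => _ [[a b] _ <-].
  rewrite /nu /= /mscale /= /pushforward.
  rewrite (_ : f @^-1` _ = `](a / r), (b / r)]%classic); last first.
    apply/seteqP; split=> u /=; rewrite !in_itv/= /f ltr_pdivrMr// ler_pdivlMr//;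
    by rewrite ![u * r]mulrC.
  rewrite !lebesgue_measure_itv/= !lte_fin ltr_pM2r ?invr_gt0//.
  case: ifP => _; rewrite ?mule0// -!EFinD -EFinM; congr EFin; field; exact: lt0r_neq0.
transitivity (\int[nu]_t (G t)%:E)%E.
  by apply: eq_measure_integral => A mA _; exact: nuE.
have mGE : measurable_fun setT (fun t : measurableTypeR R => (G t)%:E) by exact/measurable_EFinP.
rewrite ge0_integral_mscale//; last by move=> t _; rewrite lee_fin.
congr (_ * _)%E; rewrite ge0_integral_pushforward ?preimage_setT//.
by move=> t _; rewrite lee_fin.
Qed.

Lemma gamma_scale p r : 0 < p -> 0 < r ->
  (\int[mu]_(u in `]0%R, +oo[) (u `^ (p - 1) * expR (- (u * r)))%:E =
   (Gamma p * r `^ (- p))%:E)%E.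
Proof.
move=> p0 r0.
pose G t := if 0 < t then gintegrand p t else 0.
have mG : measurable_fun setT G.
  apply: measurable_fun_ifT => //; first exact: measurable_fun_ltr.
  by apply/measurable_EFinP; exact: measurable_gintegrand.
have G0 t : 0 <= G t by rewrite /G; case: ifP => // _; exact: gintegrand_ge0.
have h := integral_scale r0 mG G0.
have GG : (\int[mu]_t (G t)%:E = (Gamma p)%:E)%E.
  rewrite -gammaE// [RHS]integral_mkcond; apply: eq_integral => t _.
  by rewrite patchE /G mem_setE in_itv/= andbT; case: ifP.
rewrite GG in h.
have fE u : ((u `^ (p - 1) * expR (- (u * r)))%:E = (r `^ (1 - p))%:E * (u `^ (p - 1) * r `^ (p - 1) * expR (- (u * r)))%:E)%E.
  rewrite -EFinM; congr EFin; rewrite -[1 - p]opprB powRN; field.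
  by rewrite gt_eqF// powR_gt0.
rewrite integral_mkcond.
transitivity (\int[mu]_u ((r `^ (1 - p))%:E * (G (r * u))%:E))%E.
  apply: eq_integral => u _; rewrite patchE /G pmulr_rgt0// mem_setE in_itv/= andbT.
  case: ifP => u0; last by rewrite mule0.
  rewrite /gintegrand powRM ?(ltW r0) ?(ltW u0)// fE; congr (_ * _%:E)%E.
  by rewrite [r * u]mulrC; ring.
rewrite ge0_integralZl//; last 3 first.
- by apply/measurable_EFinP; apply: (measurableT_comp mG); exact: measurable_funM.
- by move=> u _; rewrite lee_fin.
- by rewrite lee_fin powR_ge0.
have := congr1 (fun x => ((r `^ (- p))%:E * x)%E) h => /esym.
rewrite -EFinM mulrC => <-; rewrite muleA -EFinM; congr (_%:E * _)%E.
rewrite powRD; last by apply/implyP => _; rewrite gt_eqF.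
by rewrite (powRr1 (ltW r0)) mulrC.
Qed.

End gamma_function.

(** * The weight and its limits as alpha tends to 1 *)

Section weight.
Context (R : realType).
Notation mu := (@lebesgue_measure R).
Implicit Types (alpha u A C : R) (a : R -> R).

(* Weight of the subordination of |z|^{-(n+alpha+1)} to the Gaussians, see
   integral_wt_gam. *)
Definition wt_cst alpha : R := 2 `^ (alpha - 1) / Gamma ((1 - alpha) / 2).

Definition wt alpha u : R :=
  if 0 < u then wt_cst alpha * u `^ (- ((3 - alpha) / 2)) else 0.

Lemma Gamma_gt0 q : 0 < q -> 0 < Gamma q :> R.
Proof.
move=> q0; apply: lt_le_trans (Gamma_lb q0); rewrite subr_gt0.
by rewrite ltf_pV2 ?posrE ?addr_gt0// ltrDl.
Qed.

Lemma wt_cst_gt0 alpha : alpha < 1 -> 0 < wt_cst alpha.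
Proof.
move=> a1; rewrite divr_gt0 ?powR_gt0// Gamma_gt0// divr_gt0// subr_gt0.
exact: a1.
Qed.

Lemma wt_ge0 alpha u : alpha < 1 -> 0 <= wt alpha u.
Proof.
move=> a1; rewrite /wt; case: ifP => // _.
by rewrite mulr_ge0 ?powR_ge0// ltW// wt_cst_gt0.
Qed.

Lemma measurable_wt alpha : measurable_fun setT (wt alpha).
Proof.
apply: measurable_fun_ifT => //; first exact: measurable_fun_ltr.
by apply: measurable_funM => //; exact: measurable_powR.
Qed.

(* Envelope of the functions of u to be integrated against wt alpha: as
   alpha --> 1 only A survives (cvg_wt_p, cvg_wt_r). *)
Definition wt_bd A C u : R := if 1 <= u then A + C / Num.sqrt u else C * Num.sqrt u.

Lemma wt_bd_ge0 A C u : 0 <= A -> 0 <= C -> 0 <= wt_bd A C u.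
Proof.
move=> A0 C0; rewrite /wt_bd; case: ifP => _; first by rewrite addr_ge0// divr_ge0// sqrtr_ge0.
by rewrite mulr_ge0// sqrtr_ge0.
Qed.

Lemma measurable_wt_bd A C : measurable_fun setT (wt_bd A C).
Proof.
have ms : measurable_fun setT (fun u : R => Num.sqrt u).
  by apply: continuous_measurable_fun; exact: sqrt_continuous.
apply: measurable_fun_ifT => //; first exact: measurable_fun_ler.
- apply: measurable_funD => //; apply: measurable_funM => //.
  rewrite (_ : (fun _ => _) = (fun u => (Num.sqrt u) `^ (-1))); last first.
    by apply/funext => u; rewrite powR_inv1// sqrtr_ge0.
  apply: (measurableT_comp (@measurable_powR _ _) ms).
- by apply: measurable_funM.
Qed.

(** For 0 < alpha < 1, [wt_p] is the integral of [wt] over [1, +oo[, and [wt_r] is the sum of its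
    integrals against u^(-1/2) over [1, +oo[ and against u^(1/2) over ]0, 1]. *)
Definition wt_p alpha : R := wt_cst alpha * (2 / (1 - alpha)).
Definition wt_r alpha : R := wt_cst alpha * (2 / (2 - alpha) + 2 / alpha).

Lemma integral_wt_bd alpha A C : 0 < alpha < 1 -> 0 <= A -> 0 <= C ->
  (\int[mu]_u (wt alpha u * wt_bd A C u)%:E <= (A * wt_p alpha + C * wt_r alpha)%:E)%E.
Proof.
move=> /andP[a0 a1] A0 C0; set c := wt_cst alpha.
have c0 : 0 <= c by exact: ltW (wt_cst_gt0 a1).
have q1 : 0 < (1 - alpha) / 2 by rewrite divr_gt0// subr_gt0.
have q2 : 0 < (2 - alpha) / 2 by rewrite divr_gt0// subr_gt0 (lt_trans a1)// ltr1n.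
have q3 : 0 < alpha / 2 by rewrite divr_gt0.
pose f1 := (fun u => (u `^ (- ((1 - alpha) / 2) - 1))%:E) \_ `[1%R, +oo[%classic.
pose f2 := (fun u => (u `^ (- ((2 - alpha) / 2) - 1))%:E) \_ `[1%R, +oo[%classic.
pose f3 := (fun u => (u `^ (alpha / 2 - 1))%:E) \_ `]0%R, 1%R]%classic.
have I1 : (\int[mu]_u f1 u = (((1 - alpha) / 2)^-1)%:E)%E.
  by rewrite -integral_mkcond integral_powR_1y.
have I2 : (\int[mu]_u f2 u = (((2 - alpha) / 2)^-1)%:E)%E.
  by rewrite -integral_mkcond integral_powR_1y.
have I3 : (\int[mu]_u f3 u = ((alpha / 2)^-1)%:E)%E.
  by rewrite -integral_mkcond integral_powR_01.
have f10 u : (0 <= f1 u)%E by rewrite /f1 patchE; case: ifP => //; rewrite lee_fin powR_ge0.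
have f20 u : (0 <= f2 u)%E by rewrite /f2 patchE; case: ifP => //; rewrite lee_fin powR_ge0.
have f30 u : (0 <= f3 u)%E by rewrite /f3 patchE; case: ifP => //; rewrite lee_fin powR_ge0.
have mf1 : measurable_fun setT f1.
  by apply/(measurable_restrictT _ _).1 => //; exact: measurable_powRE.
have mf2 : measurable_fun setT f2.
  by apply/(measurable_restrictT _ _).1 => //; exact: measurable_powRE.
have mf3 : measurable_fun setT f3.
  by apply/(measurable_restrictT _ _).1 => //; exact: measurable_powRE.
have cA : 0 <= c * A by exact: mulr_ge0.
have cC : 0 <= c * C by exact: mulr_ge0.
have Z (k : R) g : 0 <= k -> (forall u, 0 <= g u)%E -> forall u : R, (0 <= k%:E * g u)%E.
  by move=> k0 g0 u; rewrite mule_ge0// lee_fin.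
have mZ (k : R) (g : R -> \bar R) : measurable_fun setT g ->
    measurable_fun setT (fun u => (k%:E * g u)%E).
  by move=> mg; apply: emeasurable_funM.
apply: (@le_trans _ _ (\int[mu]_u ((c * A)%:E * f1 u + ((c * C)%:E * f2 u + (c * C)%:E * f3 u)))%E).
  apply: ge0_le_integral => //=.
  - by move=> u _; rewrite lee_fin mulr_ge0 ?wt_bd_ge0 ?wt_ge0.
  - apply/measurable_EFinP; apply: measurable_funM; first exact: measurable_wt.
    exact: measurable_wt_bd.
  - by apply: emeasurable_funD; [exact: mZ|apply: emeasurable_funD; exact: mZ].
  move=> u _; rewrite /wt; case: ifPn => [u0|_]; last first.
    by rewrite mul0r !adde_ge0// Z.
  have e1 : u `^ (- ((1 - alpha) / 2) - 1) = u `^ (- ((3 - alpha) / 2)).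
    by congr (_ `^ _); field.
  have e2 : u `^ (- ((2 - alpha) / 2) - 1) = u `^ (- ((3 - alpha) / 2)) / Num.sqrt u.
    rewrite -powR12_sqrt ?(ltW u0)// -powRN -powRD; last by rewrite (gt_eqF u0) implybT.
    by congr (_ `^ _); field.
  have e3 : u `^ (alpha / 2 - 1) = u `^ (- ((3 - alpha) / 2)) * Num.sqrt u.
    rewrite -powR12_sqrt ?(ltW u0)// -powRD; last by rewrite (gt_eqF u0) implybT.
    by congr (_ `^ _); field.
  rewrite /wt_bd; case: (leP 1 u) => u1.
    apply: (@le_trans _ _ ((c * A)%:E * f1 u + ((c * C)%:E * f2 u + 0))%E); last first.
      by rewrite !leeD2l// Z.
    rewrite /f1 /f2 !patchE mem_setE in_itv/= u1/= adde0 -!EFinM -EFinD lee_fin e1 e2.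
    by rewrite le_eqVlt; apply/orP; left; apply/eqP; rewrite -/c; ring.
  apply: (@le_trans _ _ (0 + (0 + (c * C)%:E * f3 u))%E); last first.
    by rewrite !leeD// Z.
  rewrite /f3 !patchE mem_setE in_itv/= u0 (ltW u1)/= !add0e -!EFinM lee_fin e3.
  by rewrite le_eqVlt; apply/orP; left; apply/eqP; rewrite -/c; ring.
have ZZ : forall u : R, [set: R] u -> (0 <= ((c * C)%:E * f2 u + (c * C)%:E * f3 u))%E.
  by move=> u _; rewrite adde_ge0// Z.
have mm : measurable_fun setT (fun u => ((c * C)%:E * f2 u + (c * C)%:E * f3 u)%E).
  by apply: emeasurable_funD; exact: mZ.
rewrite ge0_integralD//=; [|by move=> u _; exact: Z|exact: mZ].
rewrite ge0_integralD//=; [|by move=> u _; exact: Z|exact: mZ|by move=> u _; exact: Z|exact: mZ].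
rewrite !ge0_integralZl//; rewrite ?lee_fin//.
rewrite I1 I2 I3 -!EFinM -!EFinD lee_fin; rewrite le_eqVlt; apply/orP; left; apply/eqP.
rewrite /wt_p /wt_r -/c; field.
by rewrite !gt_eqF// subr_gt0// (lt_trans a1)// ltr1n.
Qed.

Lemma wt_integrable alpha a A C : 0 < alpha < 1 -> 0 <= A -> 0 <= C ->
  measurable_fun setT a -> (forall u, 0 < u -> `|a u| <= wt_bd A C u) ->
  mu.-integrable setT (fun u => (wt alpha u * a u)%:E).
Proof.
move=> aa A0 C0 ma ab; have /andP[_ a1] := aa; apply/integrableP; split.
  by apply/measurable_EFinP; apply: measurable_funM => //; exact: measurable_wt.
apply: (@le_lt_trans _ _ (A * wt_p alpha + C * wt_r alpha)%:E); last by rewrite ltry.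
apply: le_trans (integral_wt_bd aa A0 C0); apply: ge0_le_integral => //=.
- apply/measurable_EFinP; apply: measurableT_comp => //.
  by apply: measurable_funM => //; exact: measurable_wt.
- apply/measurable_EFinP; apply: measurable_funM; first exact: measurable_wt.
  exact: measurable_wt_bd.
move=> u _; rewrite lee_fin normrM ger0_norm ?wt_ge0//.
case: (ltP 0 u) => u0; first by rewrite ler_wpM2l ?wt_ge0// ab.
by rewrite /wt ltNge u0/= !mul0r.
Qed.

Lemma wt_Rintegral_le alpha a A C : 0 < alpha < 1 -> 0 <= A -> 0 <= C ->
  mu.-integrable setT (fun u => (wt alpha u * a u)%:E) ->
  (forall u, 0 < u -> a u <= wt_bd A C u) ->
  \int[mu]_u (wt alpha u * a u) <= A * wt_p alpha + C * wt_r alpha.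
Proof.
move=> aa A0 C0 ia ab; have /andP[_ a1] := aa.
have ib : mu.-integrable setT (fun u => (wt alpha u * wt_bd A C u)%:E).
  apply: (wt_integrable aa A0 C0); first exact: measurable_wt_bd.
  by move=> u u0; rewrite ger0_norm// wt_bd_ge0.
apply: (@le_trans _ _ (\int[mu]_u (wt alpha u * wt_bd A C u))).
  apply: le_Rintegral => // u _.
  case: (ltP 0 u) => u0; first by rewrite ler_wpM2l ?wt_ge0// ab.
  by rewrite /wt ltNge u0/= !mul0r.
rewrite -lee_fin /Rintegral fineK; first exact: integral_wt_bd.
exact: integrable_fin_num.
Qed.

Lemma Rintegral_wt_bd1 alpha : 0 < alpha < 1 ->
  \int[mu]_u (wt alpha u * wt_bd 1 0 u) = wt_p alpha.
Proof.
move=> /andP[a0 a1]; have c0 := wt_cst_gt0 a1.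
have q1 : 0 < (1 - alpha) / 2 by rewrite divr_gt0// subr_gt0.
rewrite /Rintegral.
rewrite (_ : (\int[mu]_u _ = \int[mu]_(u in `[1%R, +oo[)
   ((wt_cst alpha)%:E * (u `^ (- ((1 - alpha) / 2) - 1))%:E))%E); last first.
  rewrite [RHS]integral_mkcond; apply: eq_integral => u _.
  rewrite patchE mem_setE in_itv/= andbT /wt_bd /wt; case: (leP 1 u) => u1; last first.
    by case: ifP => _; rewrite mul0r ?mulr0.
  rewrite (lt_le_trans ltr01 u1) mul0r addr0 mulr1 -EFinM; congr (_ * _ `^ _)%:E.
  by field.
rewrite ge0_integralZl//; last 3 first.
- by apply: measurable_powRE.
- by move=> u _; rewrite lee_fin powR_ge0.
- by rewrite lee_fin ltW.
rewrite integral_powR_1y// -EFinM /wt_p /=; field.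
by rewrite gt_eqF// subr_gt0.
Qed.

Lemma wt_Rintegral_ge alpha a A C : 0 < alpha < 1 -> 0 <= A -> 0 <= C ->
  mu.-integrable setT (fun u => (wt alpha u * a u)%:E) ->
  (forall u, 0 < u -> wt_bd A 0 u - wt_bd 0 C u <= a u) ->
  A * wt_p alpha - C * wt_r alpha <= \int[mu]_u (wt alpha u * a u).
Proof.
move=> aa A0 C0 ia ab; have /andP[_ a1] := aa.
have ib A' C' : 0 <= A' -> 0 <= C' ->
    mu.-integrable setT (fun u => (wt alpha u * wt_bd A' C' u)%:E).
  move=> A'0 C'0; apply: (wt_integrable aa A'0 C'0); first exact: measurable_wt_bd.
  by move=> u u0; rewrite ger0_norm// wt_bd_ge0.
(* The main term needs the exact value of its integral, since [integral_wt_bd] only bounds from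
   above. *)
have -> : A * wt_p alpha = \int[mu]_u (wt alpha u * wt_bd A 0 u).
  rewrite -Rintegral_wt_bd1// -RintegralZl//; last exact: ib.
  by apply: eq_Rintegral => u _; rewrite /wt_bd; case: ifP => _; ring.
rewrite lerBlDr; apply: (@le_trans _ _ (\int[mu]_u (wt alpha u * a u) +
    \int[mu]_u (wt alpha u * wt_bd 0 C u))); last first.
  rewrite lerD2l; apply: le_trans (wt_Rintegral_le aa (lexx 0) C0 (ib _ _ (lexx 0) C0) _) _.
    by move=> u _.
  by rewrite mul0r add0r.
rewrite -RintegralD//; [|exact: ib].
apply: le_Rintegral => //; first exact: ib.
  rewrite (_ : _ \o _ = (fun u => (wt alpha u * a u)%:E + (wt alpha u * wt_bd 0 C u)%:E)%E)//.
  by apply: integrableD => //; exact: ib.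
move=> u _; rewrite -mulrDr; case: (ltP 0 u) => u0.
  by rewrite ler_wpM2l ?wt_ge0// -lerBlDr ab.
by rewrite /wt ltNge u0/= !mul0r.
Qed.

Lemma Gamma_near0 (q : R) : 0 < q -> q <= 1 ->
  1 - q * (q + 1)^-1 <= q * Gamma q <= 1 + q * 2.
Proof.
move=> q0 q1; have qq : q * q^-1 = 1 by rewrite divff// gt_eqF.
apply/andP; split.
  by rewrite -{1}qq -mulrBr ler_pM2l// Gamma_lb.
have -> : 1 + q * 2 = q * (q^-1 + 2) by field; rewrite gt_eqF.
by rewrite ler_pM2l// Gamma_ub// q0.
Qed.

Let cvg_s : (1 - alpha) @[alpha --> (1 : R)^'-] --> (0 : R).
Proof.
rewrite -[X in _ --> X](subrr (1 : R)); apply: cvgB; first exact: cvg_cst.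
by apply: cvg_at_left_filter; exact: cvg_id.
Qed.

Lemma near_left1 : \forall alpha \near (1 : R)^'-, 0 < alpha < 1.
Proof.
near=> alpha; apply/andP; split; near: alpha.
  exact: nbhs_left_gt.
exact: nbhs_left_lt.
Unshelve. all: by end_near. Qed.

(** With q = (1 - alpha) / 2, [wt_p alpha] equals 2^(alpha - 1) / (q Gamma(q)), and [Gamma_near0]
    squeezes q Gamma(q) to 1. *)
Lemma cvg_wt_p : wt_p alpha @[alpha --> (1 : R)^'-] --> (1 : R).
Proof.
have cq : ((1 - alpha) / 2) @[alpha --> (1 : R)^'-] --> (0 : R).
  by rewrite -[X in _ --> X](mul0r (2^-1 : R)); apply: cvgM => //; exact: cvg_cst.
have cG : ((1 - alpha) / 2 * Gamma ((1 - alpha) / 2)) @[alpha --> (1 : R)^'-] --> (1 : R).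
  have lo : (1 - (1 - alpha) / 2 * (((1 - alpha) / 2) + 1)^-1) @[alpha --> (1 : R)^'-] --> (1 - 0 * (0 + 1)^-1 : R).
    apply: cvgB; first exact: cvg_cst.
    apply: cvgM => //; apply: cvgV; first by rewrite add0r oner_neq0.
    by apply: cvgD => //; exact: cvg_cst.
  have hi : (1 + (1 - alpha) / 2 * 2) @[alpha --> (1 : R)^'-] --> (1 + 0 * 2 : R).
    apply: cvgD; first exact: cvg_cst.
    by apply: cvgM => //; exact: cvg_cst.
  rewrite mul0r subr0 in lo; rewrite mul0r addr0 in hi.
  apply: squeeze_cvgr lo hi; near=> alpha.
  have /andP[a0 a1] : 0 < alpha < 1 by near: alpha; exact: near_left1.
  apply: (@Gamma_near0 ((1 - alpha) / 2)); first by rewrite divr_gt0// subr_gt0.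
  by rewrite ler_pdivrMr// mul1r; lra.
have c2 : (2 `^ (alpha - 1)) @[alpha --> (1 : R)^'-] --> (1 : R).
  have h : expR ((1 - alpha) * - ln 2) @[alpha --> (1 : R)^'-] --> expR (0 * - ln 2 : R).
    apply: continuous_cvg; first exact: continuous_expR.
    by apply: cvgM => //; exact: cvg_cst.
  rewrite mul0r expR0 in h.
  rewrite (_ : (fun _ => _) = (fun alpha => expR ((1 - alpha) * - ln 2)))//.
  by apply/funext => alpha; rewrite /powR pnatr_eq0/= mulrN -mulNr opprB.
have h : (2 `^ (alpha - 1) / ((1 - alpha) / 2 * Gamma ((1 - alpha) / 2)))
    @[alpha --> (1 : R)^'-] --> (1 / 1 : R).
  by apply: cvgM => //; apply: cvgV => //; exact: oner_neq0.
rewrite mul1r invr1 in h.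
apply: cvg_trans h; apply: near_eq_cvg; near=> alpha.
have /andP[a0 a1] : 0 < alpha < 1 by near: alpha; exact: near_left1.
have q0 : 0 < (1 - alpha) / 2 by rewrite divr_gt0// subr_gt0.
have G0 := Gamma_gt0 q0.
rewrite /wt_p /wt_cst; move: G0; set G := Gamma _ => G0 /=.
by field; rewrite !gt_eqF// subr_gt0.
Unshelve. all: by end_near. Qed.

(** [wt_r] is [wt_p] times (1 - alpha) / 2 times a bracket that tends to 4. *)
Lemma cvg_wt_r : wt_r alpha @[alpha --> (1 : R)^'-] --> (0 : R).
Proof.
have ca : alpha @[alpha --> (1 : R)^'-] --> (1 : R).
  by apply: cvg_at_left_filter; exact: cvg_id.
have h : (wt_p alpha * ((1 - alpha) / 2 * (2 / (2 - alpha) + 2 / alpha)))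
    @[alpha --> (1 : R)^'-] --> (1 * (0 / 2 * (2 / (2 - 1) + 2 / 1)) : R).
  apply: cvgM; first exact: cvg_wt_p.
  apply: cvgM; first by apply: cvgM => //; exact: cvg_cst.
  apply: cvgD; (apply: cvgM; first exact: cvg_cst); apply: cvgV => //.
  by apply: cvgB => //; exact: cvg_cst.
rewrite mul0r mul0r mulr0 in h.
apply: cvg_trans h; apply: near_eq_cvg; near=> alpha.
have /andP[a0 a1] : 0 < alpha < 1 by near: alpha; exact: near_left1.
rewrite /wt_r /wt_p; field.
by rewrite !gt_eqF// subr_gt0// (lt_trans a1)// ltr1n.
Unshelve. all: by end_near. Qed.

End weight.

Section subordination.
Context (R : realType) (n : nat).
Notation mu := (@lebesgue_measure R).
Implicit Types (alpha u : R) (z : 'rV[R]_n).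

(** A Gamma integral of exponent p = (n + alpha + 1) / 2 at the rate |z|^2. The power in [wt] is the
    one whose product with u and u^(n/2) is u^(p-1); the factor 2 of 2 u turns 2^(alpha - 1) into
    the 2^alpha of [mu_frac]. *)
Lemma integral_wt_gam alpha z : 0 < alpha < 1 -> z != 0 ->
  (\int[mu]_u (wt alpha u * (2 * u * gam u z))%:E =
   (mu_frac n alpha / enorm z `^ (n%:R + alpha + 1))%:E)%E.
Proof.
move=> /andP[a0 a1] z0.
have e0 : 0 < enorm z by rewrite lt_neqAle enorm_ge0 andbT eq_sym; apply: contra z0 => /eqP/enorm_eq0 ->.
have r0 : 0 < dot z z by rewrite -enorm_sqr exprn_gt0.
set p := (n%:R + alpha + 1) / 2.
have p0 : 0 < p by rewrite divr_gt0// addr_gt0// ltr_wpDl.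
have pi0 : 0 < pi :> R by exact: pi_gt0.
pose k : R := 2 * wt_cst alpha * pi `^ (- (n%:R / 2)).
have k0 : 0 <= k by rewrite mulr_ge0 ?powR_ge0// mulr_ge0// ltW// wt_cst_gt0.
transitivity (\int[mu]_(u in `]0%R, +oo[) (k%:E * (u `^ (p - 1) * expR (- (u * dot z z)))%:E))%E.
  rewrite [RHS]integral_mkcond; apply: eq_integral => u _.
  rewrite patchE mem_setE in_itv/= andbT /wt; case: ifP => u0; last by rewrite mul0r.
  rewrite -EFinM; congr EFin; rewrite gamE /k.
  have -> : Num.sqrt (u / pi) ^+ n = u `^ (n%:R / 2) * pi `^ (- (n%:R / 2)) :> R.
    rewrite -powR12_sqrt ?divr_ge0 ?ltW//.
    rewrite -powR_mulrn ?powR_ge0// -powRrM mulrC powRM ?invr_ge0 ?ltW//.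
    rewrite [2^-1 * _]mulrC -[pi^-1]powR_inv1 ?(ltW pi0)// -powRrM mulN1r; exact: mulrC.
  have -> : u `^ (p - 1) = u `^ (- ((3 - alpha) / 2)) * u * u `^ (n%:R / 2).
    rewrite -[X in _ * X * _](powRr1 (ltW u0)) -!powRD ?(gt_eqF u0) ?implybT//.
    by congr (_ `^ _); rewrite /p; field.
  ring.
rewrite ge0_integralZl//=; last 2 first.
- apply/measurable_EFinP; apply: measurable_funTS; apply: measurable_funM.
    exact: measurable_powR.
  by apply: measurableT_comp => //; apply: measurableT_comp => //; exact: measurable_funM.
- by move=> u _; rewrite lee_fin mulr_ge0 ?powR_ge0 ?expR_ge0.
rewrite gamma_scale// -EFinM; congr EFin.
have -> : dot z z `^ (- p) = (enorm z `^ (n%:R + alpha + 1))^-1.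
  rewrite -enorm_sqr -powR_mulrn ?enorm_ge0// -powRrM -powRN; congr (_ `^ _).
  by rewrite /p; field.
rewrite /k /mu_frac /wt_cst -/p.
have -> : 2 `^ alpha = 2 * 2 `^ (alpha - 1) :> R.
  by rewrite -[X in X * _](@powRr1 _ 2)// -powRD ?pnatr_eq0 ?implybT// addrC subrK.
ring.
Qed.

End subordination.

(** * The fractional divergence *)

Section measurable_Rintegral.
Context d1 d2 (T1 : measurableType d1) (T2 : measurableType d2) (R : realType).
Variable m2 : {sigma_finite_measure set T2 -> \bar R}.

(** Tonelli handles the positive and negative parts separately, so integrals depending on a
    parameter are known to be measurable before any of them is known to converge. *)
Lemma measurable_Rintegral_snd (F : T1 * T2 -> R) : measurable_fun setT F ->
  measurable_fun setT (fun x => \int[m2]_y F (x, y)).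
Proof.
move=> mF; apply: measurableT_comp => //.
have mFE : measurable_fun setT (EFin \o F) by exact/measurable_EFinP.
rewrite (_ : (fun x => _) = (fun x => \int[m2]_y ((EFin \o F)^\+ (x, y)) -
    \int[m2]_y ((EFin \o F)^\- (x, y)))%E); last first.
  apply/funext => x; rewrite integralE; congr (_ - _)%E;
    by apply: eq_integral => y _; rewrite ?funeposE ?funenegE.
apply: emeasurable_funB; apply: measurable_fun_fubini_tonelli_F => //.
- exact: measurable_funepos.
- exact: measurable_funeneg.
Qed.

End measurable_Rintegral.

Lemma lip_c_bounds (R : realType) (n : nat) (phi : 'rV[R]_n -> 'rV[R]_n) :
  lip_c phi -> exists L K r : R, [/\ 0 <= L, 0 <= K,
    forall i, measurable_fun setT (fun x => phi x ord0 i),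
    forall x y, enorm (phi x - phi y) <= L * enorm (x - y) &
    (forall x, enorm (phi x) <= K) /\ (forall x, phi x != 0 -> `|x| <= r)].
Proof.
move=> lphi; have [K [r [mphi phiK phir]]] := lip_c_props lphi.
have [L [_ [L0 _ phiL _]]] := (lip_cP phi).1 lphi.
exists (n%:R * L), (n%:R * `|K|), r; split; rewrite ?mulr_ge0//.
  move=> x y; apply: le_trans (enorm_le_sum _) _.
  apply: (@le_trans _ _ (\sum_(i < n) L * enorm (x - y))); last first.
    by rewrite sumr_const card_ord -[leLHS]mulr_natl mulrA.
  apply: ler_sum => i _; rewrite !mxE; apply: le_trans (phiL i x y) _.
  by rewrite ler_wpM2l// norm_le_enorm.
split => // x; apply: le_trans (enorm_le_sum _) _.
apply: (@le_trans _ _ (\sum_(i < n) `|K|)); last first.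
  by rewrite sumr_const card_ord mulr_natl.
by apply: ler_sum => i _; exact: le_trans (phiK i x) (ler_norm _).
Qed.

Lemma lebesgue_cube_lty (R : realType) (n : nat) (r : R) :
  (lebesgue_rV R n (cube r) < +oo)%E.
Proof.
have mc := @measurable_cube R n.
apply: (@le_lt_trans _ _ (lebesgue_rV R n (cube `|r|))).
  apply: le_measure; rewrite ?inE// => x; rewrite /cube /= => /le_trans; apply; exact: ler_norm.
rewrite (_ : cube `|r| = [set x | forall i, x ord0 i \in
    `[(const_mx (- `|r|) : 'rV[R]_n) ord0 i, (const_mx `|r| : 'rV[R]_n) ord0 i]]).
  by rewrite lebesgue_rV_box ?ltry// => i; rewrite !mxE lerNl ge0_cp.
apply/seteqP; split=> x /= xr => [i|].
  by rewrite in_itv/= !mxE -ler_norml; exact: le_trans (rV_coord_le_norm _ _) xr.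
by apply: rV_norm_le => // i; have := xr i; rewrite in_itv/= !mxE -ler_norml.
Qed.

Section kernel.
Context (R : realType) (n : nat).
Notation mu := (lebesgue_rV R n).
Variables (phi : 'rV[R]_n -> 'rV[R]_n) (L K r : R).
Hypothesis L0 : 0 <= L.
Hypothesis K0 : 0 <= K.
Hypothesis mphi : forall i, measurable_fun setT (fun x => phi x ord0 i).
Hypothesis phiL : forall x y, enorm (phi x - phi y) <= L * enorm (x - y).
Hypothesis phiK : forall x, enorm (phi x) <= K.
Hypothesis phir : forall x, phi x != 0 -> `|x| <= r.

Implicit Types (u : R) (x y : 'rV[R]_n).

(* The Gaussian analogue of the integrand of div_frac: the phi x term integrates
   to 0 (qintE), it makes the integral over u against wt alpha converge. *)
Definition qker u (x y : 'rV[R]_n) : R :=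
  2 * u * gam u (y - x) * dot (y - x) (phi y - phi x).

(** For u >= 1 the Lipschitz bound on phi and the second Gaussian moment give 2 L Cg; for u < 1 the
    bound |phi y - phi x| <= 2 K and the first moment give 4 K Cg sqrt u. *)
Definition qbd u : R := wt_bd (2 * L * Cg R n) (4 * K * Cg R n) u.

Definition cubeI (x : 'rV[R]_n) : R := \1_(cube r) x.

Lemma qbd_ge0 u : 0 <= qbd u.
Proof. by rewrite wt_bd_ge0// !mulr_ge0 ?Cg_ge0. Qed.

Lemma cubeI_ge0 x : 0 <= cubeI x. Proof. by rewrite /cubeI indicE. Qed.

Lemma measurable_cubeI : measurable_fun setT cubeI.
Proof. by apply: measurable_indic; exact: measurable_cube. Qed.

Lemma phi_le_cubeI x : enorm (phi x) <= K * cubeI x.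
Proof.
have [->|/phir xr] := eqVneq (phi x) 0; first by rewrite enorm0 mulr_ge0 ?cubeI_ge0.
by rewrite /cubeI indicE mem_set// mulr1.
Qed.

Lemma qker_le u x y : 0 < u -> `|qker u x y| <= qbd u * gam (u / 2) (y - x).
Proof.
move=> u0; set z := y - x; have g0 := gam_ge0 u z; have e0 := enorm_ge0 z.
have g20 := gam_ge0 (u / 2) z; have C0 := Cg_ge0 R n.
have u20 : 0 <= 2 * u by rewrite mulr_ge0// ltW.
rewrite /qker -/z normrM (ger0_norm (mulr_ge0 u20 g0)).
apply: (@le_trans _ _ (2 * u * gam u z * (enorm z * enorm (phi y - phi x)))).
  by apply: ler_wpM2l; [rewrite mulr_ge0|exact: normr_dot_le].
rewrite /qbd /wt_bd; case: ifP => u1.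
  apply: (@le_trans _ _ (2 * L * Cg R n * gam (u / 2) z)); last first.
    by rewrite ler_wpM2r// lerDl divr_ge0// !mulr_ge0.
  have h := gam_moment2 z u0.
  apply: (@le_trans _ _ (2 * u * L * (enorm z ^+ 2 * gam u z))).
    rewrite (_ : 2 * u * L * _ = 2 * u * gam u z * (enorm z * (L * enorm z))); last by ring.
    by apply: ler_wpM2l; [rewrite mulr_ge0|apply: ler_wpM2l].
  apply: (@le_trans _ _ (2 * u * L * (Cg R n / u * gam (u / 2) z))).
    by rewrite ler_wpM2l// mulr_ge0.
  rewrite le_eqVlt; apply/orP; left; apply/eqP; field; exact: lt0r_neq0.
have h := gam_moment1 z u0.
have hK : enorm (phi y - phi x) <= 2 * K.
  apply: le_trans (enormD _ _) _; rewrite enormN.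
  by have := phiK x; have := phiK y; lra.
apply: (@le_trans _ _ (4 * u * K * (enorm z * gam u z))).
  rewrite (_ : 4 * u * K * _ = 2 * u * gam u z * (enorm z * (2 * K))); last by ring.
  by apply: ler_wpM2l; [rewrite mulr_ge0|apply: ler_wpM2l].
apply: (@le_trans _ _ (4 * u * K * (Cg R n / Num.sqrt u * gam (u / 2) z))).
  by rewrite ler_wpM2l// !mulr_ge0// ltW.
have s0 : 0 < Num.sqrt u by rewrite sqrtr_gt0.
rewrite le_eqVlt; apply/orP; left; apply/eqP.
transitivity (4 * K * Cg R n * (u / Num.sqrt u) * gam (u / 2) z); first by ring.
congr (_ * _ * _); apply: (mulIf (lt0r_neq0 s0)).
by rewrite divfK ?gt_eqF// -expr2 sqr_sqrtr// ltW.
Qed.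

(** [qker] vanishes unless x or y lies in the support of phi. This adds to [qker_le] the decay
    needed to integrate over both variables. *)
Lemma qker_le_cubeI u x y : 0 < u ->
  `|qker u x y| <= qbd u * (gam (u / 2) (y - x) * (cubeI x + cubeI y)).
Proof.
move=> u0; have [px|px] := eqVneq (phi x) 0; last first.
  rewrite mulrA; apply: le_trans (qker_le x y u0) _; rewrite ler_peMr ?mulr_ge0 ?gam_ge0 ?qbd_ge0//.
  by rewrite {1}/cubeI indicE mem_set ?lerDl ?cubeI_ge0//; exact: phir.
have [py|py] := eqVneq (phi y) 0; last first.
  rewrite mulrA; apply: le_trans (qker_le x y u0) _; rewrite ler_peMr ?mulr_ge0 ?gam_ge0 ?qbd_ge0//.
  by rewrite {2}/cubeI indicE mem_set ?lerDr ?cubeI_ge0//; exact: phir.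
rewrite /qker px py subrr dot0r mulr0 normr0.
by rewrite !mulr_ge0 ?qbd_ge0 ?gam_ge0 ?addr_ge0 ?cubeI_ge0.
Qed.

Lemma measurable_qker d (T : measurableType d) (U : T -> R) (X Y : T -> 'rV[R]_n) :
  measurable_fun setT U -> measurable_fun setT X -> measurable_fun setT Y ->
  measurable_fun setT (fun t => qker (U t) (X t) (Y t)).
Proof.
move=> mU mX mY.
have c (Z : T -> 'rV[R]_n) i : measurable_fun setT Z -> measurable_fun setT (fun t => Z t ord0 i).
  by move=> mZ; exact: (measurableT_comp (measurable_coord_rV i) mZ).
have cp (Z : T -> 'rV[R]_n) i : measurable_fun setT Z -> measurable_fun setT (fun t => phi (Z t) ord0 i).
  by move=> mZ; exact: (measurableT_comp (mphi i) mZ).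
apply: measurable_funM.
  apply: measurable_funM; first exact: measurable_funM.
  by apply: measurable_gam => // i; apply: measurable_coordB => j; exact: c.
by apply: measurable_dot => i; apply: measurable_coordB => j; solve [exact: c|exact: cp].
Qed.

Lemma measurable_qker_y u x : measurable_fun setT (qker u x).
Proof. by apply: measurable_qker => //; exact: measurable_id. Qed.

Lemma qker_integrable u x : 0 < u -> mu.-integrable setT (EFin \o qker u x).
Proof.
move=> u0; have u20 : 0 < u / 2 by rewrite divr_gt0.
have := integrableZl measurableT (qbd u) (integrable_gam x u20).
apply: le_integrable => //; first by apply/measurable_EFinP; exact: measurable_qker_y.
move=> y _; rewrite /= lee_fin; apply: le_trans (qker_le x y u0) _; exact: ler_norm.
Qed.

Definition qint u x : R := \int[mu]_y qker u x y.

Lemma measurable_qint d (T : measurableType d) (U : T -> R) (X : T -> 'rV[R]_n) :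
  measurable_fun setT U -> measurable_fun setT X ->
  measurable_fun setT (fun t => qint (U t) (X t)).
Proof.
move=> mU mX.
apply: (@measurable_Rintegral_snd _ _ _ _ _ _ (fun t : T * 'rV[R]_n => qker (U t.1) (X t.1) t.2)).
apply: measurable_qker => //; first exact: (measurableT_comp mU measurable_fst).
exact: (measurableT_comp mX measurable_fst).
Qed.

Lemma integral_qker_le u x : 0 < u -> (\int[mu]_y (`|qker u x y|)%:E <= (qbd u)%:E)%E.
Proof.
move=> u0; have u20 : 0 < u / 2 by rewrite divr_gt0.
have mg : measurable_fun setT (fun y : 'rV[R]_n => (gam (u / 2) (y - x))%:E).
  by apply/measurable_EFinP; exact: measurable_gamB.
apply: (@le_trans _ _ (\int[mu]_y ((qbd u)%:E * (gam (u / 2) (y - x))%:E))%E).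
  apply: ge0_le_integral => //.
  - by apply/measurable_EFinP; apply: measurableT_comp => //; exact: measurable_qker_y.
  - exact: emeasurable_funM.
  - by move=> y _; rewrite -EFinM lee_fin qker_le.
rewrite ge0_integralZl ?lee_fin ?qbd_ge0//; last by move=> y _; rewrite lee_fin gam_ge0.
by rewrite integral_gam// mule1.
Qed.

Lemma qint_le u x : 0 < u -> `|qint u x| <= qbd u.
Proof.
move=> u0; have iq := qker_integrable x u0.
apply: le_trans (le_normr_Rintegral measurableT iq) _.
rewrite -lee_fin /Rintegral fineK; first exact: integral_qker_le.
by apply: integrable_fin_num => //; exact: integrable_norm iq.
Qed.

(** By Tonelli, each of the two indicators of [qker_le_cubeI] contributes the volume of the cube,
    hence the factor 2. *)
Lemma integral_qint_le u : 0 < u ->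
  (\int[mu]_x (`|qint u x|)%:E <= (qbd u * (2 * fine (mu (cube r))))%:E)%E.
Proof.
move=> u0; have u20 : 0 < u / 2 by rewrite divr_gt0.
have cfin : mu (cube r) \is a fin_num.
  by rewrite ge0_fin_numE//; exact: lebesgue_cube_lty.
have mI := measurable_cubeI.
pose F1 (z : 'rV[R]_n * 'rV[R]_n) : \bar R := (gam (u / 2) (z.2 - z.1) * cubeI z.1)%:E.
pose F2 (z : 'rV[R]_n * 'rV[R]_n) : \bar R := (gam (u / 2) (z.2 - z.1) * cubeI z.2)%:E.
have mg2 : measurable_fun setT (fun z : 'rV[R]_n * 'rV[R]_n => gam (u / 2) (z.2 - z.1)).
  apply: measurable_gam => // i; apply: measurable_coordB => // j.
    exact: (measurableT_comp (measurable_coord_rV j) measurable_snd).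
  exact: (measurableT_comp (measurable_coord_rV j) measurable_fst).
have mF1 : measurable_fun setT F1.
  apply/measurable_EFinP; apply: measurable_funM => //.
  exact: (measurableT_comp mI measurable_fst).
have mF2 : measurable_fun setT F2.
  apply/measurable_EFinP; apply: measurable_funM => //.
  exact: (measurableT_comp mI measurable_snd).
have F10 z : (0 <= F1 z)%E by rewrite lee_fin mulr_ge0 ?gam_ge0 ?cubeI_ge0.
have F20 z : (0 <= F2 z)%E by rewrite lee_fin mulr_ge0 ?gam_ge0 ?cubeI_ge0.
have iI : (\int[mu]_x (cubeI x)%:E = mu (cube r))%E.
  by rewrite /cubeI integral_indic ?setIT//; exact: measurable_cube.
have m1 := measurable_fun_fubini_tonelli_F (m2 := mu) F1 mF1 F10.
have m2 := measurable_fun_fubini_tonelli_F (m2 := mu) F2 mF2 F20.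
have I1 : (\int[mu]_x \int[mu]_y F1 (x, y) = mu (cube r))%E.
  rewrite -iI; apply: eq_integral => x _; rewrite /F1 /=.
  under eq_integral do rewrite EFinM.
  rewrite ge0_integralZr//=; last 3 first.
  - by apply/measurable_EFinP; exact: measurable_gamB.
  - by move=> y _; rewrite lee_fin gam_ge0.
  - by rewrite lee_fin cubeI_ge0.
  by rewrite integral_gam// mul1e.
have I2 : (\int[mu]_x \int[mu]_y F2 (x, y) = mu (cube r))%E.
  have := fubini_tonelli (m1 := mu) (m2 := mu) F2 mF2 F20; rewrite /fubini_F /fubini_G => ->.
  rewrite -iI; apply: eq_integral => y _; rewrite /F2 /=.
  under eq_integral do rewrite EFinM.
  have mgy : measurable_fun setT (fun x : 'rV[R]_n => (gam (u / 2) (y - x))%:E).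
    apply/measurable_EFinP; rewrite (_ : (fun x => _) = (fun x => gam (u / 2) (x - y))).
      exact: measurable_gamB.
    by apply/funext => x; rewrite gamC.
  rewrite ge0_integralZr//=; last 2 first.
  - by move=> x _; rewrite lee_fin gam_ge0.
  - by rewrite lee_fin cubeI_ge0.
  by rewrite integral_gamC// mul1e.
have mq : measurable_fun setT (fun x => qint u x) by exact: measurable_qint.
apply: (@le_trans _ _ (\int[mu]_x ((qbd u)%:E * (\int[mu]_y F1 (x, y) + \int[mu]_y F2 (x, y))))%E).
  apply: ge0_le_integral => //.
  - by apply/measurable_EFinP; exact: measurableT_comp.
  - by apply: emeasurable_funM => //; exact: emeasurable_funD.
  move=> x _.
  have mF1x : measurable_fun setT (fun y => F1 (x, y)) by exact: measurableT_comp.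
  have mF2x : measurable_fun setT (fun y => F2 (x, y)) by exact: measurableT_comp.
  apply: (@le_trans _ _ (\int[mu]_y (`|qker u x y|)%:E)%E).
    have iq := qker_integrable x u0.
    apply: le_trans (_ : (\int[mu]_y `|qker u x y|)%:E <= _)%E.
      by rewrite lee_fin; exact: le_normr_Rintegral.
    rewrite /Rintegral fineK//; apply: integrable_fin_num => //; exact: integrable_norm iq.
  rewrite -ge0_integralD// -ge0_integralZl ?lee_fin ?qbd_ge0//; last 2 first.
  - exact: emeasurable_funD.
  - by move=> y _; rewrite adde_ge0.
  apply: ge0_le_integral => //.
  - by apply/measurable_EFinP; apply: measurableT_comp => //; exact: measurable_qker_y.
  - by apply: emeasurable_funM => //; exact: emeasurable_funD.
  by move=> y _; rewrite /F1 /F2 -EFinD -EFinM lee_fin -mulrDr /=; exact: qker_le_cubeI.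
have P1 x : (0 <= \int[mu]_y F1 (x, y))%E by exact: integral_ge0.
have P2 x : (0 <= \int[mu]_y F2 (x, y))%E by exact: integral_ge0.
rewrite ge0_integralZl ?lee_fin ?qbd_ge0//; last 2 first.
- exact: emeasurable_funD.
- by move=> x _; rewrite adde_ge0.
rewrite ge0_integralD// I1 I2 EFinM -[X in (_ * (X + _))%E](fineK cfin) -[X in (_ * (_ + X))%E](fineK cfin).
by rewrite -EFinD mulr_natl mulr2n.
Qed.

End kernel.

Lemma Rintegral_eq0 d (T : measurableType d) (R : realType)
    (mu : {measure set T -> \bar R}) (D : set T) (f : T -> R) :
  (forall x, f x = 0) -> \int[mu]_(x in D) f x = 0.
Proof.
move=> f0; rewrite /Rintegral (eq_integral (cst 0%E)) ?integral0// => x _.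
by rewrite f0.
Qed.

Section key.
Context (R : realType) (n : nat).
Notation mu := (lebesgue_rV R n).
Notation leb := (@lebesgue_measure R).
Implicit Types (u : R) (x y : 'rV[R]_n).
Variables (phi : 'rV[R]_n -> 'rV[R]_n) (L K r : R).
Hypothesis L0 : 0 <= L.
Hypothesis K0 : 0 <= K.
Hypothesis mphi : forall i, measurable_fun setT (fun x => phi x ord0 i).
Hypothesis phiL : forall x y, enorm (phi x - phi y) <= L * enorm (x - y).
Hypothesis phiK : forall x, enorm (phi x) <= K.
Hypothesis phir : forall x, phi x != 0 -> `|x| <= r.

Lemma mu_frac_gt0 (alpha : R) : 0 < alpha < 1 -> 0 < mu_frac n alpha.
Proof.
move=> /andP[a0 a1]; have pi0 := pi_gt0 R.
rewrite /mu_frac divr_gt0 ?Gamma_gt0 ?mulr_gt0 ?powR_gt0 ?Gamma_gt0//.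
- by rewrite divr_gt0// addr_gt0// ltr_wpDl.
- by rewrite subr_gt0.
Qed.

(** Fubini in (u, y), licensed by the bound [qbd] and its finite integral against [wt alpha]; the
    inner integral over u is [integral_wt_gam]. *)
Lemma div_frac_subordination alpha x : 0 < alpha < 1 ->
  div_frac alpha phi x = \int[leb]_u (wt alpha u * qint phi u x).
Proof.
move=> aa; have /andP[a0 a1] := aa; have mf0 := mu_frac_gt0 aa.
pose F (z : measurableTypeR R * 'rV[R]_n) : R := wt alpha z.1 * qker phi z.1 x z.2.
have mF : measurable_fun setT F.
  apply: measurable_funM; first exact: (measurableT_comp (measurable_wt alpha) measurable_fst).
  exact: (measurable_qker mphi).
have iF : (leb \x mu)%E.-integrable setT (EFin \o F).
  apply/integrable12ltyP; first exact/measurable_EFinP.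
  apply: (@le_lt_trans _ _ (\int[leb]_u (wt alpha u * qbd n L K u)%:E)%E); last first.
    apply: le_lt_trans (integral_wt_bd aa _ _) _; rewrite ?ltry// !mulr_ge0 ?Cg_ge0//.
  apply: ge0_le_integral => //.
  - by move=> u _; exact: integral_ge0.
  - apply: (measurable_fun_fubini_tonelli_F (abse \o (EFin \o F))) => [|z]; last exact: abse_ge0.
    by apply: measurableT_comp => //; exact/measurable_EFinP.
  - apply/measurable_EFinP; apply: measurable_funM; first exact: measurable_wt.
    exact: measurable_wt_bd.
  move=> u _; case: (ltP 0 u) => u0; last first.
    by rewrite integral0_eq ?lee_fin ?mulr_ge0 ?wt_ge0 ?qbd_ge0// => y _; rewrite /F /= /wt ltNge u0 /= mul0r normr0.
  have mq : measurable_fun setT (fun y => (`|qker phi u x y|)%:E).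
    by apply/measurable_EFinP; apply: measurableT_comp => //; exact: (measurable_qker_y mphi).
  under eq_integral do rewrite /F /= normrM (ger0_norm (wt_ge0 u a1)) EFinM.
  rewrite ge0_integralZl ?lee_fin ?wt_ge0//.
  by rewrite EFinM lee_wpmul2l ?lee_fin ?wt_ge0//; exact: (integral_qker_le L0 K0 mphi phiL phiK x u0).
transitivity (\int[leb]_u \int[mu]_y F (u, y)); last first.
  apply: eq_Rintegral => u _; case: (ltP 0 u) => u0.
    by rewrite /F /= RintegralZl//; exact: (qker_integrable L0 K0 mphi phiL phiK x u0).
  rewrite Rintegral_eq0; first by rewrite /wt ltNge u0 mul0r.
  by move=> y; rewrite /F /= /wt ltNge u0 /= mul0r.
rewrite -(Rfubini1 iF) (Rfubini2 iF) /div_frac.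
pose k y : R := dot (y - x) (phi y - phi x) / enorm (y - x) `^ (n%:R + alpha + 1).
have FE y : \int[leb]_u F (u, y) = mu_frac n alpha * k y.
  (* On the diagonal both sides vanish; elsewhere y - x is nonzero, as the subordination formula
     requires. *)
  have [->|yx] := eqVneq y x.
    rewrite /k subrr dotC dot0r mul0r mulr0 Rintegral_eq0// => u.
    by rewrite /F /qker /= !subrr dot0r !mulr0.
  have yx0 : y - x != 0 by rewrite subr_eq0.
  have h := integral_wt_gam aa yx0.
  rewrite (_ : (fun u => _) = fun u => (wt alpha u * (2 * u * gam u (y - x))) * dot (y - x) (phi y - phi x)); last first.
    by apply/funext => u; rewrite /F /qker /=; ring.
  have ig : leb.-integrable setT (EFin \o (fun u => wt alpha u * (2 * u * gam u (y - x)))).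
    have mg : measurable_fun setT (fun u => wt alpha u * (2 * u * gam u (y - x))).
      apply: measurable_funM; first exact: measurable_wt.
      by apply: measurable_funM; [exact: measurable_funM|exact: measurable_gam].
    apply/integrableP; split; first exact/measurable_EFinP.
    have : (\int[leb]_u (wt alpha u * (2 * u * gam u (y - x)))%:E < +oo)%E by rewrite h ltry.
    congr (_ < _)%E.
    apply: eq_integral => u _ /=; rewrite ger0_norm//; case: (ltP 0 u) => u0.
      by rewrite mulr_ge0 ?wt_ge0// mulr_ge0 ?gam_ge0// mulr_ge0// ltW.
    by rewrite /wt ltNge u0 mul0r.
  rewrite RintegralZr// /Rintegral h /=; rewrite /k; ring.
(* The singular kernel is integrable as a multiple of an inner integral in Fubini's theorem, without
   any estimate near y = x. *)
have ik : mu.-integrable setT (EFin \o k).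
  have := integrableZl measurableT (mu_frac n alpha)^-1 (integrable_Rfubini2 iF).
  apply: eq_integrable => // y _ /=; rewrite FE -EFinM mulrA mulVf ?mul1r//.
  exact: lt0r_neq0.
by rewrite -RintegralZl//; apply: eq_Rintegral => y _; rewrite FE.
Qed.

Variables (f : 'rV[R]_n -> R) (M : R).
Hypothesis ft : tame f M.
Variables (nu : radon R n) (m : {finite_measure set 'rV[R]_n -> \bar R})
  (sg : 'rV[R]_n -> 'rV[R]_n).
Hypothesis msg : forall i, measurable_fun setT (fun x => sg x ord0 i).
Hypothesis sg1 : forall x, dot (sg x) (sg x) = 1.
Hypothesis pairing : forall (phi : 'rV[R]_n -> 'rV[R]_n) M r,
  (forall i, measurable_fun setT (fun x => phi x ord0 i)) ->
  (forall i x, `|phi x ord0 i| <= M) -> (forall x, phi x != 0 -> `|x| <= r) ->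
  radon_pairing nu phi = \int[m]_x dot (phi x) (sg x).
Hypothesis gradf : is_grad f nu.

(* The function a(u) of the header. *)
Definition heat_pairing u : R :=
  \int[m]_x \int[mu]_y (gam u (x - y) * dot (phi y) (sg x)).

(** Once phi x is removed, x enters through the gradient of the Gaussian alone, so for fixed y the
    integral against f is one that [gauss_ibp] evaluates. *)
Lemma qintE u x : 0 < u ->
  qint phi u x = \int[mu]_y (2 * u * gam u (y - x) * dot (y - x) (phi y)).
Proof.
move=> u0; have mG := measurable_qker_y mphi u x.
have iq : mu.-integrable setT (EFin \o qker phi u x) by exact: (qker_integrable L0 K0 mphi phiL phiK x u0).
pose G2 y : R := 2 * u * gam u (y - x) * dot (y - x) (phi x).
have iG i : mu.-integrable setT (EFin \o (fun y => 2 * u * phi x ord0 i * ((y - x) ord0 i * gam u (y - x)))).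
  rewrite (_ : _ \o _ = (fun y => (2 * u * phi x ord0 i)%:E * ((y - x) ord0 i * gam u (y - x))%:E)%E).
    by apply: integrableZl => //; exact: integrable_gam_coord.
  by apply/funext => y /=; rewrite EFinM.
have G2E : G2 = (fun y => \sum_i 2 * u * phi x ord0 i * ((y - x) ord0 i * gam u (y - x))).
  apply/funext => y; rewrite /G2 /dot mulr_sumr; apply: eq_bigr => i _; ring.
have iG2 : mu.-integrable setT (EFin \o G2).
  rewrite G2E (_ : _ \o _ = (fun y => \sum_i (2 * u * phi x ord0 i * ((y - x) ord0 i * gam u (y - x)))%:E)%E).
    by apply: integrable_sum => // i _; exact: iG.
  by apply/funext => y /=; rewrite sumEFin.
have G20 : \int[mu]_y G2 y = 0.
  rewrite G2E Rintegral_sum// big1// => i _; rewrite RintegralZl//.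
    by rewrite Rintegral_gam_coord// mulr0.
  exact: integrable_gam_coord.
transitivity (\int[mu]_y (qker phi u x y + G2 y)).
  by rewrite RintegralD// G20 addr0.
apply: eq_Rintegral => y _.
by rewrite /qker /G2 dotBr; ring.
Qed.

Lemma tame_moment_le u y : 0 < u ->
  (\int[mu]_x (`|f x| * (enorm (x - y) * gam u (x - y)))%:E <=
   (M * (Cg R n / Num.sqrt u * Num.max 1 (Num.sqrt (u / 2) ^+ n)))%:E)%E.
Proof.
move=> u0; have u20 : 0 < u / 2 by rewrite divr_gt0.
have C0 : 0 <= Cg R n / Num.sqrt u by rewrite divr_ge0 ?Cg_ge0.
have mz i : measurable_fun setT (fun x : 'rV[R]_n => (x - y) ord0 i).
  by apply: measurable_coordB => // j; exact: measurable_coord_rV.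
have [_ _] := ft; apply.
- by move=> x; rewrite mulr_ge0 ?enorm_ge0 ?gam_ge0.
- apply: measurable_funM; last exact: measurable_gamB.
  exact: measurable_enorm.
- move=> x; apply: le_trans (gam_moment1 _ u0) _; rewrite ler_wpM2l//.
  by rewrite le_max gam_le ?orbT.
apply: le_trans (integral_moment1 y u0) _; rewrite lee_fin.
by rewrite ler_peMr// le_max lexx.
Qed.

Let sg_norm x : enorm (sg x) = 1.
Proof. by rewrite /enorm sg1 sqrtr1. Qed.

Let mfst (i : 'I_n) : measurable_fun setT (fun z : 'rV[R]_n * 'rV[R]_n => z.1 ord0 i).
Proof. exact: (measurableT_comp (measurable_coord_rV i) measurable_fst). Qed.

Let msnd (i : 'I_n) : measurable_fun setT (fun z : 'rV[R]_n * 'rV[R]_n => z.2 ord0 i).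
Proof. exact: (measurableT_comp (measurable_coord_rV i) measurable_snd). Qed.

Let mgz u : measurable_fun setT (fun z : 'rV[R]_n * 'rV[R]_n => gam u (z.1 - z.2)).
Proof. by apply: measurable_gam => // i; exact: measurable_coordB. Qed.

Let mphi2 (i : 'I_n) : measurable_fun setT (fun z : 'rV[R]_n * 'rV[R]_n => phi z.2 ord0 i).
Proof. exact: (measurableT_comp (mphi i) measurable_snd). Qed.

Lemma heat_integrable u : 0 < u ->
  (m \x mu)%E.-integrable setT (EFin \o (fun z => gam u (z.1 - z.2) * dot (phi z.2) (sg z.1))).
Proof.
move=> u0.
have mF : measurable_fun setT (fun z : 'rV[R]_n * 'rV[R]_n => gam u (z.1 - z.2) * dot (phi z.2) (sg z.1)).
  apply: measurable_funM => //; apply: measurable_dot => // i.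
  exact: (measurableT_comp (msg i) measurable_fst).
apply/integrable12ltyP; first exact/measurable_EFinP.
apply: (@le_lt_trans _ _ (\int[m]_x (cst K%:E) x)%E); last first.
  by rewrite integral_cst// lte_mul_pinfty//; exact: fin_num_fun_lty.
apply: ge0_le_integral => //.
- by move=> x _; exact: integral_ge0.
- pose F := EFin \o (fun z : 'rV[R]_n * 'rV[R]_n => gam u (z.1 - z.2) * dot (phi z.2) (sg z.1)).
  apply: (measurable_fun_fubini_tonelli_F (abse \o F)) => [|z]; last exact: abse_ge0.
  by apply: measurableT_comp => //; exact/measurable_EFinP.
move=> x _.
have mg : measurable_fun setT (fun y : 'rV[R]_n => (gam u (y - x))%:E).
  by apply/measurable_EFinP; exact: measurable_gamB.
apply: (@le_trans _ _ (\int[mu]_y (K%:E * (gam u (y - x))%:E))%E); last first.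
  rewrite ge0_integralZl ?lee_fin//; last by move=> y _; rewrite lee_fin gam_ge0.
  by rewrite integral_gam// mule1.
apply: ge0_le_integral => //.
- apply/measurable_EFinP; apply: measurableT_comp => //.
  exact: (measurableT_comp mF (measurable_pair1 x)).
- exact: emeasurable_funM.
move=> y _; rewrite -EFinM lee_fin /= normrM (ger0_norm (gam_ge0 _ _)) gamC mulrC.
rewrite ler_wpM2r ?gam_ge0//; apply: le_trans (normr_dot_le _ _) _.
by rewrite sg_norm mulr1.
Qed.

(** After Fubini, the integral over x for fixed y is a combination of Gaussian integrations by parts
    with coefficients the coordinates of phi y; the bounded support of phi supplies integrability in
    y. *)
Lemma Rintegral_qint u : 0 < u ->
  \int[mu]_x (f x * qint phi u x) = - heat_pairing u.
Proof.
move=> u0; have [M0 mf _] := ft.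
pose F (z : 'rV[R]_n * 'rV[R]_n) : R :=
  f z.1 * (2 * u * gam u (z.1 - z.2) * dot (z.2 - z.1) (phi z.2)).
have mF : measurable_fun setT F.
  apply: measurable_funM; first exact: (measurableT_comp mf measurable_fst).
  by apply: measurable_funM; [exact: measurable_funM|apply: measurable_dot => // i; exact: measurable_coordB].
set c := M * (Cg R n / Num.sqrt u * Num.max 1 (Num.sqrt (u / 2) ^+ n)).
have iF : (mu \x mu)%E.-integrable setT (EFin \o F).
  apply/integrable21ltyP; first exact/measurable_EFinP.
  have mI : measurable_fun setT (fun y => (cubeI r y)%:E).
    by apply/measurable_EFinP; exact: measurable_cubeI.
  apply: (@le_lt_trans _ _ (\int[mu]_y ((2 * u * K * c)%:E * (cubeI r y)%:E))%E); last first.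
    rewrite ge0_integralZl ?lee_fin ?mulr_ge0 ?(ltW u0)//; last by move=> y _; rewrite lee_fin.
    rewrite /cubeI integral_indic ?setIT//; last exact: measurable_cube.
    by rewrite lte_mul_pinfty ?lee_fin ?mulr_ge0 ?(ltW u0)//; exact: lebesgue_cube_lty.
  apply: ge0_le_integral => //.
  - by move=> y _; exact: integral_ge0.
  - apply: (measurable_fun_fubini_tonelli_G (abse \o (EFin \o F))) => [|z]; last exact: abse_ge0.
    by apply: measurableT_comp => //; exact/measurable_EFinP.
  - exact: emeasurable_funM.
  move=> y _.
  have mz i : measurable_fun setT (fun x : 'rV[R]_n => (x - y) ord0 i).
    by apply: measurable_coordB => // j; exact: measurable_coord_rV.
  have mg : measurable_fun setT (fun x : 'rV[R]_n => (`|f x| * (enorm (x - y) * gam u (x - y)))%:E).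
    apply/measurable_EFinP; apply: measurable_funM; first exact: measurableT_comp.
    by apply: measurable_funM; [exact: measurable_enorm|exact: measurable_gamB].
  apply: (@le_trans _ _ (\int[mu]_x ((2 * u * K * cubeI r y)%:E * (`|f x| * (enorm (x - y) * gam u (x - y)))%:E))%E).
    apply: ge0_le_integral => //.
    - apply/measurable_EFinP; apply: measurableT_comp => //.
      exact: (measurableT_comp mF (measurable_pair2 y)).
    - exact: emeasurable_funM.
    move=> x _; rewrite -EFinM lee_fin /F /= normrM mulrCA ler_wpM2l//.
    have g0 := gam_ge0 u (x - y); have e0 := enorm_ge0 (x - y).
    have u20 : 0 <= 2 * u by rewrite mulr_ge0// ltW.
    rewrite normrM (ger0_norm (mulr_ge0 u20 g0)).
    apply: (@le_trans _ _ (2 * u * gam u (x - y) * (enorm (x - y) * (K * cubeI r y)))); last first.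
      by rewrite le_eqVlt; apply/orP; left; apply/eqP; ring.
    apply: ler_wpM2l; first exact: mulr_ge0.
    apply: le_trans (normr_dot_le _ _) _; rewrite -(enormN (x - y)) opprB.
    by apply: ler_wpM2l; [exact: enorm_ge0|exact: (phi_le_cubeI K0 phiK phir)].
  rewrite ge0_integralZl ?lee_fin ?mulr_ge0 ?(ltW u0)//; last first.
    by move=> x _; rewrite lee_fin !mulr_ge0 ?enorm_ge0 ?gam_ge0.
  apply: (@le_trans _ _ ((2 * u * K * cubeI r y)%:E * c%:E)%E).
    by apply: lee_wpmul2l; [rewrite lee_fin !mulr_ge0 ?(ltW u0)|exact: tame_moment_le].
  by rewrite -!EFinM lee_fin mulrAC.
pose G2 x y : R := 2 * u * gam u (y - x) * dot (y - x) (phi y).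
have iG2 x : mu.-integrable setT (EFin \o G2 x).
  have mG2 : measurable_fun setT (G2 x).
    apply: measurable_funM; first by apply: measurable_funM => //; exact: measurable_gamB.
    by apply: measurable_dot => // i; apply: measurable_coordB => // j; exact: measurable_coord_rV.
  have u20 : 0 < u / 2 by rewrite divr_gt0.
  have := integrableZl measurableT (2 * u * (Cg R n / Num.sqrt u) * K) (integrable_gam x u20).
  apply: le_integrable => //; first exact/measurable_EFinP.
  move=> y _; rewrite /= lee_fin; apply: le_trans (ler_norm _).
  have g0 := gam_ge0 u (y - x); have e0 := enorm_ge0 (y - x).
  have u2 : 0 <= 2 * u by rewrite mulr_ge0// ltW.
  rewrite /G2 normrM (ger0_norm (mulr_ge0 u2 g0)).
  apply: (@le_trans _ _ (2 * u * K * (enorm (y - x) * gam u (y - x)))).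
    rewrite (_ : 2 * u * K * _ = 2 * u * gam u (y - x) * (enorm (y - x) * K)); last by ring.
    apply: ler_wpM2l; first exact: mulr_ge0.
    by apply: le_trans (normr_dot_le _ _) _; exact: ler_wpM2l.
  apply: (@le_trans _ _ (2 * u * K * (Cg R n / Num.sqrt u * gam (u / 2) (y - x)))).
    by apply: ler_wpM2l; [exact: mulr_ge0|exact: gam_moment1].
  by rewrite le_eqVlt; apply/orP; left; apply/eqP; ring.
transitivity (\int[mu]_x \int[mu]_y F (x, y)).
  apply: eq_Rintegral => x _; rewrite (qintE x u0).
  rewrite -(RintegralZl (f x) measurableT (iG2 x)).
  by apply: eq_Rintegral => y _; rewrite /F /G2 (gamC _ x y).
rewrite -(Rfubini1 iF) (Rfubini2 iF).
have iH := heat_integrable u0.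
rewrite /heat_pairing -(Rfubini1 iH) (Rfubini2 iH).
rewrite -mulN1r -RintegralZl//; last exact: integrable_Rfubini2 iH.
apply: eq_Rintegral => y _ /=.
transitivity (\sum_i phi y ord0 i * \int[mu]_x (f x * (2 * u * (y - x) ord0 i * gam u (x - y)))).
  transitivity (\sum_i \int[mu]_x (phi y ord0 i * (f x * (2 * u * (y - x) ord0 i * gam u (x - y))))); last first.
    by apply: eq_bigr => i _; rewrite RintegralZl//; exact: (tame_integrable_coord ft).
  rewrite -Rintegral_sum//; last first.
    move=> i; rewrite (_ : _ \o _ = (fun x => (phi y ord0 i)%:E * (f x * (2 * u * (y - x) ord0 i * gam u (x - y)))%:E)%E).
      by apply: integrableZl => //; exact: (tame_integrable_coord ft).
    by apply/funext => x /=; rewrite EFinM.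
  apply: eq_Rintegral => x _; rewrite /F /= /dot !mulr_sumr; apply: eq_bigr => i _; ring.
have moo : (m setT < +oo)%E by exact: fin_num_fun_lty.
rewrite (eq_bigr (fun i => - \int[m]_x (phi y ord0 i * (gam u (x - y) * sg x ord0 i)))); last first.
  move=> i _; rewrite (gauss_ibp ft msg sg1 moo pairing gradf y i u0) mulrN RintegralZl//.
  exact: (integrable_gam_sg msg sg1 moo).
rewrite sumrN mulN1r; congr (- _); rewrite -Rintegral_sum//; last first.
  move=> i; rewrite (_ : _ \o _ = (fun x => (phi y ord0 i)%:E * (gam u (x - y) * sg x ord0 i)%:E)%E).
    by apply: integrableZl => //; exact: (integrable_gam_sg msg sg1 moo).
  by apply/funext => x /=; rewrite EFinM.
apply: eq_Rintegral => x _; rewrite /dot mulr_sumr; apply: eq_bigr => i _; ring.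
Qed.

(** Obtained on the side of f: by [Rintegral_qint] the pairing is minus the integral of f against
    [qint phi u], whose supremum and L^1 norm are both of order [qbd u]. *)
Lemma heat_pairing_le u : 0 < u ->
  `|heat_pairing u| <= M * (qbd n L K u * Num.max 1 (2 * fine (mu (cube r)))).
Proof.
move=> u0; have [M0 mf ftM] := ft.
have mq : measurable_fun setT (fun x => qint phi u x) by exact: (measurable_qint mphi).
have mqn : measurable_fun setT (fun x => `|qint phi u x|) by exact: measurableT_comp.
have q0 := qbd_ge0 n L0 K0 u.
rewrite -normrN -(Rintegral_qint u0).
have h1 x : `|qint phi u x| <= qbd n L K u * Num.max 1 (2 * fine (mu (cube r))).
  apply: le_trans (qint_le L0 K0 mphi phiL phiK x u0) _.
  by rewrite ler_peMr// le_max lexx.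
have h2 : (\int[mu]_x (`|qint phi u x|)%:E <= (qbd n L K u * Num.max 1 (2 * fine (mu (cube r))))%:E)%E.
  apply: le_trans (integral_qint_le L0 K0 mphi phiL phiK phir u0) _.
  by rewrite lee_fin ler_wpM2l// le_max lexx orbT.
have ii := tame_integrable ft mq h1 h2.
apply: le_trans (le_normr_Rintegral measurableT ii) _.
rewrite -lee_fin /Rintegral fineK; last by apply: integrable_fin_num => //; exact: integrable_norm ii.
by under eq_integral do rewrite normrM; exact: ftM.
Qed.

Lemma measurable_heat_pairing : measurable_fun setT heat_pairing.
Proof.
apply: (@measurable_Rintegral_snd _ _ _ _ _ m (fun z : measurableTypeR R * 'rV[R]_n =>
  \int[mu]_y (gam z.1 (z.2 - y) * dot (phi y) (sg z.2)))).
apply: (@measurable_Rintegral_snd _ _ _ _ _ mu (fun z : (measurableTypeR R * 'rV[R]_n) * 'rV[R]_n =>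
  gam z.1.1 (z.1.2 - z.2) * dot (phi z.2) (sg z.1.2))).
have m12 : measurable_fun setT (fun z : (measurableTypeR R * 'rV[R]_n) * 'rV[R]_n => z.1.2).
  exact: (measurableT_comp measurable_snd measurable_fst).
apply: measurable_funM.
  apply: measurable_gam; first exact: (measurableT_comp measurable_fst measurable_fst).
  move=> i; apply: measurable_coordB => j; first exact: (measurableT_comp (measurable_coord_rV j) m12).
  exact: (measurableT_comp (measurable_coord_rV j) measurable_snd).
apply: measurable_dot => i; first exact: (measurableT_comp (mphi i) measurable_snd).
exact: (measurableT_comp (msg i) m12).
Qed.

Let A0 : 0 <= M * (2 * L * Cg R n * Num.max 1 (2 * fine (mu (cube r)))).
Proof. by have [M0 _ _] := ft; rewrite !mulr_ge0 ?Cg_ge0// le_max ler01. Qed.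

Let C0 : 0 <= M * (4 * K * Cg R n * Num.max 1 (2 * fine (mu (cube r)))).
Proof. by have [M0 _ _] := ft; rewrite !mulr_ge0 ?Cg_ge0// le_max ler01. Qed.

Let qbdM u : M * (qbd n L K u * Num.max 1 (2 * fine (mu (cube r)))) =
  wt_bd (M * (2 * L * Cg R n * Num.max 1 (2 * fine (mu (cube r)))))
    (M * (4 * K * Cg R n * Num.max 1 (2 * fine (mu (cube r))))) u.
Proof. by rewrite /qbd /wt_bd; case: ifP => _; ring. Qed.

Lemma wt_heat_integrable alpha : 0 < alpha < 1 ->
  leb.-integrable setT (fun u => (wt alpha u * heat_pairing u)%:E).
Proof.
move=> aa; apply: (wt_integrable aa A0 C0 measurable_heat_pairing) => u u0.
by rewrite -qbdM; exact: heat_pairing_le.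
Qed.

(** Fubini once more, now in (x, u): [tame] bounds the integral of |f qint| over x by a multiple of
    [qbd u], which is integrable against [wt alpha]. *)
Lemma Rintegral_div_frac alpha : 0 < alpha < 1 ->
  \int[mu]_x (f x * div_frac alpha phi x) = - \int[leb]_u (wt alpha u * heat_pairing u).
Proof.
move=> aa; have /andP[a0 a1] := aa; have [M0 mf ftM] := ft.
pose F (z : 'rV[R]_n * measurableTypeR R) : R := f z.1 * (wt alpha z.2 * qint phi z.2 z.1).
have mF : measurable_fun setT F.
  apply: measurable_funM; first exact: (measurableT_comp mf measurable_fst).
  apply: measurable_funM; first exact: (measurableT_comp (measurable_wt alpha) measurable_snd).
  by apply: (measurable_qint mphi).
have iF : (mu \x leb)%E.-integrable setT (EFin \o F).
  apply/integrable21ltyP; first exact/measurable_EFinP.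
  apply: (@le_lt_trans _ _ (\int[leb]_u (wt alpha u * (M * (qbd n L K u * Num.max 1 (2 * fine (mu (cube r))))))%:E)%E); last first.
    under eq_integral do rewrite qbdM.
    by apply: le_lt_trans (integral_wt_bd aa A0 C0) _; rewrite ltry.
  apply: ge0_le_integral => //.
  - by move=> u _; exact: integral_ge0.
  - apply: (measurable_fun_fubini_tonelli_G (abse \o (EFin \o F))) => [|z]; last exact: abse_ge0.
    by apply: measurableT_comp => //; exact/measurable_EFinP.
  - apply/measurable_EFinP; apply: measurable_funM; first exact: measurable_wt.
    under eq_fun do rewrite qbdM; exact: measurable_wt_bd.
  move=> u _; case: (ltP 0 u) => u0; last first.
    rewrite integral0_eq ?lee_fin ?/wt ?ltNge ?u0 ?mul0r// => x _.
    by rewrite /F /= /wt ltNge u0 /= mul0r mulr0 normr0.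
  have mq : measurable_fun setT (fun x => qint phi u x) by exact: (measurable_qint mphi).
  have mqn : measurable_fun setT (fun x => `|qint phi u x|) by exact: measurableT_comp.
  have mqf : measurable_fun setT (fun x => (`|f x| * `|qint phi u x|)%:E).
    by apply/measurable_EFinP; apply: measurable_funM => //; exact: measurableT_comp.
  have w0 := wt_ge0 u a1; have q0 := qbd_ge0 n L0 K0 u.
  rewrite (eq_integral (fun x => (wt alpha u)%:E * (`|f x| * `|qint phi u x|)%:E)%E); last first.
    by move=> x _; rewrite /F /= -EFinM !normrM (ger0_norm w0) mulrCA.
  rewrite ge0_integralZl ?lee_fin//.
  rewrite EFinM; apply: lee_wpmul2l; first by rewrite lee_fin.
  apply: ftM => //.
    move=> x; apply: le_trans (qint_le L0 K0 mphi phiL phiK x u0) _.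
    by rewrite ler_peMr// le_max lexx.
  apply: le_trans (integral_qint_le L0 K0 mphi phiL phiK phir u0) _.
  by rewrite lee_fin ler_wpM2l// le_max lexx orbT.
transitivity (\int[mu]_x \int[leb]_u F (x, u)).
  apply: eq_Rintegral => x _; rewrite div_frac_subordination// /F /= RintegralZl//.
  apply: (@wt_integrable _ alpha (fun u => qint phi u x) (2 * L * Cg R n) (4 * K * Cg R n)) => //.
  - by rewrite !mulr_ge0 ?Cg_ge0.
  - by rewrite !mulr_ge0 ?Cg_ge0.
  - by apply: (measurable_qint mphi).
  - by move=> u u0; exact: (qint_le L0 K0 mphi phiL phiK x u0).
rewrite -(Rfubini1 iF) (Rfubini2 iF) -mulN1r -RintegralZl//; last exact: wt_heat_integrable.
apply: eq_Rintegral => u _; case: (ltP 0 u) => u0; last first.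
  rewrite /wt ltNge u0 /= mul0r mulr0 Rintegral_eq0// => x.
  by rewrite /F /= /wt ltNge u0 /= mul0r mulr0.
rewrite mulN1r -mulrN -(Rintegral_qint u0) -RintegralZl//.
  by apply: eq_Rintegral => x _; rewrite /F /= mulrCA.
have mq : measurable_fun setT (fun x => qint phi u x) by exact: (measurable_qint mphi).
have q0 := qbd_ge0 n L0 K0 u.
apply: (@tame_integrable _ _ _ M _ (qbd n L K u * Num.max 1 (2 * fine (mu (cube r))))) => //.
  move=> x; apply: le_trans (qint_le L0 K0 mphi phiL phiK x u0) _.
  by rewrite ler_peMr// le_max lexx.
apply: le_trans (integral_qint_le L0 K0 mphi phiL phiK phir u0) _.
by rewrite lee_fin ler_wpM2l// le_max lexx orbT.
Qed.

End key.

(** * The fractional gradient *)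

Lemma measurable_compact_rV (R : realType) (n : nat) (C : set 'rV[R]_n) :
  compact C -> measurable C.
Proof.
move=> cC; have clC : closed C by apply: compact_closed cC; exact: norm_hausdorff.
by rewrite -[C]setCK; apply: measurableC; apply: open_measurable_rV; rewrite openC.
Qed.

(** The measure with density theta is pushed forward along the first projection; this integrates out
    u and leaves a measure on R^n. *)
Lemma marginal_density d1 d2 (T1 : measurableType d1) (T2 : measurableType d2)
    (R : realType) (mu : {measure set (T1 * T2) -> \bar R}) (theta : T1 * T2 -> R) :
  (forall z, 0 <= theta z) -> measurable_fun setT theta ->
  exists nu : {measure set T1 -> \bar R}, forall h : T1 -> R, measurable_fun setT h ->
    (\int[nu]_x (h x)%:E = \int[mu]_z (h z.1 * theta z)%:E)%E.
Proof.
move=> th0 mth.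
have [D DE] : exists D : {measure set (T1 * T2) -> \bar R},
    forall E, measurable E -> D E = (\int[mu]_(z in E) (theta z)%:E)%E.
  apply: density_measure => [z|]; first by rewrite lee_fin.
  exact/measurable_EFinP.
exists (measure_function_pushforward__canonical__measure_function_Measure D
  (measurable_fst : measurable_fun setT (@fst T1 T2))) => h mh.
have mh1 : measurable_fun setT (fun z : T1 * T2 => h z.1).
  exact: (measurableT_comp mh measurable_fst).
rewrite -(signed_integral_density th0 mth DE mh1) integralE [RHS]integralE.
have mhE : measurable_fun setT (EFin \o h) by exact/measurable_EFinP.
congr (_ - _)%E; rewrite ge0_integral_pushforward ?preimage_setT//.
- by apply: eq_integral => z _; rewrite /= !funeposE.
- exact: measurable_funepos.
- by apply: eq_integral => z _; rewrite /= !funenegE.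
- exact: measurable_funeneg.
Qed.

(** * Mollified measures averaged over u *)

Section heat_density.
Context (R : realType) (n : nat).
Notation mu := (lebesgue_rV R n).
Notation leb := (@lebesgue_measure R).
Implicit Types (u : R) (x y : 'rV[R]_n).
Hypothesis hn : (0 < n)%N.
Variables (m : {finite_measure set 'rV[R]_n -> \bar R}) (w : 'rV[R]_n -> R).
Hypothesis mw : measurable_fun setT w.
Hypothesis w01 : forall x, 0 <= w x <= 1.

(** Mollification of the measure of density w with respect to m; w will be the positive or the
    negative part of a coordinate of sg. *)
Definition heat u y : R := \int[m]_x (gam u (x - y) * w x).

Let mT : R := fine (m setT).

Let mTE : m setT = mT%:E.
Proof. by rewrite fineK//; exact: fin_num_measure. Qed.

Let mT0 : 0 <= mT. Proof. exact: fine_ge0. Qed.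

Let w0 x : 0 <= w x. Proof. by have /andP[] := w01 x. Qed.

Let gw0 u x y : 0 <= gam u (x - y) * w x.
Proof. by rewrite mulr_ge0 ?gam_ge0. Qed.

Let mgw u y : measurable_fun setT (fun x : 'rV[R]_n => gam u (x - y) * w x).
Proof. by apply: measurable_funM => //; exact: measurable_gamB. Qed.

Let gw_le u x y : gam u (x - y) * w x <= gam u (x - y).
Proof. by have /andP[_ w1] := w01 x; rewrite ler_piMr ?gam_ge0. Qed.

Lemma heat_ge0 u y : 0 <= heat u y.
Proof. by apply: Rintegral_ge0 => x _; exact: gw0. Qed.

Lemma heat_integrand_integrable u y : 0 < u ->
  m.-integrable setT (EFin \o (fun x => gam u (x - y) * w x)).
Proof.
move=> u0; apply: measurable_bounded_integrable => //; first exact: fin_num_fun_lty.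
exists (Num.sqrt u ^+ n); split; first exact: num_real.
move=> M' MM' x _; apply: le_trans (ltW MM'); rewrite /= ger0_norm//.
by apply: le_trans (gw_le _ _ _) _; exact: gam_le.
Qed.

Lemma heatE u y : 0 < u -> (heat u y)%:E = (\int[m]_x (gam u (x - y) * w x)%:E)%E.
Proof.
move=> u0; rewrite /heat /Rintegral fineK//.
by apply: integrable_fin_num => //; exact: heat_integrand_integrable.
Qed.

Lemma measurable_heat d (T : measurableType d) (U : T -> R) (Y : T -> 'rV[R]_n) :
  measurable_fun setT U -> measurable_fun setT Y ->
  measurable_fun setT (fun t => heat (U t) (Y t)).
Proof.
move=> mU mY.
apply: (@measurable_Rintegral_snd _ _ _ _ _ m (fun z : T * 'rV[R]_n =>
  gam (U z.1) (z.2 - Y z.1) * w z.2)).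
apply: measurable_funM; last exact: (measurableT_comp mw measurable_snd).
apply: measurable_gam; first exact: (measurableT_comp mU measurable_fst).
move=> i; apply: measurable_coordB => j.
  exact: (measurableT_comp (measurable_coord_rV j) measurable_snd).
apply: (measurableT_comp (measurable_coord_rV j)).
exact: (measurableT_comp mY measurable_fst).
Qed.

(** For u >= 1, mollifying does not increase the total mass; for u < 1 the pointwise bound
    [gam_le_sqrt] is integrated over the cube. *)
Lemma integral_heat_cube r u : 0 < u ->
  (\int[mu]_y (cubeI r y * heat u y)%:E <=
   (wt_bd mT (mT * fine (mu (cube r))) u)%:E)%E.
Proof.
move=> u0; have cI0 := @cubeI_ge0 R n r; have mI := @measurable_cubeI R n r.
have mh : measurable_fun setT (fun y => heat u y) by exact: measurable_heat.
have cfin : mu (cube r) \is a fin_num.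
  by rewrite ge0_fin_numE//; exact: lebesgue_cube_lty.
rewrite /wt_bd; case: ifPn => [u1|]; last first.
  rewrite -ltNge => /ltW u1.
  apply: (@le_trans _ _ (\int[mu]_y ((mT * Num.sqrt u)%:E * (cubeI r y)%:E))%E).
    apply: ge0_le_integral => //.
    - by move=> y _; rewrite lee_fin mulr_ge0 ?heat_ge0.
    - by apply/measurable_EFinP; exact: measurable_funM.
    - by apply: emeasurable_funM => //; exact/measurable_EFinP.
    move=> y _; rewrite -EFinM lee_fin mulrC ler_wpM2r//.
    rewrite -lee_fin heatE//.
    apply: (@le_trans _ _ (\int[m]_x (cst (Num.sqrt u)%:E x))%E).
      apply: ge0_le_integral => //.
      - by move=> x _; rewrite lee_fin.
      - by apply/measurable_EFinP; exact: mgw.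
      - by move=> x _; rewrite lee_fin; apply: le_trans (gw_le _ _ _) _; exact: gam_le_sqrt.
    rewrite integral_cst// EFinM muleC.
    by apply: lee_wpmul2r; rewrite ?lee_fin// -mTE.
  rewrite ge0_integralZl ?lee_fin ?mulr_ge0//; last 2 first.
  - exact/measurable_EFinP.
  - by move=> y _; rewrite lee_fin.
  rewrite /cubeI integral_indic ?setIT//; last exact: measurable_cube.
  by rewrite (mulrAC mT) [leRHS]EFinM fineK.
apply: (@le_trans _ _ mT%:E); last first.
  by rewrite lee_fin lerDl divr_ge0// mulr_ge0// fine_ge0.
pose F (z : 'rV[R]_n * 'rV[R]_n) : \bar R := (gam u (z.1 - z.2) * w z.1)%:E.
have mF : measurable_fun setT F.
  apply/measurable_EFinP; apply: measurable_funM; last exact: (measurableT_comp mw measurable_fst).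
  apply: measurable_gam => // i; apply: measurable_coordB => // j.
    exact: (measurableT_comp (measurable_coord_rV j) measurable_fst).
  exact: (measurableT_comp (measurable_coord_rV j) measurable_snd).
have F0 z : (0 <= F z)%E by rewrite lee_fin.
apply: (@le_trans _ _ (\int[mu]_y \int[m]_x F (x, y))%E).
  apply: ge0_le_integral => //.
  - by move=> y _; rewrite lee_fin mulr_ge0 ?heat_ge0.
  - by apply/measurable_EFinP; exact: measurable_funM.
  - exact: (measurable_fun_fubini_tonelli_G F mF F0).
  move=> y _; rewrite /F /= -heatE// lee_fin ler_piMl ?heat_ge0//.
  by rewrite /cubeI indicE; case: (_ \in _).
have := fubini_tonelli (m1 := m) (m2 := mu) F mF F0; rewrite /fubini_F /fubini_G => <-.
rewrite -mTE; apply: (@le_trans _ _ (\int[m]_x (cst 1%E x))%E); last first.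
  by rewrite integral_cst// mul1e.
apply: ge0_le_integral => //.
- by move=> x _; exact: integral_ge0.
- exact: (measurable_fun_fubini_tonelli_F F mF F0).
move=> x _; rewrite -(integral_gamC x u0); apply: ge0_le_integral => //.
- by apply: (measurableT_comp mF); exact: measurable_pair1.
- apply/measurable_EFinP; apply: measurable_gam => // i; apply: measurable_coordB => // j.
  exact: measurable_coord_rV.
- by move=> y _; rewrite lee_fin.
Qed.

Definition heat_density alpha (z : 'rV[R]_n * measurableTypeR R) : R :=
  wt alpha z.2 * heat z.2 z.1.

Lemma heat_density_ge0 alpha z : alpha < 1 -> 0 <= heat_density alpha z.
Proof. by move=> a1; rewrite mulr_ge0 ?wt_ge0 ?heat_ge0. Qed.

Lemma measurable_heat_density alpha : measurable_fun setT (heat_density alpha).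
Proof.
apply: measurable_funM; first exact: (measurableT_comp (measurable_wt alpha) measurable_snd).
by apply: measurable_heat.
Qed.

Lemma heat_density_integrable alpha (h : 'rV[R]_n -> R) K r : 0 < alpha < 1 ->
  measurable_fun setT h -> (forall x, `|h x| <= K * cubeI r x) -> 0 <= K ->
  (mu \x leb)%E.-integrable setT (EFin \o (fun z => h z.1 * heat_density alpha z)).
Proof.
move=> aa mh hK K0; have /andP[a0 a1] := aa.
have mF : measurable_fun setT (fun z : 'rV[R]_n * measurableTypeR R => h z.1 * heat_density alpha z).
  by apply: measurable_funM; [exact: (measurableT_comp mh measurable_fst)|exact: measurable_heat_density].
have c0 : 0 <= mT * fine (mu (cube r)) by rewrite mulr_ge0// fine_ge0.
apply/integrable21ltyP; first exact/measurable_EFinP.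
apply: (@le_lt_trans _ _ (\int[leb]_u (wt alpha u * wt_bd (K * mT) (K * (mT * fine (mu (cube r)))) u)%:E)%E); last first.
  by apply: le_lt_trans (integral_wt_bd aa _ _) _; rewrite ?ltry// mulr_ge0.
apply: ge0_le_integral => //.
- by move=> u _; exact: integral_ge0.
- pose F := EFin \o (fun z : 'rV[R]_n * measurableTypeR R => h z.1 * heat_density alpha z).
  apply: (measurable_fun_fubini_tonelli_G (abse \o F)) => [|z]; last exact: abse_ge0.
  by apply: measurableT_comp => //; exact/measurable_EFinP.
- apply/measurable_EFinP; apply: measurable_funM; first exact: measurable_wt.
  exact: measurable_wt_bd.
move=> u _; case: (ltP 0 u) => u0; last first.
  rewrite integral0_eq ?lee_fin ?/wt ?ltNge ?u0 ?mul0r// => x _.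
  by rewrite /heat_density /= /wt ltNge u0 /= mul0r mulr0 normr0.
have mI := @measurable_cubeI R n r.
have mch : measurable_fun setT (fun y => (cubeI r y * heat u y)%:E).
  by apply/measurable_EFinP; apply: measurable_funM => //; exact: measurable_heat.
have ch0 y : 0 <= cubeI r y * heat u y by rewrite mulr_ge0 ?cubeI_ge0 ?heat_ge0.
have w00 := wt_ge0 u a1.
apply: (@le_trans _ _ (\int[mu]_y ((wt alpha u * K)%:E * (cubeI r y * heat u y)%:E))%E).
  apply: ge0_le_integral => //.
  - apply/measurable_EFinP; apply: measurableT_comp => //.
    exact: (measurableT_comp mF (measurable_pair2 u)).
  - exact: emeasurable_funM.
  move=> y _; rewrite -EFinM lee_fin /heat_density /= normrM mulrC.
  rewrite (ger0_norm (mulr_ge0 w00 (heat_ge0 _ _))) -!mulrA ler_wpM2l//.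
  by rewrite mulrC mulrA ler_wpM2r ?heat_ge0.
rewrite ge0_integralZl ?lee_fin ?mulr_ge0//; last by move=> y _; rewrite lee_fin.
apply: (@le_trans _ _ ((wt alpha u * K)%:E * (wt_bd mT (mT * fine (mu (cube r))) u)%:E)%E).
  by apply: lee_wpmul2l; [rewrite lee_fin mulr_ge0|exact: integral_heat_cube].
rewrite -EFinM lee_fin /wt_bd; case: ifP => _; rewrite le_eqVlt; apply/orP; left; apply/eqP; ring.
Qed.

(** Local finiteness amounts to integrability of the indicator of a cube against the density, that
    is, to [integral_heat_cube] integrated against the weight. *)
Lemma heat_measure alpha : 0 < alpha < 1 ->
  exists nu : {measure set 'rV[R]_n -> \bar R},
    (forall C, compact C -> (nu C < +oo)%E) /\
    forall h : 'rV[R]_n -> R, measurable_fun setT h ->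
      (\int[nu]_x (h x)%:E = \int[(mu \x leb)%E]_z (h z.1 * heat_density alpha z)%:E)%E.
Proof.
move=> aa; have /andP[_ a1] := aa.
have [nu nuE] := marginal_density (mu \x leb)%E
  (fun z => heat_density_ge0 z a1) (measurable_heat_density alpha).
exists nu; split => // C cC; have [k Ck] := compact_sub_cube cC.
have mc := @measurable_cube R n k%:R.
have mC := measurable_compact_rV cC.
apply: (@le_lt_trans _ _ (nu (cube k%:R))).
  by apply: le_measure; rewrite ?inE.
have mI := @measurable_cubeI R n k%:R.
have := nuE _ mI; rewrite /cubeI integral_indic ?setIT// => ->.
have h1 x : `|cubeI k%:R x| <= 1 * cubeI k%:R x by rewrite ger0_norm// mul1r.
have ii := heat_density_integrable aa mI h1 ler01.
by rewrite ltey_eq; apply/orP; left; exact: integrable_fin_num ii.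
Qed.

End heat_density.

Section grad_frac_exists.
Context (R : realType) (n : nat).
Notation mu := (lebesgue_rV R n).
Notation leb := (@lebesgue_measure R).
Implicit Types (u : R) (x y : 'rV[R]_n).
Hypothesis hn : (0 < n)%N.
Variables (f : 'rV[R]_n -> R) (M : R).
Hypothesis ft : tame f M.
Variables (nu : radon R n) (m : {finite_measure set 'rV[R]_n -> \bar R})
  (sg : 'rV[R]_n -> 'rV[R]_n).
Hypothesis msg : forall i, measurable_fun setT (fun x => sg x ord0 i).
Hypothesis sg1 : forall x, dot (sg x) (sg x) = 1.
Hypothesis pairing : forall (phi : 'rV[R]_n -> 'rV[R]_n) M r,
  (forall i, measurable_fun setT (fun x => phi x ord0 i)) ->
  (forall i x, `|phi x ord0 i| <= M) -> (forall x, phi x != 0 -> `|x| <= r) ->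
  radon_pairing nu phi = \int[m]_x dot (phi x) (sg x).
Hypothesis gradf : is_grad f nu.

Let pos i x : R := Num.max (sg x ord0 i) 0.
Let neg i x : R := Num.max (- sg x ord0 i) 0.

Let sg_le i x : `|sg x ord0 i| <= 1. Proof. exact: coord_unit_le1. Qed.

Let pos01 i x : 0 <= pos i x <= 1.
Proof.
have := sg_le i x; rewrite ler_norml => /andP[_ h].
by rewrite /pos le_max lexx orbT ge_max h ler01.
Qed.

Let neg01 i x : 0 <= neg i x <= 1.
Proof.
have := sg_le i x; rewrite ler_norml => /andP[h _].
by rewrite /neg le_max lexx orbT ge_max lerNl h ler01.
Qed.

Let mpos i : measurable_fun setT (pos i).
Proof. by apply: measurable_maxr => //; exact: msg. Qed.

Let mneg i : measurable_fun setT (neg i).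
Proof. by apply: measurable_maxr => //; apply: measurableT_comp => //; exact: msg. Qed.

Let pos_neg i x : pos i x - neg i x = sg x ord0 i.
Proof.
rewrite /pos /neg; case: (leP (sg x ord0 i) 0) => h.
  by rewrite (max_idPl _) ?oppr_ge0// sub0r opprK.
by rewrite (max_idPr _) ?subr0// oppr_le0 ltW.
Qed.

(** The candidate for D^alpha f. The positive and negative parts of each coordinate of sg are
    mollified and averaged separately, because a [radon] is presented by pairs of positive
    measures. *)
Lemma radon_heat alpha : 0 < alpha < 1 ->
  exists nua : radon R n, forall phi, lip_c phi ->
    radon_pairing nua phi = \int[leb]_u (wt alpha u * heat_pairing phi m sg u).
Proof.
move=> aa; have /andP[a0 a1] := aa.
have /choice[rp rpP] i := heat_measure hn m (mpos i) (pos01 i) aa.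
have /choice[rn rnP] i := heat_measure hn m (mneg i) (neg01 i) aa.
exists (Radon (fun i K cK => (rpP i).1 K cK) (fun i K cK => (rnP i).1 K cK)) => phi lphi.
have [L [K [r [L0 K0 mphi phiL [phiK phir]]]]] := lip_c_bounds lphi.
have phic i x : `|phi x ord0 i| <= K * cubeI r x.
  by apply: le_trans (coord_le_enorm _ _) _; exact: (phi_le_cubeI K0 phiK phir).
have ip i := heat_density_integrable hn m (mpos i) (pos01 i) aa (mphi i) (phic i) K0.
have iq i := heat_density_integrable hn m (mneg i) (neg01 i) aa (mphi i) (phic i) K0.
pose D i (z : 'rV[R]_n * measurableTypeR R) : R := phi z.1 ord0 i * heat_density m (pos i) alpha z -
  phi z.1 ord0 i * heat_density m (neg i) alpha z.
have iD i : (mu \x leb)%E.-integrable setT (EFin \o D i).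
  rewrite (_ : _ \o _ = (fun z => (phi z.1 ord0 i * heat_density m (pos i) alpha z)%:E -
      (phi z.1 ord0 i * heat_density m (neg i) alpha z)%:E)%E).
    exact: (integrableB measurableT (ip i) (iq i)).
  by apply/funext => z /=; rewrite EFinB.
transitivity (\sum_i \int[(mu \x leb)%E]_z D i z).
  apply: eq_bigr => i _ /=; rewrite /Rintegral (rpP i).2// (rnP i).2//.
  by rewrite -/(Rintegral _ _ _) -/(Rintegral _ _ _) -RintegralB.
rewrite -Rintegral_sum//.
have iS : (mu \x leb)%E.-integrable setT (EFin \o (fun z => \sum_i D i z)).
  rewrite (_ : _ \o _ = (fun z => \sum_i (D i z)%:E)%E); first by apply: integrable_sum => // i _; exact: iD.
  by apply/funext => z /=; rewrite sumEFin.
rewrite (Rfubini2 iS); apply: eq_Rintegral => u _.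
case: (ltP 0 u) => u0; last first.
  rewrite Rintegral_eq0; first by rewrite /wt ltNge u0 mul0r.
  move=> y; rewrite big1// => i _; rewrite /D /heat_density /= /wt ltNge u0 /=.
  by rewrite !mul0r mulr0 subrr.
have iH := heat_integrable K0 mphi phiK m msg sg1 u0.
rewrite /heat_pairing -(Rfubini1 iH) (Rfubini2 iH) -RintegralZl//; last exact: integrable_Rfubini2 iH.
apply: eq_Rintegral => y _ /=.
have moo : (m setT < +oo)%E by exact: fin_num_fun_lty.
have isg i := integrable_gam_sg msg sg1 moo y i u0.
transitivity (\sum_i wt alpha u * \int[m]_x (phi y ord0 i * (gam u (x - y) * sg x ord0 i))).
  apply: eq_bigr => i _; rewrite /D /heat_density /=.
  rewrite RintegralZl// -mulrBr -mulrBr mulrCA; congr (_ * (_ * _)).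
  rewrite /heat -RintegralB//.
  - by apply: eq_Rintegral => x _; rewrite -mulrBr pos_neg.
  - exact: heat_integrand_integrable.
  - exact: heat_integrand_integrable.
rewrite -mulr_sumr; congr (_ * _); rewrite -Rintegral_sum//; last first.
  move=> i; rewrite (_ : _ \o _ = (fun x => (phi y ord0 i)%:E * (gam u (x - y) * sg x ord0 i)%:E)%E).
    exact: (integrableZl measurableT _ (isg i)).
  by apply/funext => x /=; rewrite EFinM.
apply: eq_Rintegral => x _; rewrite /dot mulr_sumr; apply: eq_bigr => i _; ring.
Qed.

(** [grad_frac] is picked by [get], so only its defining identity is known; it holds because
    [radon_heat] exhibits a solution, and it fixes the pairings. *)
Lemma grad_frac_pairing alpha phi : 0 < alpha < 1 -> lip_c phi ->
  radon_pairing (grad_frac alpha f) phi =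
  \int[leb]_u (wt alpha u * heat_pairing phi m sg u).
Proof.
move=> aa lphi; have [nua nuaE] := radon_heat aa.
have id g : lip_c g -> \int[mu]_x (f x * div_frac alpha g x) =
    - \int[leb]_u (wt alpha u * heat_pairing g m sg u).
  move=> lg; have [L [K [r [L0 K0 mg gL [gK gr]]]]] := lip_c_bounds lg.
  exact: (Rintegral_div_frac L0 K0 mg gL gK gr ft msg sg1 pairing gradf aa).
have ex : [set nu | is_grad_frac alpha f nu] nua.
  by move=> g lg; rewrite id// nuaE.
have /(_ phi lphi) : is_grad_frac alpha f (grad_frac alpha f) by exact: (getPex (ex_intro _ nua ex)).
by rewrite id// => /oppr_inj ->.
Qed.

End grad_frac_exists.

(** The last two clauses are the halves of a duality formula: the integral of psi against the
    variation is the supremum of the pairings over |phi| <= psi. The limit argument controls the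
    variation of D^alpha f through them. *)
Lemma polar_dual (R : realType) (n : nat) (hn : (0 < n)%N) (nu : radon R n) :
  exists m : {measure set 'rV[R]_n -> \bar R},
  [/\ forall K, compact K -> (m K < +oo)%E,
    forall B, measurable B -> radon_variation nu B = m B,
    forall (phi : 'rV[R]_n -> 'rV[R]_n) (psi : 'rV[R]_n -> R), lip_c phi ->
      measurable_fun setT psi -> (forall x, enorm (phi x) <= psi x) ->
      ((radon_pairing nu phi)%:E <= \int[m]_x (psi x)%:E)%E &
    forall (psi : 'rV[R]_n -> R) (c : R), continuous psi -> (forall x, 0 <= psi x) ->
      (c%:E < \int[m]_x (psi x)%:E)%E ->
      exists phi : 'rV[R]_n -> 'rV[R]_n,
      [/\ lip_c phi, forall x, enorm (phi x) <= psi x & c <= radon_pairing nu phi]].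
Proof.
have [m [sg [mK msg sg1 mE pE]]] := radon_polar nu hn.
have pairE phi : lip_c phi -> radon_pairing nu phi = \int[m]_x dot (phi x) (sg x).
  by move=> /lip_c_props[M [r [mphi phiM phir]]]; exact: (pE _ M r).
exists m; split => //.
  by move=> phi psi lphi mpsi phipsi; rewrite pairE//; exact: pairing_le.
move=> psi c cpsi psi0 cint.
have [phi [lphi phipsi cphi]] := duality_lower mK msg sg1 cpsi psi0 cint.
by exists phi; split => //; rewrite pairE.
Qed.

(** * Bounds on the mollified pairing for large and small u *)

Section heat_bounds.
Context (R : realType) (n : nat).
Notation mu := (lebesgue_rV R n).
Notation leb := (@lebesgue_measure R).
Implicit Types (u : R) (x y : 'rV[R]_n) (phi : 'rV[R]_n -> 'rV[R]_n).
Hypothesis hn : (0 < n)%N.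
Variables (m : {finite_measure set 'rV[R]_n -> \bar R}) (sg : 'rV[R]_n -> 'rV[R]_n).
Hypothesis msg : forall i, measurable_fun setT (fun x => sg x ord0 i).
Hypothesis sg1 : forall x, dot (sg x) (sg x) = 1.

Let mT : R := fine (m setT).

Let mT0 : 0 <= mT. Proof. exact: fine_ge0. Qed.

Let moo : (m setT < +oo)%E. Proof. exact: fin_num_fun_lty. Qed.

Definition heat_at phi u x : R := \int[mu]_y (gam u (x - y) * dot (phi y) (sg x)).

Let dot_sg v x : dot v (sg x) <= enorm v.
Proof. by apply: le_trans (dot_le_enorm _ _) _; rewrite /enorm sg1 sqrtr1 mulr1. Qed.

Lemma heat_at_integrable phi u x : lip_c phi -> 0 < u ->
  mu.-integrable setT (EFin \o (fun y => gam u (x - y) * dot (phi y) (sg x))).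
Proof.
move=> /lip_c_bounds[L [K [r [L0 K0 mphi phiL [phiK phir]]]]] u0.
have := integrableZl measurableT K (integrable_gam x u0).
apply: le_integrable => //.
  apply/measurable_EFinP; apply: measurable_funM; last exact: measurable_dot.
  apply: measurable_gam => // i; apply: measurable_coordB => // j; exact: measurable_coord_rV.
move=> y _; rewrite /= lee_fin gamC mulrC; apply: le_trans (ler_norm _).
rewrite normrM (ger0_norm (gam_ge0 _ _)) ler_wpM2r ?gam_ge0//.
by apply: le_trans (normr_dot_le _ _) _; rewrite {2}/enorm sg1 sqrtr1 mulr1.
Qed.

Lemma heat_pairing_integrable phi u : lip_c phi -> 0 < u ->
  m.-integrable setT (EFin \o heat_at phi u).
Proof.
move=> /lip_c_bounds[L [K [r [L0 K0 mphi phiL [phiK phir]]]]] u0.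
exact: (integrable_Rfubini1 (heat_integrable K0 mphi phiK m msg sg1 u0)).
Qed.

Lemma gam_enorm_integrable u x : 0 < u ->
  mu.-integrable setT (EFin \o (fun y => enorm (y - x) * gam u (y - x))).
Proof.
move=> u0; apply/integrableP; split.
  apply/measurable_EFinP; apply: measurable_funM; last exact: measurable_gamB.
  by apply: measurable_enorm => i; apply: measurable_coordB => // j; exact: measurable_coord_rV.
under eq_integral do rewrite /= ger0_norm ?mulr_ge0 ?enorm_ge0 ?gam_ge0//.
by apply: le_lt_trans (integral_moment1 x u0) _; rewrite ltry.
Qed.

Let gam_affineE u x (a b : R) : (fun y => gam u (y - x) * (a + b * enorm (y - x))) =
  (fun y => a * gam u (y - x) + b * (enorm (y - x) * gam u (y - x))).
Proof. by apply/funext => y; ring. Qed.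

Let igZ u x (a : R) : 0 < u -> mu.-integrable setT (EFin \o (fun y => a * gam u (y - x))).
Proof.
move=> u0; rewrite (_ : _ \o _ = (fun y => a%:E * (gam u (y - x))%:E)%E).
  by apply: integrableZl => //; exact: integrable_gam.
by apply/funext => y /=; rewrite EFinM.
Qed.

Let ieZ u x (a : R) : 0 < u ->
  mu.-integrable setT (EFin \o (fun y => a * (enorm (y - x) * gam u (y - x)))).
Proof.
move=> u0; rewrite (_ : _ \o _ = (fun y => a%:E * (enorm (y - x) * gam u (y - x))%:E)%E).
  by apply: integrableZl => //; exact: gam_enorm_integrable.
by apply/funext => y /=; rewrite EFinM.
Qed.

Lemma gam_affine_integrable u x (a b : R) : 0 < u ->
  mu.-integrable setT (EFin \o (fun y => gam u (y - x) * (a + b * enorm (y - x)))).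
Proof.
move=> u0; rewrite gam_affineE (_ : _ \o _ = (fun y => (a * gam u (y - x))%:E +
    (b * (enorm (y - x) * gam u (y - x)))%:E)%E).
  by apply: integrableD => //; [exact: igZ|exact: ieZ].
by apply/funext => y /=; rewrite EFinD.
Qed.

(** The unit mass of the Gaussian reproduces a, and its first moment bounds the linear term. *)
Lemma Rintegral_gam_affine u x (a b : R) : 0 < u ->
  `|\int[mu]_y (gam u (y - x) * (a + b * enorm (y - x))) - a| <= `|b| * (Cg R n / Num.sqrt u).
Proof.
move=> u0; have ie := gam_enorm_integrable x u0.
have Ig : \int[mu]_y gam u (y - x) = 1 by rewrite /Rintegral integral_gam.
have I0 : 0 <= \int[mu]_y (enorm (y - x) * gam u (y - x)).
  by apply: Rintegral_ge0 => y _; rewrite mulr_ge0 ?enorm_ge0 ?gam_ge0.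
have Ie : \int[mu]_y (enorm (y - x) * gam u (y - x)) <= Cg R n / Num.sqrt u.
  rewrite -lee_fin /Rintegral fineK; first exact: integral_moment1.
  exact: (integrable_fin_num measurableT ie).
rewrite gam_affineE RintegralD//; [|exact: igZ|exact: ieZ].
rewrite RintegralZl//; last exact: integrable_gam.
rewrite RintegralZl// Ig mulr1 addrC addrA addNr add0r normrM (ger0_norm I0).
by rewrite ler_wpM2l.
Qed.

Let IE u phi : heat_pairing phi m sg u = \int[m]_x heat_at phi u x.
Proof. by []. Qed.

Let cst_integrable (c : R) : m.-integrable setT (EFin \o (fun=> c)).
Proof. exact: finite_measure_integrable_cst. Qed.

(** For each x, phi y . sg x <= eta y <= eta x + L |y - x|. The Lipschitz constant is that of eta,
    so the error is the same for every phi below eta. *)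
Lemma heat_le_avg phi (eta : 'rV[R]_n -> R) (L : R) u : lip_c phi ->
  m.-integrable setT (EFin \o eta) -> (forall x, enorm (phi x) <= eta x) ->
  (forall x y, `|eta x - eta y| <= L * enorm (x - y)) -> 0 <= L -> 0 < u ->
  heat_pairing phi m sg u <= \int[m]_x eta x + L * Cg R n * mT / Num.sqrt u.
Proof.
move=> lphi ieta phieta etaL L0 u0; rewrite IE.
set c := L * (Cg R n / Num.sqrt u).
have -> : L * Cg R n * mT / Num.sqrt u = \int[m]_x (fun=> c) x.
  by rewrite Rintegral_cst// /c -/mT; ring.
rewrite -RintegralD//; apply: le_Rintegral => //.
- exact: heat_pairing_integrable.
- by rewrite (_ : _ \o _ = (fun x => (eta x)%:E + c%:E)%E)//; exact: (integrableD measurableT ieta (cst_integrable c)).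
move=> x _; apply: (@le_trans _ _ (\int[mu]_y (gam u (y - x) * (eta x + L * enorm (y - x))))).
  apply: le_Rintegral => //; [exact: heat_at_integrable|exact: gam_affine_integrable|].
  move=> y _; rewrite gamC ler_wpM2l ?gam_ge0//.
  apply: le_trans (dot_sg _ _) _; apply: le_trans (phieta _) _.
  by rewrite -lerBlDl; apply: le_trans (ler_norm _) (etaL _ _).
have := Rintegral_gam_affine x (eta x) L u0; rewrite (ger0_norm L0).
by move=> /(le_trans (ler_norm _)); rewrite lerBlDl.
Qed.

(** For u <= 1 the Gaussian is at most sqrt u pointwise; here too phi enters the bound through eta
    only. *)
Lemma heat_le_small phi (eta : 'rV[R]_n -> R) u : lip_c phi ->
  mu.-integrable setT (EFin \o eta) -> (forall x, enorm (phi x) <= eta x) ->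
  0 < u -> u <= 1 ->
  heat_pairing phi m sg u <= mT * \int[mu]_y eta y * Num.sqrt u.
Proof.
move=> lphi ieta phieta u0 u1; rewrite IE.
set c := Num.sqrt u * \int[mu]_y eta y.
rewrite [leRHS](_ : _ = \int[m]_x (fun=> c) x); last first.
  by rewrite Rintegral_cst// /c -/mT; ring.
apply: le_Rintegral => //; first exact: heat_pairing_integrable.
move=> x _; rewrite /c -RintegralZl//; apply: le_Rintegral => //.
- exact: heat_at_integrable.
- rewrite (_ : _ \o _ = (fun y => (Num.sqrt u)%:E * (eta y)%:E)%E); first exact: integrableZl.
  by apply/funext => y /=; rewrite EFinM.
move=> y _; apply: (@le_trans _ _ (gam u (x - y) * eta y)).
  by rewrite ler_wpM2l ?gam_ge0//; exact: le_trans (dot_sg _ _) _.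
by rewrite ler_wpM2r ?gam_le_sqrt//; apply: le_trans (phieta y); exact: enorm_ge0.
Qed.

(** Counterpart of [heat_le_avg] in which the Lipschitz constant of phi itself enters: a lower bound
    for a supremum needs a single phi, so no uniformity is lost. *)
Lemma heat_ge_avg phi (L : R) u : lip_c phi ->
  (forall x y, enorm (phi x - phi y) <= L * enorm (x - y)) -> 0 <= L -> 0 < u ->
  \int[m]_x dot (phi x) (sg x) - L * Cg R n * mT / Num.sqrt u <= heat_pairing phi m sg u.
Proof.
move=> lphi phiL L0 u0; rewrite IE.
set c := L * (Cg R n / Num.sqrt u).
have ip : m.-integrable setT (EFin \o (fun x => dot (phi x) (sg x))).
  apply: pairing_integrable => // K cK.
  by apply: le_lt_trans moo; apply: le_measure; rewrite ?inE//; exact: measurable_compact_rV.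
have -> : L * Cg R n * mT / Num.sqrt u = \int[m]_x (fun=> c) x.
  by rewrite Rintegral_cst// /c -/mT; ring.
rewrite -RintegralB//; apply: le_Rintegral => //.
- by rewrite (_ : _ \o _ = (fun x => (dot (phi x) (sg x))%:E - c%:E)%E)//; exact: (integrableB measurableT ip (cst_integrable c)).
- exact: heat_pairing_integrable.
move=> x _; apply: (@le_trans _ _ (\int[mu]_y (gam u (y - x) * (dot (phi x) (sg x) + (- L) * enorm (y - x))))); last first.
  apply: le_Rintegral => //; [exact: gam_affine_integrable|exact: heat_at_integrable|].
  move=> y _; rewrite gamC ler_wpM2l ?gam_ge0// mulNr lerBlDr -lerBlDl.
  rewrite ![dot (phi _) _]dotC -dotBr dotC; apply: le_trans (dot_sg _ _) _.
  by rewrite -(enormN (y - x)) opprB.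
have := Rintegral_gam_affine x (dot (phi x) (sg x)) (- L) u0; rewrite normrN (ger0_norm L0).
rewrite distrC => /(le_trans (ler_norm _)); rewrite lerBlDr -lerBlDl.
by [].
Qed.

End heat_bounds.

(** * Convergence as alpha tends to 1 *)

Section convergence.
Context (R : realType) (n : nat).
Notation mu := (lebesgue_rV R n).
Notation leb := (@lebesgue_measure R).
Implicit Types (u : R) (x y : 'rV[R]_n) (phi : 'rV[R]_n -> 'rV[R]_n) (psi eta : 'rV[R]_n -> R).
Hypothesis hn : (0 < n)%N.
Variables (f : 'rV[R]_n -> R) (M : R).
Hypothesis ft : tame f M.
Variables (nu : radon R n) (m : {finite_measure set 'rV[R]_n -> \bar R})
  (sg : 'rV[R]_n -> 'rV[R]_n).
Hypothesis msg : forall i, measurable_fun setT (fun x => sg x ord0 i).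
Hypothesis sg1 : forall x, dot (sg x) (sg x) = 1.
Hypothesis pairing : forall (phi : 'rV[R]_n -> 'rV[R]_n) M r,
  (forall i, measurable_fun setT (fun x => phi x ord0 i)) ->
  (forall i x, `|phi x ord0 i| <= M) -> (forall x, phi x != 0 -> `|x| <= r) ->
  radon_pairing nu phi = \int[m]_x dot (phi x) (sg x).
Hypothesis gradf : is_grad f nu.
Variable ma : R -> {measure set 'rV[R]_n -> \bar R}.
Hypothesis maK : forall a K, compact K -> (ma a K < +oo)%E.
Hypothesis ma_ge : forall a phi psi, lip_c phi ->
  measurable_fun setT psi -> (forall x, enorm (phi x) <= psi x) ->
  ((radon_pairing (grad_frac a f) phi)%:E <= \int[ma a]_x (psi x)%:E)%E.
Hypothesis ma_le : forall a psi c, continuous psi -> (forall x, 0 <= psi x) ->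
  (c%:E < \int[ma a]_x (psi x)%:E)%E ->
  exists phi, [/\ lip_c phi, forall x, enorm (phi x) <= psi x &
    c <= radon_pairing (grad_frac a f) phi].

Let mT : R := fine (m setT).

Let mT0 : 0 <= mT. Proof. exact: fine_ge0. Qed.

Let moo : (m setT < +oo)%E. Proof. exact: fin_num_fun_lty. Qed.

Let mK K : compact K -> (m K < +oo)%E.
Proof.
move=> cK; apply: le_lt_trans moo; apply: le_measure; rewrite ?inE//.
exact: measurable_compact_rV.
Qed.

Lemma pairing_frac_ge phi : lip_c phi -> 0 <= \int[m]_x dot (phi x) (sg x) ->
  exists2 C, 0 <= C & forall alpha, 0 < alpha < 1 ->
    (\int[m]_x dot (phi x) (sg x)) * wt_p alpha - C * wt_r alpha <=
    radon_pairing (grad_frac alpha f) phi.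
Proof.
move=> lphi A0; have [M0 _ _] := ft.
have [L [K [r [L0 K0 mphi phiL [phiK phir]]]]] := lip_c_bounds lphi.
(* [C1] is the mollification error for u >= 1, [C2] the decay for u < 1 read on the side of f. *)
pose C1 := L * Cg R n * mT.
pose mx := Num.max 1 (2 * fine (mu (cube r))).
have mx0 : 0 <= mx by rewrite le_max ler01.
pose C2 := M * (4 * K * Cg R n * mx).
have C10 : 0 <= C1 by rewrite !mulr_ge0 ?Cg_ge0.
have C20 : 0 <= C2 by rewrite !mulr_ge0 ?Cg_ge0.
exists (C1 + C2); first exact: addr_ge0.
move=> alpha aa; rewrite (grad_frac_pairing hn ft msg sg1 pairing gradf aa lphi).
apply: wt_Rintegral_ge => //; first exact: addr_ge0.
  exact: (wt_heat_integrable L0 K0 mphi phiL phiK phir ft msg sg1 pairing gradf aa).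
move=> u u0; have s0 := sqrtr_ge0 u; rewrite /wt_bd; case: ifPn => u1.
  apply: le_trans (@heat_ge_avg _ _ m sg msg sg1 phi L u lphi phiL L0 u0).
  rewrite mul0r addr0 add0r lerD2l lerN2 -/mT -/C1.
  by rewrite ler_wpM2r ?invr_ge0// lerDl.
have := heat_pairing_le L0 K0 mphi phiL phiK phir ft msg sg1 pairing gradf u0.
rewrite ler_norml => /andP[h _]; apply: le_trans h.
rewrite mul0r sub0r lerN2 /qbd /wt_bd (negbTE u1) -/mx.
rewrite (_ : M * _ = C2 * Num.sqrt u); last by rewrite /C2; ring.
by rewrite ler_wpM2r// lerDr.
Qed.

(** A field phi nearly optimal for Df competes for every D^alpha f as well, where its pairing is at
    least a quantity tending to its pairing with Df. *)
Lemma integral_near_ge psi c : continuous psi -> (forall x, 0 <= psi x) ->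
  (c%:E < \int[m]_x (psi x)%:E)%E ->
  \forall alpha \near (1 : R)^'-, (c%:E < \int[ma alpha]_x (psi x)%:E)%E.
Proof.
move=> cpsi psi0; have [c0 _|c0 cint] := ltP c 0.
  apply: nearW => alpha; apply: lt_le_trans (_ : 0 <= _)%E; first by rewrite lte_fin.
  by apply: integral_ge0 => x _; rewrite lee_fin.
(* A value strictly between c and the integral, possibly +oo, leaves room to pass to the limit. *)
have [c' cc' c'int] : exists2 c', c < c' & (c'%:E < \int[m]_x (psi x)%:E)%E.
  case: (\int[m]_x (psi x)%:E)%E cint => [r| |]//; rewrite ?lte_fin => cr.
    by exists ((c + r) / 2); rewrite ?lte_fin; lra.
  by exists (c + 1); rewrite ?ltry//; lra.
have [phi [lphi phipsi cphi]] := duality_lower mK msg sg1 cpsi psi0 c'int.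
have A0 : 0 <= \int[m]_x dot (phi x) (sg x).
  by apply: le_trans cphi; exact: le_trans (ltW cc').
have [C C0 HC] := pairing_frac_ge lphi A0.
have lim : (\int[m]_x dot (phi x) (sg x)) * wt_p alpha - C * wt_r alpha
    @[alpha --> (1 : R)^'-] --> (\int[m]_x dot (phi x) (sg x)) * 1 - C * 0.
  apply: cvgB; apply: cvgM; try exact: cvg_cst.
  - exact: cvg_wt_p.
  - exact: cvg_wt_r.
rewrite mulr1 mulr0 subr0 in lim.
have cA : c < \int[m]_x dot (phi x) (sg x) by exact: lt_le_trans cphi.
have near_c := cvgr_gt _ lim _ cA.
near=> alpha.
have aa : 0 < alpha < 1 by near: alpha; exact: near_left1.
apply: lt_le_trans (ma_ge alpha lphi (continuous_measurable_rV cpsi) phipsi).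
rewrite lte_fin; apply: lt_le_trans (HC _ aa).
by near: alpha; exact: near_c.
Unshelve. all: by end_near. Qed.

(** [C] is fixed before phi, because the bound has to survive a supremum over all phi below eta. *)
Definition heat_dominated eta C := 0 <= C /\ forall phi, lip_c phi ->
  (forall x, enorm (phi x) <= eta x) ->
  forall u, 0 < u -> heat_pairing phi m sg u <= wt_bd (\int[m]_x eta x) C u.

(** Each phi below eta has pairing at most (int eta dm) [wt_p] + C [wt_r]; by duality the integral
    of eta against the variation of D^alpha f obeys the same bound, which tends to int eta dm. *)
Lemma integral_near_le eta C e : continuous eta -> (forall x, 0 <= eta x) ->
  heat_dominated eta C -> 0 < e ->
  \forall alpha \near (1 : R)^'-,
    (\int[ma alpha]_x (eta x)%:E < (\int[m]_x eta x + e)%:E)%E.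
Proof.
move=> ceta eta0 [C0 dom] e0; have I0 : 0 <= \int[m]_x eta x by apply: Rintegral_ge0.
have ub alpha : 0 < alpha < 1 ->
    (\int[ma alpha]_x (eta x)%:E <= (\int[m]_x eta x * wt_p alpha + C * wt_r alpha)%:E)%E.
  move=> aa; apply/lee_addgt0Pr => d d0; rewrite leNgt; apply/negP; rewrite -EFinD => h.
  have [phi [lphi phieta dphi]] := ma_le ceta eta0 h.
  have [L [K [r [L0 K0 mphi phiL [phiK phir]]]]] := lip_c_bounds lphi.
  have := wt_Rintegral_le aa I0 C0
    (wt_heat_integrable L0 K0 mphi phiL phiK phir ft msg sg1 pairing gradf aa)
    (dom _ lphi phieta).
  rewrite -(grad_frac_pairing hn ft msg sg1 pairing gradf aa lphi).
  by move=> /(le_trans dphi); rewrite gerDl leNgt d0.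
have lim : (\int[m]_x eta x) * wt_p alpha + C * wt_r alpha
    @[alpha --> (1 : R)^'-] --> (\int[m]_x eta x) * 1 + C * 0.
  apply: cvgD; apply: cvgM; try exact: cvg_cst.
  - exact: cvg_wt_p.
  - exact: cvg_wt_r.
rewrite mulr1 mulr0 addr0 in lim.
have near_c := cvgr_lt _ lim (\int[m]_x eta x + e) ltac:(by rewrite ltrDl).
near=> alpha.
have aa : 0 < alpha < 1 by near: alpha; exact: near_left1.
apply: le_lt_trans (ub _ aa) _; rewrite lte_fin.
by near: alpha; exact: near_c.
Unshelve. all: by end_near. Qed.

(** [heat_le_avg] covers u >= 1 and [heat_le_small] covers u < 1, the latter through the Lebesgue
    integral of eta. *)
Lemma heat_dominated_lip eta (L : R) : m.-integrable setT (EFin \o eta) ->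
  mu.-integrable setT (EFin \o eta) -> (forall x, 0 <= eta x) ->
  0 <= L -> (forall x y, `|eta x - eta y| <= L * enorm (x - y)) ->
  exists C, heat_dominated eta C.
Proof.
move=> ieta imeta eta0 L0 etaL.
have I0 : 0 <= \int[mu]_y eta y by apply: Rintegral_ge0.
have C10 : 0 <= L * Cg R n * mT by rewrite !mulr_ge0 ?Cg_ge0.
have C20 : 0 <= mT * \int[mu]_y eta y by rewrite mulr_ge0.
exists (L * Cg R n * mT + mT * \int[mu]_y eta y); split; first exact: addr_ge0.
move=> phi lphi phieta u u0; rewrite /wt_bd; case: ifPn => u1.
  apply: le_trans (@heat_le_avg _ _ m sg msg sg1 phi eta L u lphi ieta phieta etaL L0 u0) _.
  by rewrite lerD2l -/mT ler_wpM2r ?invr_ge0// lerDl.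
have u1' : u <= 1 by rewrite ltW// ltNge.
apply: le_trans (@heat_le_small _ _ hn m sg msg sg1 phi eta u lphi imeta phieta u0 u1') _.
by rewrite -/mT ler_wpM2r// lerDr.
Qed.

Lemma heat_dominated_one : mu.-integrable setT (EFin \o f) ->
  exists C, heat_dominated (fun=> 1) C.
Proof.
move=> iF; have [M0 mf _] := ft.
pose N := \int[mu]_x `|f x|.
have N0 : 0 <= N by apply: Rintegral_ge0.
have C0 : 0 <= N * (4 * 1 * Cg R n) by rewrite !mulr_ge0 ?Cg_ge0.
exists (N * (4 * 1 * Cg R n)); split => // phi lphi phi1 u u0; rewrite /wt_bd; case: ifPn => u1.
  have i1 : m.-integrable setT (EFin \o (fun=> (1 : R))) by exact: finite_measure_integrable_cst.
  apply: le_trans (@heat_le_avg _ _ m sg msg sg1 phi (fun=> 1) 0 u lphi i1 phi1 _ (lexx 0) u0) _.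
    by move=> x y; rewrite subrr normr0 mul0r.
  by rewrite !mul0r addr0 lerDl divr_ge0.
have [L [K [r [L0 K0 mphi phiL [phiK phir]]]]] := lip_c_bounds lphi.
have qle x : `|qint phi u x| <= 4 * 1 * Cg R n * Num.sqrt u.
  by have := qint_le L0 ler01 mphi phiL phi1 x u0; rewrite /qbd /wt_bd (negbTE u1).
have mq : measurable_fun setT (fun x => qint phi u x) by exact: (measurable_qint mphi).
have s0 : 0 <= 4 * 1 * Cg R n * Num.sqrt u by rewrite !mulr_ge0 ?Cg_ge0.
have := Rintegral_qint L0 K0 mphi phiL phiK phir ft msg sg1 pairing gradf u0.
move=> /(congr1 (fun t => - t)); rewrite opprK => <-.
apply: le_trans (ler_norm _) _; rewrite normrN.
have iN : mu.-integrable setT (EFin \o (fun x => 4 * 1 * Cg R n * Num.sqrt u * `|f x|)).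
  rewrite (_ : _ \o _ = (fun x => (4 * 1 * Cg R n * Num.sqrt u)%:E * (`|f x|)%:E)%E).
    by apply: integrableZl => //; exact: (integrable_norm iF).
  by apply/funext => x /=; rewrite EFinM.
have ifq : mu.-integrable setT (EFin \o (fun x => f x * qint phi u x)).
  apply: le_integrable iN => //; first by apply/measurable_EFinP; exact: measurable_funM.
  move=> x _; rewrite /= lee_fin (ger0_norm (mulr_ge0 s0 (normr_ge0 (f x)))).
  by rewrite normrM mulrC ler_wpM2r.
apply: le_trans (le_normr_Rintegral measurableT ifq) _.
rewrite (_ : N * _ * _ = \int[mu]_x (4 * 1 * Cg R n * Num.sqrt u * `|f x|)); last first.
  rewrite RintegralZl//; last exact: (integrable_norm iF).
  by rewrite -/N; ring.
apply: le_Rintegral => //; first exact: (integrable_norm ifq).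
by move=> x _; rewrite normrM mulrC ler_wpM2r.
Qed.

(** Both one-sided estimates are taken at the constant 1, whose integral is the total mass. *)
Lemma cvg_total_mass : mu.-integrable setT (EFin \o f) ->
  ma alpha setT @[alpha --> (1 : R)^'-] --> m setT.
Proof.
move=> iF; have [C domC] := heat_dominated_one iF.
have one (k : {measure set 'rV[R]_n -> \bar R}) : (\int[k]_x (1%R)%:E = k setT)%E.
  by rewrite integral_cst// mul1e.
have mfin : m setT \is a fin_num by exact: fin_num_measure.
rewrite -(fineK mfin).
have I1 : \int[m]_x (1 : R) = fine (m setT) by rewrite Rintegral_cst// mul1r.
have c1 : continuous (fun _ : 'rV[R]_n => 1 : R) by exact: cst_continuous.
have lo e : 0 < e -> \forall alpha \near (1 : R)^'-, ((fine (m setT) - e)%:E < ma alpha setT)%E.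
  move=> e0; have h : ((fine (m setT) - e)%:E < \int[m]_x (1 : R)%:E)%E.
    by rewrite one -[X in (_ < X)%E](fineK mfin) lte_fin ltrBlDr ltrDl.
  have := integral_near_ge c1 (fun=> ler01) h; apply: filterS => alpha; by rewrite one.
have hi e : 0 < e -> \forall alpha \near (1 : R)^'-, (ma alpha setT < (fine (m setT) + e)%:E)%E.
  move=> e0; have := integral_near_le c1 (fun=> ler01) domC e0; apply: filterS => alpha.
  by rewrite one I1.
apply/fine_cvgP; split.
  apply: filterS (hi 1 ltr01) => alpha h.
  by rewrite ge0_fin_numE//; apply: lt_trans h _; rewrite ltry.
apply/cvgrPdist_lt => e e0; near=> alpha.
have h1 : (ma alpha setT < (fine (m setT) + e)%:E)%E by near: alpha; exact: hi.
have h2 : ((fine (m setT) - e)%:E < ma alpha setT)%E by near: alpha; exact: lo.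
have fin : ma alpha setT \is a fin_num.
  by rewrite ge0_fin_numE//; apply: lt_trans h1 _; rewrite ltry.
move: h1 h2; rewrite -(fineK fin) !lte_fin /= => h1 h2.
by rewrite ltr_norml; apply/andP; split; lra.
Unshelve. all: by end_near. Qed.

Lemma lip_cutoff (r : R) : 0 <= r -> exists eta, [/\ continuous eta,
  forall x, 0 <= eta x <= 1, forall x, `|x| <= r -> eta x = 1,
  forall x, eta x != 0 -> `|x| <= r + 1 &
  forall x y, `|eta x - eta y| <= enorm (x - y)].
Proof.
move=> r0; pose eta x : R := Num.max 0 (Num.min 1 (r + 1 - `|x|)).
have etaL x y : `|eta x - eta y| <= `|x - y|.
  have := ler_dist_dist x y; rewrite /eta ler_norml => /andP[h1 h2].
  move: h1 h2; move: (`|x|) (`|y|) (`|x - y|) (normr_ge0 (x - y)) => a b c c0 h1 h2.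
  rewrite ler_norml; apply/andP.
  by case: (leP 1 (r + 1 - a)) => ?; case: (leP 1 (r + 1 - b)) => ?;
     rewrite ?(max_idPr (ler01)); try (case: (leP 0 (r + 1 - a)) => ?);
     try (case: (leP 0 (r + 1 - b)) => ?); split; lra.
exists eta; split.
- apply: (@klip_continuous _ _ 1 _ ler01) => x y; rewrite mul1r; exact: etaL.
- by move=> x; rewrite /eta le_max lexx/= ge_max ler01/= ge_min lexx.
- move=> x xr; rewrite /eta (min_idPl _) ?(max_idPr _)//.
  by rewrite lerBrDr addrC lerD2r.
- move=> x; apply: contraNle => xr; apply/eqP; rewrite /eta; apply/max_idPl.
  by rewrite ge_min; apply/orP; right; rewrite subr_le0 ltW.
- by move=> x y; apply: le_trans (etaL x y) _; exact: norm_le_enorm.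
Qed.

(** phi is merely continuous, so the upper estimate does not apply to it. The lower estimate for the
    nonnegative functions B eta + phi and B eta - phi, and the upper estimate for the Lipschitz
    cutoff eta, enclose the integral of phi. *)
Lemma cvg_weak_star : weak_star_cvg (1 : R)^'- (fun a => ma a : set 'rV[R]_n -> \bar R) m.
Proof.
move=> phi cphi /compact_supp_sub[k phik].
have [eta [ceta eta01 eta1 etar etaL]] := @lip_cutoff k%:R (ler0n _ _).
have eta0 x : 0 <= eta x by have /andP[] := eta01 x.
have mphi : measurable_fun setT phi by exact: continuous_measurable_rV.
have meta : measurable_fun setT eta by exact: continuous_measurable_rV.
have phir x : phi x != 0 -> `|x| <= k%:R by move=> /phik.
have [B B0 phiB] : exists2 B, 0 <= B & forall x, `|phi x| <= B.
  have := compact_bounded (continuous_compact (continuous_subspaceT cphi) (@compact_cube R n k%:R)).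
  move=> [B [_ HB]]; exists (`|B| + 1); first by rewrite addr_ge0.
  move=> x; have [->|px] := eqVneq (phi x) 0; first by rewrite normr0 addr_ge0.
  apply: HB; first by rewrite ltr_pwDr// ler_norm.
  by exists x => //; exact: phir.
have fint (rho : {measure set 'rV[R]_n -> \bar R}) (h : 'rV[R]_n -> R) (c : R) :
    (forall K, compact K -> (rho K < +oo)%E) -> measurable_fun setT h ->
    (forall x, `|h x| <= c) -> (forall x, h x != 0 -> `|x| <= k%:R + 1) ->
    rho.-integrable setT (EFin \o h).
  by move=> rhoK mh hc hr; exact: (bounded_supp_integrable mh rhoK hc hr).
have phir1 x : phi x != 0 -> `|x| <= k%:R + 1.
  by move=> /phir h; apply: le_trans h _; rewrite lerDl.
have etaB x : `|eta x| <= 1 by have /andP[h0 h1] := eta01 x; rewrite ger0_norm.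
have muK K : compact K -> (mu K < +oo)%E.
  move=> cK; have [j Kj] := compact_sub_cube cK; apply: le_lt_trans (@lebesgue_cube_lty R n j%:R).
  by apply: le_measure; rewrite ?inE//; [exact: measurable_compact_rV|exact: measurable_cube].
have iphi (rho : {measure set 'rV[R]_n -> \bar R})
    (rhoK : forall K, compact K -> (rho K < +oo)%E) := fint rho phi B rhoK mphi phiB phir1.
have ieta (rho : {measure set 'rV[R]_n -> \bar R})
    (rhoK : forall K, compact K -> (rho K < +oo)%E) := fint rho eta 1 rhoK meta etaB etar.
have etaL1 x y : `|eta x - eta y| <= 1 * enorm (x - y) by rewrite mul1r.
have [C domC] := heat_dominated_lip (ieta m mK) (ieta mu muK) eta0 ler01 etaL1.
pose psi (s : R) x := B * eta x + s * phi x.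
have phi_eta x : `|phi x| <= B * eta x.
  have [->|px] := eqVneq (phi x) 0; first by rewrite normr0 mulr_ge0.
  by rewrite eta1 ?mulr1//; exact: phir.
have psi0 s x : `|s| = 1 -> 0 <= psi s x.
  move=> s1; have : `|s * phi x| <= B * eta x by rewrite normrM s1 mul1r.
  by rewrite ler_norml => /andP[h _]; rewrite /psi addrC -lerBlDr sub0r.
have cZ (c : R) (h : 'rV[R]_n -> R) : continuous h -> continuous (fun x => c * h x).
  move=> ch x; apply: (@continuous_comp _ _ _ h (fun t => c * t) x (ch x)).
  exact: mulrl_continuous.
have cpsi s : continuous (psi s).
  by move=> x; exact: (cvgD (cZ B eta ceta x) (cZ s phi cphi x)).
have iZ (rho : {measure set 'rV[R]_n -> \bar R}) (h : 'rV[R]_n -> R) (c : R) :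
    rho.-integrable setT (EFin \o h) -> rho.-integrable setT (EFin \o (fun x => c * h x)).
  move=> ih; rewrite (_ : _ \o _ = (fun x => c%:E * (h x)%:E)%E).
    by apply: integrableZl.
  by apply/funext => x /=; rewrite EFinM.
have psiE (rho : {measure set 'rV[R]_n -> \bar R}) (s : R) :
    (forall K, compact K -> (rho K < +oo)%E) ->
    (\int[rho]_x (psi s x)%:E = (B * \int[rho]_x eta x + s * \int[rho]_x phi x)%:E)%E.
  move=> rhoK; have i1 := iZ _ _ B (ieta _ rhoK); have i2 := iZ _ _ s (iphi _ rhoK).
  rewrite -(RintegralZl B measurableT (ieta _ rhoK)) -(RintegralZl s measurableT (iphi _ rhoK)).
  rewrite -RintegralD// /Rintegral fineK//; apply: integrable_fin_num => //.
  rewrite (_ : (fun x => _) = (fun x => (B * eta x)%:E + (s * phi x)%:E)%E)//.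
  exact: (integrableD measurableT i1 i2).
have E (rho : {measure set 'rV[R]_n -> \bar R}) (h : 'rV[R]_n -> R) :
    rho.-integrable setT (EFin \o h) -> (\int[rho]_x (h x)%:E = (\int[rho]_x h x)%:E)%E.
  by move=> ih; rewrite /Rintegral fineK//; exact: (integrable_fin_num measurableT ih).
rewrite (E _ _ (iphi m mK)).
rewrite (_ : (fun a => _) = (fun a => (\int[ma a]_x phi x)%:E)); last first.
  by apply/funext => a; rewrite (E _ _ (iphi _ (maK a))).
apply/cvg_EFin; first exact: nearW.
(* Half of e is spent on the lower estimates and at most half on B times the upper one; B + 1 guards
   against B = 0. *)
apply/cvgrPdist_lt => e e0; pose d := e / (2 * (B + 1)).
have B10 : 0 < B + 1 by rewrite ltr_wpDl.
have d0 : 0 < d by rewrite divr_gt0// mulr_gt0.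
have Bd : B * d <= e / 2.
  have <- : d * (B + 1) = e / 2 by rewrite /d; field; exact: lt0r_neq0.
  by rewrite mulrDr mulr1 mulrC lerDl ltW.
have lo (s : R) : `|s| = 1 -> \forall alpha \near (1 : R)^'-,
    ((B * \int[m]_x eta x + s * \int[m]_x phi x - e / 2)%:E < \int[ma alpha]_x (psi s x)%:E)%E.
  move=> s1; apply: integral_near_ge; first exact: cpsi.
    by move=> x; exact: psi0.
  by rewrite psiE// lte_fin ltrBlDr ltrDl divr_gt0.
have lo1 := lo 1 (normr1 R).
have lo2 := lo (-1) ltac:(by rewrite normrN normr1).
have hi := integral_near_le ceta eta0 domC d0.
near=> alpha.
have h1 : ((B * \int[m]_x eta x + 1 * \int[m]_x phi x - e / 2)%:E <
    \int[ma alpha]_x (psi 1 x)%:E)%E by near: alpha; exact: lo1.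
have h2 : ((B * \int[m]_x eta x + (-1) * \int[m]_x phi x - e / 2)%:E <
    \int[ma alpha]_x (psi (-1) x)%:E)%E by near: alpha; exact: lo2.
have h3 : (\int[ma alpha]_x (eta x)%:E < (\int[m]_x eta x + d)%:E)%E.
  by near: alpha; exact: hi.
rewrite (psiE _ 1 (maK alpha)) lte_fin in h1.
rewrite (psiE _ (-1) (maK alpha)) lte_fin in h2.
rewrite (E _ _ (ieta _ (maK alpha))) lte_fin in h3.
rewrite /=; move: Bd h1 h2 h3; set I := \int[ma alpha]_x eta x; set I' := \int[m]_x eta x.
set J := \int[ma alpha]_x phi x; set J' := \int[m]_x phi x => Bd h1 h2 h3.
have BI : B * I <= B * I' + B * d by rewrite -mulrDr ler_wpM2l// ltW.
by rewrite ltr_norml; apply/andP; split; lra.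
Unshelve. all: by end_near. Qed.

End convergence.

(** The size of f enters through [tame], common to L^1 and L^oo; integrability is asked for the
    total masses alone. *)
Lemma tame_cvg_variation (R : realType) (n : nat) (hn : (0 < n)%N) (f : 'rV[R]_n -> R) (M : R) :
  tame f M -> finite_variation f ->
  weak_star_cvg 1^'- (fun alpha => radon_variation (grad_frac alpha f))
    (radon_variation (grad f)) /\
  ((lebesgue_rV R n).-integrable setT (EFin \o f) ->
   radon_variation (grad_frac alpha f) setT @[alpha --> (1 : R)^'-] -->
   radon_variation (grad f) setT).
Proof.
move=> ft [[nu gnu] var].
have gradf : is_grad f (grad f) by exact: (getPex (ex_intro [set nu | is_grad f nu] nu gnu)).
have [m0 [sg [m0K msg sg1 m0E pE]]] := radon_polar (grad f) hn.
have m0oo : (m0 setT < +oo)%E by rewrite -m0E.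
have [m mE] := to_finite_measure m0oo.
have pE' (phi : 'rV[R]_n -> 'rV[R]_n) (M' r : R) :
    (forall i, measurable_fun setT (fun x => phi x ord0 i)) ->
    (forall i x, `|phi x ord0 i| <= M') -> (forall x, phi x != 0 -> `|x| <= r) ->
    radon_pairing (grad f) phi = \int[m]_x dot (phi x) (sg x).
  move=> mphi phiM phir; rewrite (pE _ _ _ mphi phiM phir) /Rintegral; congr fine.
  by apply: eq_measure_integral => A _ _; exact: (esym (mE A)).
have /choice[ma maP] alpha := polar_dual hn (grad_frac alpha f).
have maK a : forall K, compact K -> (ma a K < +oo)%E by have [] := maP a.
have maE a : forall B, measurable B -> radon_variation (grad_frac a f) B = ma a B by have [] := maP a.
have ma_ge a : forall (phi : 'rV[R]_n -> 'rV[R]_n) (psi : 'rV[R]_n -> R), lip_c phi -> measurable_fun setT psi ->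
    (forall x, enorm (phi x) <= psi x) ->
    ((radon_pairing (grad_frac a f) phi)%:E <= \int[ma a]_x (psi x)%:E)%E by have [] := maP a.
have ma_le a : forall (psi : 'rV[R]_n -> R) (c : R), continuous psi -> (forall x, 0 <= psi x) ->
    (c%:E < \int[ma a]_x (psi x)%:E)%E -> exists phi : 'rV[R]_n -> 'rV[R]_n,
    [/\ lip_c phi, forall x, enorm (phi x) <= psi x &
    c <= radon_pairing (grad_frac a f) phi] by have [] := maP a.
split=> [phi cphi sphi|iF].
  have h := cvg_weak_star hn ft msg sg1 pE' gradf maK ma_ge ma_le cphi sphi.
  (* The statement integrates against bare set functions, which are exchanged here for the measures
     of the polar decompositions. *)
  rewrite (_ : (fun a => _) = (fun a => \int[ma a]_x (phi x)%:E)%E); last first.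
    by apply/funext => a; apply: eq_setfun_integral => B mB; exact: maE.
  rewrite (_ : (\int[_]_x _ = \int[m]_x (phi x)%:E)%E)//.
  by apply: eq_setfun_integral => B mB; rewrite m0E//; exact: (esym (mE B)).
have h := cvg_total_mass hn ft msg sg1 pE' gradf ma_ge ma_le iF.
have -> : radon_variation (grad f) setT = m setT by rewrite m0E//; exact: (esym (mE _)).
rewrite (_ : (fun a => _) = (fun a => ma a setT))//.
by apply/funext => a; exact: maE.
Qed.

Theorem theorem4p9 (R : realType) (n : nat) (hn : (0 < n)%N)
    (f : 'rV[R]_n -> R) :
  (BV f \/ (bv f /\ f \in Lfun (lebesgue_rV R n) +oo%E) ->
     weak_star_cvg 1^'- (fun alpha => radon_variation (grad_frac alpha f))
       (radon_variation (grad f))) /\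
  (BV f ->
     radon_variation (grad_frac alpha f) setT @[alpha --> (1 : R)^'-] -->
     radon_variation (grad f) setT).
Proof.
split=> [[[f1 vf]|[[[mf _] vf] foo]]|[f1 vf]].
- by have [M ft] := Lfun1_tame f1; have [] := tame_cvg_variation hn ft vf.
- by have [M ft] := Lfuny_tame foo; have [] := tame_cvg_variation hn ft vf.
have [M ft] := Lfun1_tame f1; have [_] := tame_cvg_variation hn ft vf; apply.
exact: (iffLR (Lfun1_integrable _ _)) f1.
Qed.
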